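(* Let $\Bbbk$ be a field of characteristic zero. There is a one-to-one correspondence between graded double Poisson vertex algebras $(\mathcal{V},\partial,\{\!\{-{}_\lambda-\}\!\})$ of degree $-1$ that are freely generated in weights $0$ and $1$, and double Courant--Dorfman algebras $(A,E,\langle\!\langle-,-\rangle\!\rangle,\partial,[\![-,-]\!])$. Under this correspondence $A=\mathcal{V}_0$, $E=\mathcal{V}_1$, the derivation $\partial\colon A\to E$ is the restriction of the derivation of $\mathcal{V}$, and for all $a,b\in A$, $e,f\in E$: $$\{\!\{e{}_\lambda f\}\!\}=[\![e,f]\!]+\langle\!\langle e,f\rangle\!\rangle\lambda,\qquad \{\!\{e{}_\lambda a\}\!\}=\langle\!\langle e,\partial a\rangle\!\rangle,\qquad \{\!\{a{}_\lambda e\}\!\}=-\langle\!\langle \partial a,e\rangle\!\rangle,\qquad \{\!\{a{}_\lambda b\}\!\}=0,$$ where $[\![e,f]\!]\in E\otimes A\oplus A\otimes E$ and $\langle\!\langle e,f\rangle\!\rangle\in A\otimes A$; conversely the double $\lambda$-bracket on $\mathcal{V}$ is the unique extension of these formulas satisfying the left Leibniz rule $\{\!\{a{}_\lambda bc\}\!\}=b\{\!\{a{}_\lambda c\}\!\}+\{\!\{a{}_\lambda b\}\!\}c$.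
   Context: All algebras are associative unital $\Bbbk$-algebras (not necessarily commutative), $\otimes=\otimes_\Bbbk$. Sweedler notation: an element $x$ of a twofold tensor product is written $x'\otimes x''$ with summation suppressed; $(x'\otimes x'')^\sigma=x''\otimes x'$. For an algebra $A$, an $A$-bimodule $E$: the outer bimodule structure on $A\otimes A$ (and on $E\otimes A$, $A\otimes E$) is $a(x'\otimes x'')b=ax'\otimes x''b$; the inner structure on $A\otimes A$ is $a*(x'\otimes x'')*b=x'b\otimes ax''$. For $x=x'\otimes x''$ and $y$ put $x\otimes_1 y:=x'\otimes y\otimes x''$ and $y\otimes_1x:=x'\otimes y\otimes x''$. Double Courant--Dorfman algebras. A derivation $\partial\colon A\to E$ satisfies $\partial(ab)=(\partial a)b+a\partial b$; it acts on $A\otimes A$ by $\partial(x'\otimes x'')=\partial x'\otimes x''+x'\otimes\partial x''\in E\otimes A\oplus A\otimes E$. A pairing is a linear $\langle\!\langle-,-\rangle\!\rangle\colon E\otimes E\to A\otimes A$ such that for each $e$, $f\mapsto\langle\!\langle e,f\rangle\!\rangle$ is a bimodule map $E\to(A\otimes A)_{\mathrm{out}}$ and $f\mapsto\langle\!\langle f,e\rangle\!\rangle$ is a bimodule map $E\to(A\otimes A)_{\mathrm{inn}}$; it is symmetric if $\langle\!\langle e,f\rangle\!\rangle=\langle\!\langle f,e\rangle\!\rangle^\sigma$. Extend it additively to $A^{\otimes3}$-valued maps: $\langle\!\langle e,f\otimes a\rangle\!\rangle_L=\langle\!\langle e,f\rangle\!\rangle\otimes a$, $\langle\!\langle e,a\otimes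 f\rangle\!\rangle_L=0$, $\langle\!\langle e,a\otimes f\rangle\!\rangle_R=a\otimes\langle\!\langle e,f\rangle\!\rangle$, $\langle\!\langle e,f\otimes a\rangle\!\rangle_R=0$, $\langle\!\langle e\otimes a,f\rangle\!\rangle_L=\langle\!\langle e,f\rangle\!\rangle'\otimes a\otimes\langle\!\langle e,f\rangle\!\rangle''$, $\langle\!\langle a\otimes e,f\rangle\!\rangle_L=0$, $\langle\!\langle a\otimes e,f\rangle\!\rangle_R=\langle\!\langle e,f\rangle\!\rangle'\otimes a\otimes\langle\!\langle e,f\rangle\!\rangle''$, $\langle\!\langle e\otimes a,f\rangle\!\rangle_R=0$. Let $T_AE$ be the tensor algebra with $E$ in degree 1. A double Courant--Dorfman bracket is a linear map $[\![-,-]\!]\colon T_AE\otimes T_AE\to T_AE\otimes T_AE$ of degree $-1$ with $[\![e,a]\!]=\langle\!\langle e,\partial a\rangle\!\rangle$, $[\![a,e]\!]=-\langle\!\langle\partial a,e\rangle\!\rangle$, $[\![a,b]\!]=0$ ($a,b\in A$, $e\in E$); for $e,f\in E$ write $[\![e,f]\!]=[\![e,f]\!]_l+[\![e,f]\!]_r\in E\otimes A\oplus A\otimes E$. Extensions (additive, valued in $E\otimes A\otimes A\oplus A\otimes E\otimes A\oplus A\otimes A\otimes E$): $[\![e,f\otimes a]\!]_L=[\![e,f]\!]\otimes a$, $[\![e,a\otimes f]\!]_L=\langle\!\langle e,\partial a\rangle\!\rangle\otimes f$, $[\![e,f\otimes a]\!]_R=f\otimes\langle\!\langle e,\partial a\rangle\!\rangle$,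 $[\![e,a\otimes f]\!]_R=a\otimes[\![e,f]\!]$, $[\![e\otimes a,f]\!]_L=[\![e,f]\!]\otimes_1a+\langle\!\langle e,f\rangle\!\rangle\otimes_1\partial a$, $[\![a\otimes e,f]\!]_L=-\langle\!\langle\partial a,f\rangle\!\rangle\otimes_1e$. A double Courant--Dorfman algebra is $(A,E,\langle\!\langle-,-\rangle\!\rangle,\partial,[\![-,-]\!])$ with symmetric pairing, derivation $\partial$ and double Courant--Dorfman bracket such that for all $a,b\in A$, $e,f,g\in E$: (1) $\partial\langle\!\langle e,f\rangle\!\rangle=[\![e,f]\!]+[\![f,e]\!]^\sigma$; (2) $[\![\partial a,e]\!]=0$; (3) $\langle\!\langle\partial a,\partial b\rangle\!\rangle=0$; (4) $[\![e,fa]\!]=[\![e,f]\!]a+f\langle\!\langle e,\partial a\rangle\!\rangle$; (5) $[\![e,af]\!]=a[\![e,f]\!]+\langle\!\langle e,\partial a\rangle\!\rangle f$ (outer structure); (6) $[\![e,[\![f,g]\!]]\!]_L=[\![f,[\![e,g]\!]]\!]_R+[\![[\![e,f]\!],g]\!]_L$; (7) $\langle\!\langle e,\partial\langle\!\langle f,g\rangle\!\rangle\rangle\!\rangle_L=\langle\!\langle f,[\![e,g]\!]\rangle\!\rangle_R+\langle\!\langle[\![e,f]\!],g\rangle\!\rangle_L$. Double Poisson vertex algebras. A differential algebra $(\mathcal{V},\partial)$ is an algebra with a derivation; $\partial$ acts on tensor products by the Leibniz rule. A double $\lambda$-bracket is a linear map $\{\!\{-{}_\lambda-\}\!\}\colon\mathcal{V}\otimes\mathcal{V}\to(\mathcal{V}\otimes\mathcal{V})[\lambda]$;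 write $\{\!\{a{}_\lambda b\}\!\}=\sum_p(a_pb)'\otimes(a_pb)''\lambda^p$. It must satisfy, for all $a,b,c$: $\{\!\{\partial a{}_\lambda b\}\!\}=-\lambda\{\!\{a{}_\lambda b\}\!\}$; $\{\!\{a{}_\lambda\partial b\}\!\}=(\lambda+\partial)\{\!\{a{}_\lambda b\}\!\}$; $\{\!\{a{}_\lambda bc\}\!\}=b\{\!\{a{}_\lambda c\}\!\}+\{\!\{a{}_\lambda b\}\!\}c$ (outer structure); $\{\!\{ab{}_\lambda c\}\!\}=\sum_p(a_pc)'\big((\lambda+\partial)^pb\big)\otimes(a_pc)''+\sum_p\sum_{j}\binom{p}{j}(b_pc)'\otimes(\partial^ja)(b_pc)''\lambda^{p-j}$. A double Poisson vertex algebra is such $(\mathcal{V},\partial,\{\!\{-{}_\lambda-\}\!\})$ satisfying skewsymmetry $\{\!\{a{}_\lambda b\}\!\}=-\sum_p(-\lambda-\partial)^p\big((b_pa)''\otimes(b_pa)'\big)$ and the Jacobi identity $\sum_{p,q}(a_p(b_qc)')'\otimes(a_p(b_qc)')''\otimes(b_qc)''\lambda^p\mu^q=\sum_{p,q}(a_pc)'\otimes(b_q(a_pc)'')'\otimes(b_q(a_pc)'')''\lambda^p\mu^q+\sum_{p,q}((a_pb)'_qc)'\otimes(\lambda+\mu+\partial)^q(a_pb)''\otimes((a_pb)'_qc)''\lambda^p$. It is graded of degree $-1$ if $\mathcal{V}=\bigoplus_{k\ge0}\mathcal{V}_k$ with $\mathcal{V}_i\mathcal{V}_j\subseteq\mathcal{V}_{i+j}$,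 $\partial\mathcal{V}_k\subseteq\mathcal{V}_{k+1}$, and $(v_qw)'\otimes(v_qw)''\in(\mathcal{V}\otimes\mathcal{V})_{i+j-q-1}$ for $v\in\mathcal{V}_i$, $w\in\mathcal{V}_j$. Then $A=\mathcal{V}_0$ is an algebra, $E=\mathcal{V}_1$ an $A$-bimodule, and $\partial|_A\colon A\to E$ a derivation. For an algebra $A$, $A$-bimodule $E$ and derivation $\partial\colon A\to E$, let $\mathcal{V}'$ be the free graded associative $A$-algebra with a derivation $T$ of degree 1 generated by $E$ in degree 1, and $\mathcal{V}(A,E,\partial)$ its quotient by the differential ideal generated by $(T-\partial)a$, $a\in A$, with derivation induced by $T$. The graded algebra $\mathcal{V}$ is freely generated in weights 0 and 1 if the natural map $\mathcal{V}(\mathcal{V}_0,\mathcal{V}_1,\partial|_{\mathcal{V}_0})\to\mathcal{V}$ is an isomorphism. *)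

(* Defs.v *)
(* Double Poisson vertex algebras vs double Courant--Dorfman
   algebras.  Tensor products over k are represented by finite lists of
   elementary tensors, compared by the universal property of the tensor
   product (equality after every k-bilinear / k-trilinear map). *)
From HB Require Import structures.
From mathcomp Require Import all_boot all_order all_algebra.
Set Implicit Arguments. Unset Strict Implicit. Unset Printing Implicit Defensive.
Import GRing.Theory.
Local Open Scope ring_scope.

Section DefsAlg.
Variable k : fieldType.
Variable V : algType k.

(* representatives of elements of V (x) V, V (x) V (x) V, (V (x) V)[lambda],
   (V (x) V (x) V)[lambda, mu] (lists of monomials) *)
Definition T2 := seq (V * V).
Definition T3 := seq (V * V * V).
Definition P2 := seq (nat * (V * V)).
Definition P3 := seq (nat * nat * (V * V * V)).

Definition bilin (W : lmodType k) (b : V -> V -> W) :=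
  forall (c : k) x y z,
    b (c *: x + y) z = c *: b x z + b y z /\ b z (c *: x + y) = c *: b z x + b z y.

Definition trilin (W : lmodType k) (b : V -> V -> V -> W) :=
  forall (c : k) x y z w,
    [/\ b (c *: x + y) z w = c *: b x z w + b y z w,
        b z (c *: x + y) w = c *: b z x w + b z y w &
        b z w (c *: x + y) = c *: b z w x + b z w y].

Definition t2eq (s t : T2) : Prop :=
  forall (W : lmodType k) (b : V -> V -> W), bilin b ->
    \sum_(p <- s) b p.1 p.2 = \sum_(p <- t) b p.1 p.2.

Definition t3eq (s t : T3) : Prop :=
  forall (W : lmodType k) (b : V -> V -> V -> W), trilin b ->
    \sum_(p <- s) b p.1.1 p.1.2 p.2 = \sum_(p <- t) b p.1.1 p.1.2 p.2.

Definition coef2 (P : P2) (n : nat) : T2 := [seq m.2 | m <- P & m.1 == n].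
Definition p2eq (P Q : P2) : Prop := forall n, t2eq (coef2 P n) (coef2 Q n).
Definition coef3 (P : P3) (n m : nat) : T3 := [seq x.2 | x <- P & x.1 == (n, m)].
Definition p3eq (P Q : P3) : Prop := forall n m, t3eq (coef3 P n m) (coef3 Q n m).

Definition sc2 (c : k) (t : T2) : T2 := [seq (c *: p.1, p.2) | p <- t].
Definition scP2 (c : k) (P : P2) : P2 := [seq (m.1, (c *: m.2.1, m.2.2)) | m <- P].
Definition sig2 (t : T2) : T2 := [seq (p.2, p.1) | p <- t].
Definition lmul2 (a : V) (t : T2) : T2 := [seq (a * p.1, p.2) | p <- t].
Definition rmul2 (t : T2) (a : V) : T2 := [seq (p.1, p.2 * a) | p <- t].
Definition hom2 (P Q : V -> Prop) (t : T2) := forall p, p \in t -> P p.1 /\ Q p.2.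

Definition klinear (f : V -> V) := forall (c : k) x y, f (c *: x + y) = c *: f x + f y.

Section WithD.
Variable d : V -> V.

Definition D2 (t : T2) : T2 := flatten [seq [:: (d p.1, p.2); (p.1, d p.2)] | p <- t].

Definition derivation := klinear d /\ forall x y, d (x * y) = d x * y + x * d y.

Variable br : V -> V -> P2.

Definition br_bilin := forall (c : k) x y z,
  p2eq (br (c *: x + y) z) (scP2 c (br x z) ++ br y z) /\
  p2eq (br z (c *: x + y)) (scP2 c (br z x) ++ br z y).

Definition sesq_l := forall a b,
  p2eq (br (d a) b) [seq (m.1.+1, (- m.2.1, m.2.2)) | m <- br a b].

Definition sesq_r := forall a b,
  p2eq (br a (d b))
    ([seq (m.1.+1, m.2) | m <- br a b] ++
     flatten [seq [seq (m.1, z) | z <- D2 [:: m.2]] | m <- br a b]).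

Definition leibniz_l := forall a b c,
  p2eq (br a (b * c))
    ([seq (m.1, (b * m.2.1, m.2.2)) | m <- br a c] ++
     [seq (m.1, (m.2.1, m.2.2 * c)) | m <- br a b]).

Definition leibniz_r := forall a b c,
  p2eq (br (a * b) c)
    (flatten [seq [seq ((m.1 - j)%N,
                        (('C(m.1, j))%:R *: (m.2.1 * iter j d b), m.2.2))
                  | j <- iota 0 m.1.+1] | m <- br a c] ++
     flatten [seq [seq ((m.1 - j)%N,
                        (('C(m.1, j))%:R *: m.2.1, iter j d a * m.2.2))
                  | j <- iota 0 m.1.+1] | m <- br b c]).

Definition double_lambda_bracket :=
  [/\ br_bilin, sesq_l, sesq_r, leibniz_l & leibniz_r].

Definition skewsym := forall a b,
  p2eq (br a b)
    (flatten [seq flatten [seq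
        [seq ((m.1 - j)%N, (- ((-1) ^+ m.1 * ('C(m.1, j))%:R) *: z.1, z.2))
        | z <- iter j D2 [:: (m.2.2, m.2.1)]]
      | j <- iota 0 m.1.+1] | m <- br b a]).

Definition jacobi := forall a b c,
  p3eq
    (flatten [seq [seq ((p.1, q.1), (p.2.1, p.2.2, q.2.2)) | p <- br a q.2.1]
             | q <- br b c])
    (flatten [seq [seq ((p.1, q.1), (p.2.1, q.2.1, q.2.2)) | q <- br b p.2.2]
             | p <- br a c] ++
     flatten [seq flatten [seq flatten [seq
        [seq (((p.1 + i)%N, j),
              (q.2.1,
               iter (q.1 - i - j) d p.2.2 *+ ('C(q.1, i) * 'C(q.1 - i, j)),
               q.2.2))
        | j <- iota 0 (q.1 - i).+1]
      | i <- iota 0 q.1.+1] | q <- br p.2.1 c] | p <- br a b]).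

Definition double_PVA := [/\ double_lambda_bracket, skewsym & jacobi].

End WithD.

Section Graded.
Variable Vg : nat -> V -> Prop.

Definition graded_alg :=
  [/\ (forall n, Vg n 0 /\ forall (c : k) x y, Vg n x -> Vg n y -> Vg n (c *: x + y)),
      (forall v, exists (N : nat) (c : nat -> V),
          (forall i, Vg i (c i)) /\ v = \sum_(i < N) c i),
      (forall (N : nat) (c : nat -> V), (forall i, Vg i (c i)) ->
          \sum_(i < N) c i = 0 -> forall i, (i < N)%N -> c i = 0) &
      (forall i j x y, Vg i x -> Vg j y -> Vg (i + j)%N (x * y))].

Definition graded_diff_alg (d : V -> V) :=
  [/\ graded_alg, derivation d & forall n x, Vg n x -> Vg n.+1 (d x)].

(* (V (x) V)_n, for n : int (zero if n < 0) *)
Definition inVV (n : int) (t : T2) :=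
  exists t' : T2, t2eq t t' /\
    forall p, p \in t' -> exists r s : nat, (r + s)%N%:Z = n /\ Vg r p.1 /\ Vg s p.2.

Definition bracket_degree_m1 (br : V -> V -> P2) :=
  forall (i j q : nat) v w, Vg i v -> Vg j w ->
    inVV (i%:Z + j%:Z - q%:Z - 1) (coef2 (br v w) q).

Definition graded_double_PVA (d : V -> V) (br : V -> V -> P2) :=
  double_PVA d br /\ bracket_degree_m1 br.

Local Notation A := (Vg 0%N).
Local Notation E := (Vg 1%N).

Definition ext_hom (W : algType k) (D : W -> W) (psi0 psi1 : V -> W) (d : V -> V)
    (Psi : V -> W) :=
  [/\ (forall (c : k) x y, Psi (c *: x + y) = c *: Psi x + Psi y),
      (forall x y, Psi (x * y) = Psi x * Psi y) /\ Psi 1 = 1,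
      (forall x, Psi (d x) = D (Psi x)),
      (forall a, A a -> Psi a = psi0 a) &
      (forall e, E e -> Psi e = psi1 e)].

(* V is freely generated in weights 0 and 1: V together with the inclusions
   of A = V_0 and E = V_1 has the universal property of V(A, E, d|_A) *)
Definition freely_generated (d : V -> V) :=
  forall (W : algType k) (D : W -> W) (psi0 psi1 : V -> W),
    (forall (c : k) x y, D (c *: x + y) = c *: D x + D y) ->
    (forall x y, D (x * y) = D x * y + x * D y) ->
    (forall (c : k) a b, A a -> A b -> psi0 (c *: a + b) = c *: psi0 a + psi0 b) ->
    (forall a b, A a -> A b -> psi0 (a * b) = psi0 a * psi0 b) ->
    psi0 1 = 1 ->
    (forall (c : k) e f, E e -> E f -> psi1 (c *: e + f) = c *: psi1 e + psi1 f) ->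
    (forall a e b, A a -> E e -> A b -> psi1 (a * e * b) = psi0 a * psi1 e * psi0 b) ->
    (forall a, A a -> D (psi0 a) = psi1 (d a)) ->
    exists Psi : V -> W, ext_hom D psi0 psi1 d Psi /\
      forall Psi' : V -> W, ext_hom D psi0 psi1 d Psi' -> forall x, Psi' x = Psi x.

Section CD.
Variable d : V -> V.
Variables (pr cb : V -> V -> T2).

Definition in_EA_AE (t : T2) :=
  exists tl tr, t2eq t (tl ++ tr) /\ hom2 E A tl /\ hom2 A E tr.

Definition pairing_axioms :=
  [/\ (forall e f, E e -> E f -> exists t, t2eq (pr e f) t /\ hom2 A A t),
      (forall (c : k) e e' f, E e -> E e' -> E f ->
          t2eq (pr (c *: e + e') f) (sc2 c (pr e f) ++ pr e' f) /\
          t2eq (pr f (c *: e + e')) (sc2 c (pr f e) ++ pr f e')),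
      (forall a e f b, A a -> E e -> E f -> A b ->
          t2eq (pr e (a * f * b)) [seq (a * p.1, p.2 * b) | p <- pr e f]),
      (forall a e f b, A a -> E e -> E f -> A b ->
          t2eq (pr (a * f * b) e) [seq (p.1 * b, a * p.2) | p <- pr f e]) &
      (forall e f, E e -> E f -> t2eq (pr e f) (sig2 (pr f e)))].

Definition bracket_axioms :=
  (forall e f, E e -> E f -> in_EA_AE (cb e f)) /\
  (forall (c : k) e e' f, E e -> E e' -> E f ->
      t2eq (cb (c *: e + e') f) (sc2 c (cb e f) ++ cb e' f) /\
      t2eq (cb f (c *: e + e')) (sc2 c (cb f e) ++ cb f e')).

Definition CD1 := forall e f, E e -> E f ->
  t2eq (D2 d (pr e f)) (cb e f ++ sig2 (cb f e)).
Definition CD2 := forall a e, A a -> E e -> t2eq (cb (d a) e) [::].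
Definition CD3 := forall a b, A a -> A b -> t2eq (pr (d a) (d b)) [::].
Definition CD4 := forall a e f, A a -> E e -> E f ->
  t2eq (cb e (f * a)) (rmul2 (cb e f) a ++ lmul2 f (pr e (d a))).
Definition CD5 := forall a e f, A a -> E e -> E f ->
  t2eq (cb e (a * f)) (lmul2 a (cb e f) ++ rmul2 (pr e (d a)) f).

(* [[e,[[f,g]]]]_L = [[f,[[e,g]]]]_R + [[[[e,f]],g]]_L, computed on
   representatives of [[f,g]], [[e,g]], [[e,f]] split into E(x)A and A(x)E parts *)
Definition CD6 := forall e f g (tl1 tr1 tl2 tr2 tl3 tr3 : T2),
  E e -> E f -> E g ->
  t2eq (cb f g) (tl1 ++ tr1) -> hom2 E A tl1 -> hom2 A E tr1 ->
  t2eq (cb e g) (tl2 ++ tr2) -> hom2 E A tl2 -> hom2 A E tr2 ->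
  t2eq (cb e f) (tl3 ++ tr3) -> hom2 E A tl3 -> hom2 A E tr3 ->
  t3eq
    (flatten [seq [seq (x.1, x.2, p.2) | x <- cb e p.1] | p <- tl1] ++
     flatten [seq [seq (x.1, x.2, p.2) | x <- pr e (d p.1)] | p <- tr1])
    ((flatten [seq [seq (p.1, x.1, x.2) | x <- pr f (d p.2)] | p <- tl2] ++
      flatten [seq [seq (p.1, x.1, x.2) | x <- cb f p.2] | p <- tr2]) ++
     (flatten [seq [seq (x.1, p.2, x.2) | x <- cb p.1 g] ++
                   [seq (x.1, d p.2, x.2) | x <- pr p.1 g] | p <- tl3] ++
      flatten [seq [seq (- x.1, p.2, x.2) | x <- pr (d p.1) g] | p <- tr3])).

(* <<e, d<<f,g>> >>_L = <<f,[[e,g]]>>_R + <<[[e,f]],g>>_L *)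
Definition CD7 := forall e f g (s tl2 tr2 tl3 tr3 : T2),
  E e -> E f -> E g ->
  t2eq (pr f g) s -> hom2 A A s ->
  t2eq (cb e g) (tl2 ++ tr2) -> hom2 E A tl2 -> hom2 A E tr2 ->
  t2eq (cb e f) (tl3 ++ tr3) -> hom2 E A tl3 -> hom2 A E tr3 ->
  t3eq
    (flatten [seq [seq (x.1, x.2, p.2) | x <- pr e (d p.1)] | p <- s])
    (flatten [seq [seq (p.1, x.1, x.2) | x <- pr f p.2] | p <- tr2] ++
     flatten [seq [seq (x.1, p.2, x.2) | x <- pr p.1 g] | p <- tl3]).

Definition double_CD :=
  [/\ pairing_axioms, bracket_axioms, CD1, CD2 & [/\ CD3, CD4, CD5, CD6 & CD7]].

Definition corresponds (br : V -> V -> P2) :=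
  forall e f a b, E e -> E f -> A a -> A b ->
  [/\ p2eq (br e f) ([seq (0%N, p) | p <- cb e f] ++ [seq (1%N, p) | p <- pr e f]),
      p2eq (br e a) [seq (0%N, p) | p <- pr e (d a)],
      p2eq (br a e) [seq (0%N, (- p.1, p.2)) | p <- pr (d a) e] &
      p2eq (br a b) [::]].

End CD.
End Graded.
End DefsAlg.

Definition bimodule_with_derivation (k : fieldType) (A : algType k) (E : lmodType k)
    (la : A -> E -> E) (ra : E -> A -> E) (dA : A -> E) :=
  [/\ (forall (c : k) a a' e, la (c *: a + a') e = c *: la a e + la a' e
                            /\ ra e (c *: a + a') = c *: ra e a + ra e a'),
      (forall (c : k) a e e', la a (c *: e + e') = c *: la a e + la a e'
                            /\ ra (c *: e + e') a = c *: ra e a + ra e' a),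
      (forall a b e, la (a * b) e = la a (la b e) /\ ra e (a * b) = ra (ra e a) b
                     /\ la a (ra e b) = ra (la a e) b),
      (forall e, la 1 e = e /\ ra e 1 = e) &
      ((forall (c : k) a b, dA (c *: a + b) = c *: dA a + dA b) /\
       (forall a b, dA (a * b) = ra (dA a) b + la a (dA b)))].

(* Main.v *)
(** Tensor products are realised as quotients of free modules by equality under
    all multilinear maps, so that (V (x) V)[lambda] is a module with a universal
    property. It carries two differential V-bimodule structures: the outer one,
    with operator lambda + d, and an inner one, twisted by lambda |-> lambda + d,
    with operator - lambda. They commute, and the reversal
    lambda |-> - lambda - d, x (x) y |-> y (x) x exchanges them. A double lambda-bracket
    is the same thing as a map that is an outer derivation in its second argument
    and an inner derivation in its first one.

    A derivation of V into a differential bimodule M is a differential algebra map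
    into the square-zero extension V (+) M; hence, if V is freely generated by A and E,
    it is determined by, and may be prescribed on, A and E. From a double
    Courant-Dorfman algebra the bracket is therefore obtained by extending first
    in the second and then in the first argument, and its properties are checked
    on A and E. The Jacobi identity has the form
    J(a,b,c) = L(a,b,c) + rho L(b,c,a) + rho^2 L(c,a,b), where rho is the cyclic
    rotation of (V (x) V (x) V)[lambda, mu] of order 3, and J is an outer derivation
    in c; by cyclicity it too may be checked on generators. For e, f, g in E the
    coefficients of 1 and mu in J(e,f,g) are the last two axioms of a double
    Courant-Dorfman algebra, and the coefficient of lambda is a rotation of that
    of mu. *)
Require Import Defs.
From HB Require Import structures.
From mathcomp Require Import all_boot all_order all_algebra.
From mathcomp Require Import boolp.
Set Implicit Arguments. Unset Strict Implicit. Unset Printing Implicit Defensive.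
Import GRing.Theory.
Local Open Scope ring_scope.

(** * Tensor products *)

(** Quantification over all test modules, or over all models, takes place in Prop. The quotients
    therefore stay in the universe of V and are themselves among the objects tested against, which
    makes them universal. The obstacle in prescribing a bracket on generators is that an extension
    made by the left Leibniz rule must also obey the right one. The twist of the inner structure is
    chosen so that inner operations are endomorphisms of the outer differential bimodule, and
    conversely. Every consistency condition then becomes an equality of derivations in the other
    argument, to be tested again only on A and E. Freeness enters in two ways: existence of maps
    yields extensions of derivations, and uniqueness yields an induction principle on V. For the
    Jacobi identity put nu = - lambda - mu - d. The rotation rho permutes lambda, mu, nu cyclically
    along with the three tensor factors. Without it only the last argument of J could be reduced to
    generators, since the Leibniz rule of J in the first two is not directly visible. *)

Section ClassicalQuotient.
Variables (T : Type) (R : T -> T -> Prop).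
(** Classes are predicates, so extensionality identifies the classes of related representatives;
    decidable equality and choice on them are the classical ones. *)
Definition quo := {P : T -> Prop | exists t, P = R t}.
HB.instance Definition _ := gen_eqMixin quo.
HB.instance Definition _ := gen_choiceMixin quo.
Definition cls (t : T) : quo := exist _ (R t) (ex_intro _ t erefl).
Definition rep (x : quo) : T := projT1 (cid (svalP x)).
Lemma quo_eq (x y : quo) : sval x = sval y -> x = y.
Proof.
case: x y => [P hP] [Q hQ] /= PQ; rewrite -PQ in hQ *.
by rewrite (Prop_irrelevance hP hQ).
Qed.
Lemma repK x : cls (rep x) = x.
Proof. by apply: quo_eq; rewrite /= /rep; case: (cid _) => t /= ->. Qed.
Hypotheses (Rrefl : forall t, R t t) (Rsym : forall s t, R s t -> R t s)
  (Rtr : forall s t u, R s t -> R t u -> R s u).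
Lemma clsP s t : cls s = cls t <-> R s t.
Proof.
split=> [/(congr1 (@sval _ _)) /= ->|Rst]; first exact: Rrefl.
apply: quo_eq => /=; apply/funext => u; apply/propext.
by split; [exact: Rtr (Rsym Rst) | exact: Rtr Rst].
Qed.
End ClassicalQuotient.

Section FreeModule.
Variables (k : fieldType) (X : Type) (adm : forall W : lmodType k, (X -> W) -> Prop).

Definition evl (W : lmodType k) (b : X -> W) (s : seq (k * X)) : W :=
  \sum_(p <- s) p.1 *: b p.2.
(** [adm] will single out the multilinear maps. Equality under all of them imposes exactly the
    multilinear relations on formal combinations of elements of X. *)
Definition meq (s t : seq (k * X)) : Prop :=
  forall (W : lmodType k) (b : X -> W), adm b -> evl b s = evl b t.
Definition fmod := quo meq.
HB.instance Definition _ := Choice.on fmod.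

Let cl : seq (k * X) -> fmod := @cls _ meq.

Lemma meqP s t : cl s = cl t <-> meq s t.
Proof.
by apply: clsP => [u|u v uv|u v w uv vw] W b hb; rewrite ?uv ?vw.
Qed.

Lemma evl_rep (W : lmodType k) (b : X -> W) s : adm b -> evl b (rep (cl s)) = evl b s.
Proof.
move=> hb; have : meq (rep (cl s)) s by apply/meqP; rewrite /cl repK.
exact.
Qed.

Lemma evl_cat (W : lmodType k) (b : X -> W) s t : evl b (s ++ t) = evl b s + evl b t.
Proof. exact: big_cat. Qed.

Definition scs (c : k) (s : seq (k * X)) := [seq (c * p.1, p.2) | p <- s].

Lemma evl_scs (W : lmodType k) (b : X -> W) c s : evl b (scs c s) = c *: evl b s.
Proof.
by rewrite /evl big_map scaler_sumr; apply: eq_bigr => p _; rewrite scalerA.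
Qed.

Definition fadd (x y : fmod) : fmod := cl (rep x ++ rep y).
Definition fscale c (x : fmod) : fmod := cl (scs c (rep x)).

Lemma fmod_eq (x y : fmod) :
  (forall (W : lmodType k) (b : X -> W), adm b -> evl b (rep x) = evl b (rep y)) -> x = y.
Proof. by move=> h; rewrite -[x]repK -[y]repK; apply/meqP. Qed.

Lemma evl_add (W : lmodType k) (b : X -> W) x y : adm b ->
  evl b (rep (fadd x y)) = evl b (rep x) + evl b (rep y).
Proof. by move=> hb; rewrite evl_rep // evl_cat. Qed.

Lemma evl_fscale (W : lmodType k) (b : X -> W) c x : adm b ->
  evl b (rep (fscale c x)) = c *: evl b (rep x).
Proof. by move=> hb; rewrite evl_rep // evl_scs. Qed.

Lemma evl_zero (W : lmodType k) (b : X -> W) : adm b -> evl b (rep (cl [::])) = 0.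
Proof. by move=> hb; rewrite evl_rep // /evl big_nil. Qed.

Let evlE := (evl_add, evl_fscale, evl_zero).

Lemma faddA : associative fadd.
Proof. by move=> x y z; apply: fmod_eq => W b hb; rewrite !evlE // addrA. Qed.
Lemma faddC : commutative fadd.
Proof. by move=> x y; apply: fmod_eq => W b hb; rewrite !evlE // addrC. Qed.
Lemma fadd0 : left_id (cl [::]) fadd.
Proof. by move=> x; apply: fmod_eq => W b hb; rewrite !evlE // add0r. Qed.
Lemma faddN : left_inverse (cl [::]) (fscale (-1)) fadd.
Proof. by move=> x; apply: fmod_eq => W b hb; rewrite !evlE // scaleN1r addNr. Qed.
HB.instance Definition _ := GRing.isZmodule.Build fmod faddA faddC fadd0 faddN.

Lemma fscaleA a b v : fscale a (fscale b v) = fscale (a * b) v.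
Proof. by apply: fmod_eq => W f hb; rewrite !evlE // scalerA. Qed.
Lemma fscale1 : left_id 1 fscale.
Proof. by move=> v; apply: fmod_eq => W f hb; rewrite !evlE // scale1r. Qed.
Lemma fscaleDr : right_distributive fscale +%R.
Proof. by move=> a u v; apply: fmod_eq => W f hb; rewrite !evlE // scalerDr. Qed.
Lemma fscaleDl v : {morph fscale^~ v : a b / a + b}.
Proof. by move=> a b; apply: fmod_eq => W f hb; rewrite !evlE // scalerDl. Qed.
HB.instance Definition _ :=
  GRing.Zmodule_isLmodule.Build k fmod fscaleA fscale1 fscaleDr fscaleDl.

Definition fgen (x : X) : fmod := locked (cl [:: (1, x)]).

Definition flift_fun (W : lmodType k) (b : X -> W) (hb : adm b) (x : fmod) : W :=
  locked (evl b (rep x)).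
Lemma flift_linear (W : lmodType k) (b : X -> W) (hb : adm b) : linear (flift_fun hb).
Proof. by move=> c x y; rewrite /flift_fun -!lock [in LHS]evl_add // evl_fscale. Qed.
HB.instance Definition _ (W : lmodType k) (b : X -> W) (hb : adm b) :=
  GRing.isLinear.Build k fmod W _ (flift_fun hb) (flift_linear hb).
Definition flift (W : lmodType k) (b : X -> W) (hb : adm b) : {linear fmod -> W} :=
  flift_fun hb.

Lemma flift_gen (W : lmodType k) (b : X -> W) (hb : adm b) x : flift hb (fgen x) = b x.
Proof. by rewrite /= /flift_fun /fgen -!lock evl_rep // /evl big_seq1 scale1r. Qed.

Lemma fmod_liftP (x y : fmod) :
  (forall (W : lmodType k) (b : X -> W) (hb : adm b), flift hb x = flift hb y) -> x = y.
Proof. by move=> h; apply: fmod_eq => W b hb; by have := h W b hb; rewrite /= /flift_fun -!lock. Qed.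

Lemma fmod_span (x : fmod) : exists s : seq (k * X), x = \sum_(p <- s) p.1 *: fgen p.2.
Proof.
exists (rep x); apply: fmod_liftP => W b hb; rewrite linear_sum.
rewrite /= {1}/flift_fun -lock; apply: eq_bigr => p _.
by rewrite linearZZ; congr (_ *: _); rewrite -[LHS](flift_gen hb).
Qed.
End FreeModule.

Section BilinTheory.
Variables (k : fieldType) (V : algType k) (W : lmodType k).

Section Two.
Variables (b : V -> V -> W) (hb : bilin b).
Lemma bilinl z : linear (b^~ z). Proof. by move=> c x y; case: (hb c x y z). Qed.
Lemma bilinr z : linear (b z). Proof. by move=> c x y; case: (hb c x y z). Qed.
End Two.

Lemma linear_bilin (b : V -> V -> W) :
  (forall z, linear (b^~ z)) -> (forall z, linear (b z)) -> bilin b.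
Proof. by move=> hl hr c x y z; rewrite hr (hl z). Qed.

Lemma linear_trilin (b : V -> V -> V -> W) :
  (forall z w, linear (fun x => b x z w)) -> (forall z w, linear (fun x => b z x w)) ->
  (forall z w, linear (b z w)) -> trilin b.
Proof. by move=> h1 h2 h3 c x y z w; rewrite h3 (h2 z w) (h1 z w). Qed.

Lemma bilin_cond (P : bool) (b : V -> V -> W) :
  bilin b -> bilin (fun x y => if P then b x y else 0).
Proof. by case: P => // _ c x y z; rewrite scaler0 addr0. Qed.
Lemma trilin_cond (P : bool) (b : V -> V -> V -> W) :
  trilin b -> trilin (fun x y z => if P then b x y z else 0).
Proof. by case: P => // _ c x y z w; rewrite scaler0 addr0. Qed.

End BilinTheory.

Definition mklin (k : fieldType) (U W : lmodType k) (f : U -> W) (hf : linear f) :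
  {linear U -> W} := HB.pack f (GRing.isLinear.Build k U W _ f hf).

Section LinearFunctions.
Variables (k : fieldType) (U W : lmodType k) (f : U -> W) (hf : linear f).
Lemma lin_D x y : f (x + y) = f x + f y. Proof. exact: (linearD (mklin hf)). Qed.
Lemma lin_0 : f 0 = 0. Proof. exact: (linear0 (mklin hf)). Qed.
Lemma lin_N x : f (- x) = - f x. Proof. exact: (linearN (mklin hf)). Qed.
Lemma lin_Z c x : f (c *: x) = c *: f x. Proof. exact: (linearZZ (mklin hf)). Qed.
Lemma lin_sum I (r : seq I) (P : pred I) F :
  f (\sum_(i <- r | P i) F i) = \sum_(i <- r | P i) f (F i).
Proof. exact: (linear_sum (mklin hf)). Qed.
End LinearFunctions.

Section Tensor2.
Variables (k : fieldType) (V : algType k).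

(* [M2] is (V (x) V)[lambda]; [mon2 n x y] is x (x) y lambda^n. *)
Definition adm2 (W : lmodType k) (b : nat * (V * V) -> W) :=
  forall n, bilin (fun x y => b (n, (x, y))).
Definition M2 := fmod adm2.
HB.instance Definition _ := GRing.Lmodule.on M2.

Definition mon2 n (x y : V) : M2 := fgen adm2 (n, (x, y)).
Definition tens2 := mon2 0.

Lemma mon2_bilin n : bilin (mon2 n).
Proof.
by apply: linear_bilin => z c x y; apply: fmod_liftP => W b hb;
  rewrite linearP !flift_gen; case: (hb n c x y z).
Qed.
Definition tens2_bilin : bilin tens2 := mon2_bilin 0.

Lemma lift2 (W : lmodType k) (b : nat -> V -> V -> W) (hb : forall n, bilin (b n)) :
  {f : {linear M2 -> W} | forall n x y, f (mon2 n x y) = b n x y}.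
Proof.
have hb' : adm2 (fun t => b t.1 t.2.1 t.2.2) by [].
by exists (flift hb') => n x y; rewrite flift_gen.
Qed.

Definition q2 (P : P2 V) : M2 := \sum_(m <- P) mon2 m.1 m.2.1 m.2.2.

Lemma q2_cat P Q : q2 (P ++ Q) = q2 P + q2 Q. Proof. exact: big_cat. Qed.
Lemma q2_nil : q2 [::] = 0. Proof. exact: big_nil. Qed.

Lemma q2_surj m : exists P, m = q2 P.
Proof.
have [s ->] := fmod_span m.
(* The lists in [P2] carry no coefficients, so each scalar is absorbed into the left tensor
   factor. *)
exists [seq (p.2.1, (p.1 *: p.2.2.1, p.2.2.2)) | p <- s].
rewrite /q2 big_map; apply: eq_bigr => -[c [n [x y]]] _ /=.
by have /= <- := linearZZ (mklin (bilinl (mon2_bilin n) y)) c x.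
Qed.

Lemma M2_eq (W : lmodType k) (f g : {linear M2 -> W}) :
  (forall n x y, f (mon2 n x y) = g (mon2 n x y)) -> f =1 g.
Proof.
move=> fg m; have [P ->] := q2_surj m.
by rewrite !linear_sum; apply: eq_bigr => p _.
Qed.

(** Any bound on the degrees will do, so two lists can be sorted with a common one and compared
    coefficient by coefficient. *)
Lemma q2_coef (P : P2 V) N : (forall m, m \in P -> m.1 < N)%N ->
  q2 P = \sum_(n < N) \sum_(t <- coef2 P n) mon2 n t.1 t.2.
Proof.
move=> hN; rewrite /q2 big_seq_cond; under eq_bigr => m /andP[mP _].
  rewrite (_ : mon2 _ _ _ = \sum_(n < N | m.1 == n) mon2 n m.2.1 m.2.2).
    over.
  rewrite (bigD1 (Ordinal (hN _ mP))) //= big1 ?addr0 // => i /andP[/eqP mi].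
  by case/eqP; apply: val_inj.
rewrite -big_seq_cond; under eq_bigr do rewrite big_mkcond.
rewrite exchange_big; apply: eq_bigr => n _ /=.
by rewrite -big_mkcond /coef2 big_map big_filter.
Qed.

(** Left to right, the monomial map [mon2 n] is itself one of the bilinear test maps. Right to left,
    a test map for the coefficient n extends to (V (x) V)[lambda] by zero in the other degrees. *)
Lemma q2_eq P Q : p2eq P Q <-> q2 P = q2 Q.
Proof.
split=> [PQ|PQ n W b hb].
  pose N := (\max_(m <- P ++ Q) m.1).+1.
  have hN m : m \in P ++ Q -> (m.1 < N)%N by move=> ?; rewrite ltnS leq_bigmax_seq.
  rewrite (@q2_coef P N) => [|m ?]; last by rewrite hN ?mem_cat //; apply/orP; left.
  rewrite (@q2_coef Q N) => [|m ?]; last by rewrite hN ?mem_cat //; apply/orP; right.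
  by apply: eq_bigr => n _; apply: PQ; apply: mon2_bilin.
have hb' m : bilin (fun x y => if m == n then b x y else 0) by exact: bilin_cond.
have [f fE] := lift2 hb'; move: (congr1 f PQ); rewrite !linear_sum.
under eq_bigr do rewrite fE.
under [RHS]eq_bigr do rewrite fE.
by rewrite -!big_mkcond /coef2 !big_map !big_filter.
Qed.

Definition qt (t : T2 V) : M2 := \sum_(p <- t) tens2 p.1 p.2.

Lemma qt_cat s t : qt (s ++ t) = qt s + qt t. Proof. exact: big_cat. Qed.
Lemma qt_nil : qt [::] = 0. Proof. exact: big_nil. Qed.

Lemma qt_eq s t : t2eq s t <-> qt s = qt t.
Proof.
split=> [st|st W b hb]; first by apply: st; apply: tens2_bilin.
have hb' m : bilin (fun x y => if m == 0%N then b x y else 0) by exact: bilin_cond.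
have [f fE] := lift2 hb'; move: (congr1 f st); rewrite !linear_sum.
under eq_bigr do rewrite fE.
by under [RHS]eq_bigr do rewrite fE.
Qed.

Lemma lam_sig : {f : {linear M2 -> M2} | forall n x y, f (mon2 n x y) = mon2 n.+1 x y}.
Proof. exact: (lift2 (fun n => mon2_bilin n.+1)). Qed.
Lemma cf2_sig n : {f : {linear M2 -> M2} |
  forall m x y, f (mon2 m x y) = if m == n then tens2 x y else 0}.
Proof. exact: (lift2 (fun m => bilin_cond (m == n) tens2_bilin)). Qed.
End Tensor2.

(* Operators are locked: unification would otherwise unfold distinct ones down
   to the quotients in order to compare them. *)
HB.lock Definition lam (k : fieldType) (V : algType k) : {linear M2 V -> M2 V} :=
  sval (lam_sig V).
Arguments lam {k V}.
HB.lock Definition cf2 (k : fieldType) (V : algType k) n : {linear M2 V -> M2 V} :=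
  sval (cf2_sig V n).
Arguments cf2 {k V}.

Section Tensor2Theory.
Variables (k : fieldType) (V : algType k).
Local Notation M2 := (M2 V).
Local Notation tens2 := (@tens2 k V).
Local Notation mon2 := (@mon2 k V).
Local Notation lam := (@lam k V).
Local Notation cf2 := (@cf2 k V).

Lemma lamE n x y : lam (mon2 n x y) = mon2 n.+1 x y. Proof. by rewrite unlock; exact: (svalP (lam_sig V)). Qed.
Lemma mon2E n x y : mon2 n x y = iter n lam (tens2 x y).
Proof. by elim: n => //= n <-; rewrite lamE. Qed.

(** Monomials are built from constant tensors by [lam], so an operator is controlled by its value on
    tensors and its commutation with lambda; later inductions thus avoid binomial sums. *)
Lemma M2_ind (Q : M2 -> Prop) :
  (forall c m m', Q m -> Q m' -> Q (c *: m + m')) -> (forall m, Q m -> Q (lam m)) ->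
  (forall x y, Q (tens2 x y)) -> forall m, Q m.
Proof.
move=> QD Qlam Qt m; have [P ->] := q2_surj m.
have Qm n x y : Q (mon2 n x y) by rewrite mon2E; elim: n => //= n /Qlam.
rewrite /q2; apply: big_ind => // [|u v Qu Qv]; last by rewrite -[u]scale1r; apply: QD.
rewrite (_ : 0 = -1 *: mon2 0 0 0 + mon2 0 0 0); first exact: QD.
by rewrite scaleN1r addNr.
Qed.

Lemma q2_lam0 (t : T2 V) : q2 [seq (0%N, p) | p <- t] = qt t.
Proof. by rewrite /q2 big_map. Qed.
Lemma q2_lam1 (t : T2 V) : q2 [seq (1%N, p) | p <- t] = lam (qt t).
Proof. by rewrite /q2 big_map linear_sum; under [RHS]eq_bigr do rewrite lamE. Qed.

Lemma cf2E n m x y : cf2 n (mon2 m x y) = if m == n then tens2 x y else 0.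
Proof. by rewrite unlock; exact: (svalP (cf2_sig V n)). Qed.
Lemma cf2_lam n m : cf2 n.+1 (lam m) = cf2 n m.
Proof.
by move: m; apply: (@M2_eq _ _ _ (cf2 n.+1 \o lam) (cf2 n)) => p x y /=; rewrite lamE !cf2E.
Qed.
Lemma cf20_lam m : cf2 0 (lam m) = 0.
Proof. by move: m; apply: (@M2_eq _ _ _ (cf2 0 \o lam) \0) => p x y /=; rewrite lamE !cf2E. Qed.
Lemma cf2_qt n t : cf2 n (qt t) = if n == 0%N then qt t else 0.
Proof.
rewrite linear_sum; under eq_bigr do rewrite cf2E eq_sym.
by case: eqP => // _; rewrite big1.
Qed.
Lemma qt_coef2 n P : qt (coef2 P n) = cf2 n (q2 P).
Proof.
rewrite linear_sum; under [RHS]eq_bigr do rewrite cf2E.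
by rewrite /qt /coef2 big_map big_filter -big_mkcond.
Qed.
End Tensor2Theory.

(** * Triple tensors with two polynomial variables *)

Section Tensor3.
Variables (k : fieldType) (V : algType k).

(* [M3] is (V (x) V (x) V)[lambda, mu]. *)
Definition adm3 (W : lmodType k) (b : nat * nat * (V * V * V) -> W) :=
  forall n m, trilin (fun x y z => b (n, m, (x, y, z))).
Definition M3 := fmod adm3.
HB.instance Definition _ := GRing.Lmodule.on M3.

Definition mon3 n m (x y z : V) : M3 := fgen adm3 (n, m, (x, y, z)).
Definition tens3 := mon3 0 0.

Lemma mon3_trilin n m : trilin (mon3 n m).
Proof.
by apply: linear_trilin => u v c x y; apply: fmod_liftP => W b hb;
  rewrite linearP !flift_gen; case: (hb n m c x y u v).
Qed.
Definition tens3_trilin : trilin tens3 := mon3_trilin 0 0.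

Lemma lift3 (W : lmodType k) (b : nat -> nat -> V -> V -> V -> W)
    (hb : forall n m, trilin (b n m)) :
  {f : {linear M3 -> W} | forall n m x y z, f (mon3 n m x y z) = b n m x y z}.
Proof.
have hb' : adm3 (fun t => b t.1.1 t.1.2 t.2.1.1 t.2.1.2 t.2.2) by [].
by exists (flift hb') => n m x y z; rewrite flift_gen.
Qed.

Definition q3 (P : P3 V) : M3 :=
  \sum_(m <- P) mon3 m.1.1 m.1.2 m.2.1.1 m.2.1.2 m.2.2.

Lemma q3_cat P Q : q3 (P ++ Q) = q3 P + q3 Q. Proof. exact: big_cat. Qed.

Lemma q3_surj m : exists P, m = q3 P.
Proof.
have [s ->] := fmod_span m.
exists [seq (p.2.1, (p.1 *: p.2.2.1.1, p.2.2.1.2, p.2.2.2)) | p <- s].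
rewrite /q3 big_map; apply: eq_bigr => -[c [[n n'] [[x y] z]]] _ /=.
have hl : linear (fun x => mon3 n n' x y z).
  by move=> a u v; case: (mon3_trilin n n' a u v y z).
by have /= <- := linearZZ (mklin hl) c x.
Qed.

Lemma M3_eq (W : lmodType k) (f g : {linear M3 -> W}) :
  (forall n m x y z, f (mon3 n m x y z) = g (mon3 n m x y z)) -> f =1 g.
Proof.
move=> fg m; have [P ->] := q3_surj m.
by rewrite !linear_sum; apply: eq_bigr => p _.
Qed.

Lemma q3_coef (P : P3 V) N : (forall m, m \in P -> m.1.1 < N /\ m.1.2 < N)%N ->
  q3 P = \sum_(n < N) \sum_(n' < N) \sum_(t <- coef3 P n n') mon3 n n' t.1.1 t.1.2 t.2.
Proof.
move=> hN; rewrite pair_bigA /= /q3 big_seq_cond; under eq_bigr => m /andP[mP _].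
  rewrite (_ : mon3 _ _ _ _ _ = \sum_(n : 'I_N * 'I_N | m.1 == (val n.1, val n.2))
     mon3 n.1 n.2 m.2.1.1 m.2.1.2 m.2.2).
    over.
  have [h1 h2] := hN _ mP.
  rewrite (bigD1 (Ordinal h1, Ordinal h2)) /=; last by case: m.1.
  rewrite big1 ?addr0 // => -[i i'] /andP[/eqP mi /eqP[]].
  by congr pair; apply: val_inj; rewrite /= mi.
rewrite -big_seq_cond; under eq_bigr do rewrite big_mkcond.
rewrite exchange_big; apply: eq_bigr => n _ /=.
by rewrite -big_mkcond /coef3 big_map big_filter.
Qed.

Lemma q3_eq P Q : p3eq P Q <-> q3 P = q3 Q.
Proof.
split=> [PQ|PQ n n' W b hb].
  pose N := (\max_(m <- P ++ Q) maxn m.1.1 m.1.2).+1.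
  have hN m : m \in P ++ Q -> (m.1.1 < N /\ m.1.2 < N)%N.
    move=> mPQ; apply/andP; rewrite /N !ltnS -geq_max.
    exact: (leq_bigmax_seq _ mPQ).
  rewrite (@q3_coef P N) => [|m ?]; last by apply: hN; rewrite ?mem_cat //; apply/orP; left.
  rewrite (@q3_coef Q N) => [|m ?]; last by apply: hN; rewrite ?mem_cat //; apply/orP; right.
  by do 2!apply: eq_bigr => ? _; apply: PQ; apply: mon3_trilin.
have hb' m m' : trilin (fun x y z => if (m, m') == (n, n') then b x y z else 0).
  exact: trilin_cond.
have [f fE] := lift3 hb'; move: (congr1 f PQ); rewrite !linear_sum.
under eq_bigr do rewrite fE -surjective_pairing.
under [RHS]eq_bigr do rewrite fE -surjective_pairing.
by rewrite -!big_mkcond /coef3 !big_map !big_filter.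
Qed.

Definition qt3 (t : T3 V) : M3 := \sum_(p <- t) tens3 p.1.1 p.1.2 p.2.

Lemma qt3_cat s t : qt3 (s ++ t) = qt3 s + qt3 t. Proof. exact: big_cat. Qed.

Lemma qt3_eq s t : t3eq s t <-> qt3 s = qt3 t.
Proof.
split=> [st|st W b hb]; first by apply: st; apply: tens3_trilin.
have hb' m m' : trilin (fun x y z => if (m, m') == (0%N, 0%N) then b x y z else 0).
  exact: trilin_cond.
have [f fE] := lift3 hb'; move: (congr1 f st); rewrite !linear_sum.
under eq_bigr do rewrite fE.
by under [RHS]eq_bigr do rewrite fE.
Qed.

Lemma lam3_sig : {f : {linear M3 -> M3} |
  forall n m x y z, f (mon3 n m x y z) = mon3 n.+1 m x y z}.
Proof. exact: (lift3 (fun n m => mon3_trilin n.+1 m)). Qed.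
Lemma mu3_sig : {f : {linear M3 -> M3} |
  forall n m x y z, f (mon3 n m x y z) = mon3 n m.+1 x y z}.
Proof. exact: (lift3 (fun n m => mon3_trilin n m.+1)). Qed.
Lemma cf3_sig n m : {f : {linear M3 -> M3} | forall n' m' x y z,
  f (mon3 n' m' x y z) = if (n', m') == (n, m) then tens3 x y z else 0}.
Proof. exact: (lift3 (fun n' m' => trilin_cond ((n', m') == (n, m)) tens3_trilin)). Qed.
End Tensor3.

HB.lock Definition lam3 (k : fieldType) (V : algType k) : {linear M3 V -> M3 V} :=
  sval (lam3_sig V).
Arguments lam3 {k V}.
HB.lock Definition mu3 (k : fieldType) (V : algType k) : {linear M3 V -> M3 V} :=
  sval (mu3_sig V).
Arguments mu3 {k V}.
HB.lock Definition cf3 (k : fieldType) (V : algType k) n m : {linear M3 V -> M3 V} :=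
  sval (cf3_sig V n m).
Arguments cf3 {k V}.

Section Tensor3Theory.
Variables (k : fieldType) (V : algType k).
Local Notation M3 := (M3 V).
Local Notation tens3 := (@tens3 k V).
Local Notation mon3 := (@mon3 k V).
Local Notation lam3 := (@lam3 k V).
Local Notation mu3 := (@mu3 k V).
Local Notation cf3 := (@cf3 k V).

Lemma lam3E n m x y z : lam3 (mon3 n m x y z) = mon3 n.+1 m x y z.
Proof. by rewrite unlock; exact: (svalP (lam3_sig V)). Qed.
Lemma mu3E n m x y z : mu3 (mon3 n m x y z) = mon3 n m.+1 x y z.
Proof. by rewrite unlock; exact: (svalP (mu3_sig V)). Qed.
Lemma mon3E n m x y z : mon3 n m x y z = iter n lam3 (iter m mu3 (tens3 x y z)).
Proof.
elim: n => [|n /= <-]; last by rewrite lam3E.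
by elim: m => //= m <-; rewrite mu3E.
Qed.
Lemma lamuC m : lam3 (mu3 m) = mu3 (lam3 m).
Proof.
by move: m; apply: (@M3_eq _ _ _ (lam3 \o mu3) (mu3 \o lam3)) => * /=;
  rewrite !(lam3E, mu3E).
Qed.

Lemma M3_ind (Q : M3 -> Prop) :
  (forall c m m', Q m -> Q m' -> Q (c *: m + m')) -> (forall m, Q m -> Q (lam3 m)) ->
  (forall m, Q m -> Q (mu3 m)) ->
  (forall x y z, Q (tens3 x y z)) -> forall m, Q m.
Proof.
move=> QD Qlam Qmu Qt m; have [P ->] := q3_surj m.
have Qm n n' x y z : Q (mon3 n n' x y z).
  rewrite mon3E; elim: n => [|n] /=; last exact: Qlam.
  by elim: n' => //= n' /Qmu.
rewrite /q3; apply: big_ind => // [|u v Qu Qv]; last by rewrite -[u]scale1r; apply: QD.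
rewrite (_ : 0 = -1 *: mon3 0 0 0 0 0 + mon3 0 0 0 0 0); first exact: QD.
by rewrite scaleN1r addNr.
Qed.

Lemma cf3E n m n' m' x y z :
  cf3 n m (mon3 n' m' x y z) = if (n', m') == (n, m) then tens3 x y z else 0.
Proof. by rewrite unlock; exact: (svalP (cf3_sig V n m)). Qed.

(** On generators the Jacobi expression contains no monomials besides 1, lambda and mu, so this
    comparison of coefficients is all that is required. *)
Lemma qt3_indep (s t u : T3 V) : qt3 s + lam3 (qt3 t) + mu3 (qt3 u) = 0 ->
  [/\ qt3 s = 0, qt3 t = 0 & qt3 u = 0].
Proof.
move=> h.
have hs n m : cf3 n m (qt3 s) = if (0%N, 0%N) == (n, m) then qt3 s else 0.
  rewrite linear_sum; under eq_bigr do rewrite cf3E.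
  by case: ifP => // _; rewrite big1.
have ht n m : cf3 n m (lam3 (qt3 t)) = if (1%N, 0%N) == (n, m) then qt3 t else 0.
  rewrite !linear_sum; under eq_bigr do rewrite lam3E cf3E.
  by case: ifP => // _; rewrite big1.
have hu n m : cf3 n m (mu3 (qt3 u)) = if (0%N, 1%N) == (n, m) then qt3 u else 0.
  rewrite !linear_sum; under eq_bigr do rewrite mu3E cf3E.
  by case: ifP => // _; rewrite big1.
split; [move: (congr1 (cf3 0 0) h)|move: (congr1 (cf3 1 0) h)|move: (congr1 (cf3 0 1) h)];
by rewrite !linearD linear0 hs ht hu /= ?addr0 ?add0r.
Qed.
End Tensor3Theory.

(** * Outer and inner structures on (V (x) V)[lambda] *)

Section Pascal.
Variables (k : fieldType) (W : lmodType k) (L : {linear W -> W}).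

(** The binomial expansion of (L + s)^p F at index 0, where s shifts the index of F. With F j = d^j
    a this is (L + d)^p a. *)
Definition pasc (F : nat -> W) p : W := \sum_(j < p.+1) iter (p - j) L (F j) *+ 'C(p, j).

Lemma pasc0 F : pasc F 0 = F 0%N.
Proof. by rewrite /pasc big_ord_recl big_ord0 addr0 bin0. Qed.

(** Pascal's rule: the additional factor L + s either applies L or shifts F. *)
Lemma pascS F p : pasc F p.+1 = L (pasc F p) + pasc (fun j => F j.+1) p.
Proof.
rewrite /pasc big_ord_recl subn0 bin0.
under eq_bigr => i _ do rewrite lift0 subSS binS mulrnDr.
rewrite big_split addrA; congr (_ + _).
rewrite big_ord_recr /= bin_small // mulr0n addr0 linear_sum big_ord_recl subn0 bin0.
congr (_ + _); apply: eq_bigr => i _.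
by rewrite linearMn -iterS lift0 subnSK.
Qed.

Lemma iter_lin n c x y : iter n L (c *: x + y) = c *: iter n L x + iter n L y.
Proof. by elim: n => //= n ->; rewrite linearP. Qed.

Lemma eq_pasc F G p : F =1 G -> pasc F p = pasc G p.
Proof. by move=> FG; apply: eq_bigr => j _; rewrite FG. Qed.

Lemma pasc_lin c F G H p : (forall j, H j = c *: F j + G j) ->
  pasc H p = c *: pasc F p + pasc G p.
Proof.
move=> HE; rewrite /pasc scaler_sumr -big_split; apply: eq_bigr => j _.
by rewrite HE iter_lin mulrnDl scalerMnr.
Qed.
End Pascal.

Section Operations2.
Variables (k : fieldType) (V : algType k) (d : {linear V -> V}).
Local Notation M := (M2 V).
Local Notation lam := (@lam k V).
Implicit Types (m : M) (a b x y : V).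

Lemma tensl y : linear (fun x : V => tens2 x y). Proof. exact: (bilinl (@tens2_bilin _ V) y). Qed.
Lemma tensr x : linear (fun y : V => tens2 x y). Proof. exact: (bilinr (@tens2_bilin _ V) x). Qed.

Lemma tensDl x x' y : tens2 (x + x') y = tens2 x y + tens2 x' y.
Proof. exact: (lin_D (tensl y)). Qed.
Lemma tensDr x y y' : tens2 x (y + y') = tens2 x y + tens2 x y'.
Proof. exact: (lin_D (tensr x)). Qed.

Lemma mon2l n (y : V) : linear (fun x : V => mon2 n x y).
Proof. exact: (bilinl (@mon2_bilin _ V n) y). Qed.
Lemma mon2r n (x : V) : linear (fun y : V => mon2 n x y).
Proof. exact: (bilinr (@mon2_bilin _ V n) x). Qed.
Lemma Dop_sig : {f : {linear M -> M} |
  forall n x y, f (mon2 n x y) = mon2 n (d x) y + mon2 n x (d y)}.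
Proof.
by apply: lift2 => n; apply: linear_bilin => z c x y; rewrite linearP;
  rewrite ?(mon2l n) ?(mon2r n) ?(mon2l n) ?(mon2r n) scalerDr addrACA.
Qed.

Lemma oml_sig a : {f : {linear M -> M} |
  forall n x y, f (mon2 n x y) = mon2 n (a * x) y}.
Proof.
apply: lift2 => n; apply: linear_bilin => z c x y; last exact: mon2r.
by rewrite mulrDr -scalerAr (mon2l n).
Qed.

Lemma omr_sig b : {f : {linear M -> M} |
  forall n x y, f (mon2 n x y) = mon2 n x (y * b)}.
Proof.
apply: lift2 => n; apply: linear_bilin => z c x y; first exact: mon2l.
by rewrite mulrDl -scalerAl (mon2r n).
Qed.

Lemma iml_sig a : {f : {linear M -> M} |
  forall n x y, f (mon2 n x y) = pasc (lam) (fun j => tens2 x (iter j d a * y)) n}.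
Proof.
apply: lift2 => n; apply: linear_bilin => z c x y; apply: pasc_lin => j; first exact: tensl.
by rewrite mulrDr -scalerAr tensr.
Qed.

Lemma imr_sig b : {f : {linear M -> M} |
  forall n x y, f (mon2 n x y) = pasc (lam) (fun j => tens2 (x * iter j d b) y) n}.
Proof.
apply: lift2 => n; apply: linear_bilin => z c x y; apply: pasc_lin => j; last exact: tensr.
by rewrite mulrDl -scalerAl (tensl z).
Qed.

End Operations2.

HB.lock Definition Dop (k : fieldType) (V : algType k) (d : {linear V -> V}) :
  {linear M2 V -> M2 V} := sval (Dop_sig d).
HB.lock Definition oml (k : fieldType) (V : algType k) (a : V) : {linear M2 V -> M2 V} :=
  sval (oml_sig a).
HB.lock Definition omr (k : fieldType) (V : algType k) (b : V) : {linear M2 V -> M2 V} :=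
  sval (omr_sig b).
HB.lock Definition iml (k : fieldType) (V : algType k) (d : {linear V -> V}) (a : V) :
  {linear M2 V -> M2 V} := sval (iml_sig d a).
HB.lock Definition imr (k : fieldType) (V : algType k) (d : {linear V -> V}) (b : V) :
  {linear M2 V -> M2 V} := sval (imr_sig d b).

Section Twist.
Variables (k : fieldType) (V : algType k) (d : {linear V -> V}).
Local Notation M := (M2 V).
Local Notation lam := (@lam k V).
Local Notation Dop := (Dop d).

Lemma Sout_linear : linear (fun m => lam m + Dop m).
Proof. by move=> c m m'; rewrite !linearP scalerDr addrACA. Qed.
Lemma Sin_linear : linear (fun m : M => - lam m).
Proof. by move=> c m m'; rewrite linearP opprD scalerN. Qed.
End Twist.

HB.lock Definition Sout (k : fieldType) (V : algType k) (d : {linear V -> V}) :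
  {linear M2 V -> M2 V} := mklin (Sout_linear d).
HB.lock Definition Sin (k : fieldType) (V : algType k) :
  {linear M2 V -> M2 V} := mklin (@Sin_linear k V).

Section Reversal.
Variables (k : fieldType) (V : algType k) (d : {linear V -> V}).
Local Notation M := (M2 V).
Local Notation Sout := (Sout d).

Lemma nu2_linear : linear (fun m => - Sout m).
Proof. by move=> c m m'; rewrite linearP opprD scalerN. Qed.
(** The operator - lambda - d that the reversal substitutes for lambda. *)
Definition nu2 : {linear M -> M} := mklin nu2_linear.

Lemma tau_sig : {f : {linear M -> M} |
  forall n x y, f (mon2 n x y) = iter n nu2 (tens2 y x)}.
Proof.
by apply: lift2 => n; apply: linear_bilin => z c x y; rewrite ?(tensl z) ?(tensr z) iter_lin.
Qed.
End Reversal.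

HB.lock Definition tau (k : fieldType) (V : algType k) (d : {linear V -> V}) :
  {linear M2 V -> M2 V} := sval (tau_sig d).

Section Operations2Theory.
Variables (k : fieldType) (V : algType k) (d : {linear V -> V}).
Hypothesis hd : forall x y, d (x * y) = d x * y + x * d y.
Local Notation M := (M2 V).
Local Notation lam := (@lam k V).
Local Notation Dop := (Dop d).
Local Notation oml := (@oml k V).
Local Notation omr := (@omr k V).
Local Notation Sout := (Sout d).
Local Notation Sin := (@Sin k V).
Local Notation nu2 := (nu2 d).
Local Notation iml := (iml d).
Local Notation imr := (imr d).
Local Notation tau := (tau d).
Implicit Types (m : M) (a b x y : V).

Lemma Dop_mon n x y : Dop (mon2 n x y) = mon2 n (d x) y + mon2 n x (d y).
Proof. by rewrite unlock; exact: (svalP (Dop_sig d)). Qed.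
Lemma Dop_tens x y : Dop (tens2 x y) = tens2 (d x) y + tens2 x (d y).
Proof. exact: Dop_mon. Qed.
Lemma Dop_lam m : Dop (lam m) = lam (Dop m).
Proof.
move: m; apply: (@M2_eq _ _ _ (Dop \o lam) (lam \o Dop)) => n x y /=.
by rewrite lamE !Dop_mon linearD !lamE.
Qed.

Lemma oml_mon n a x y : oml a (mon2 n x y) = mon2 n (a * x) y.
Proof. by rewrite unlock; exact: (svalP (oml_sig a)). Qed.
Lemma oml_tens a x y : oml a (tens2 x y) = tens2 (a * x) y.
Proof. exact: oml_mon. Qed.
Lemma oml_lam a m : oml a (lam m) = lam (oml a m).
Proof.
move: m; apply: (@M2_eq _ _ _ (oml a \o lam) (lam \o oml a)) => n x y /=.
by rewrite !(lamE, oml_mon).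
Qed.

Lemma omr_mon n b x y : omr b (mon2 n x y) = mon2 n x (y * b).
Proof. by rewrite unlock; exact: (svalP (omr_sig b)). Qed.
Lemma omr_tens b x y : omr b (tens2 x y) = tens2 x (y * b).
Proof. exact: omr_mon. Qed.
Lemma omr_lam b m : omr b (lam m) = lam (omr b m).
Proof.
move: m; apply: (@M2_eq _ _ _ (omr b \o lam) (lam \o omr b)) => n x y /=.
by rewrite !(lamE, omr_mon).
Qed.

(* The inner actions are twisted: an algebra element multiplied into
   the coefficient of lambda^p is hit by (lambda + d)^p. *)
Let iml_pasc n a x y : iml a (mon2 n x y) =
  pasc (lam) (fun j => tens2 x (iter j d a * y)) n.
Proof. by rewrite unlock; exact: (svalP (iml_sig d a)). Qed.
Lemma iml_mon n a x y : iml a (mon2 n x y) =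
  \sum_(j < n.+1) mon2 (n - j) x (iter j d a * y) *+ 'C(n, j).
Proof. by rewrite iml_pasc; apply: eq_bigr => j _; rewrite mon2E. Qed.
Lemma iml_tens a x y : iml a (tens2 x y) = tens2 x (a * y).
Proof. by rewrite iml_pasc pasc0. Qed.
(** In (lambda + d)^(n+1) a the additional factor either multiplies by lambda or differentiates a.
    Together with [iml_tens] this rule determines the action and replaces its binomial formula. *)
Lemma iml_lam a m : iml a (lam m) = lam (iml a m) + iml (d a) m.
Proof.
move: m; have h : linear (fun m => lam (iml a m) + iml (d a) m).
  by move=> c m m'; rewrite !linearP scalerDr addrACA.
apply: (@M2_eq _ _ _ (iml a \o lam) (mklin h)) => n x y /=.
rewrite lamE !iml_pasc pascS; congr (_ + _).
by apply: eq_pasc => j; rewrite -iterSr.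
Qed.

Let imr_pasc n b x y : imr b (mon2 n x y) =
  pasc (lam) (fun j => tens2 (x * iter j d b) y) n.
Proof. by rewrite unlock; exact: (svalP (imr_sig d b)). Qed.
Lemma imr_mon n b x y : imr b (mon2 n x y) =
  \sum_(j < n.+1) mon2 (n - j) (x * iter j d b) y *+ 'C(n, j).
Proof. by rewrite imr_pasc; apply: eq_bigr => j _; rewrite mon2E. Qed.
Lemma imr_tens b x y : imr b (tens2 x y) = tens2 (x * b) y.
Proof. by rewrite imr_pasc pasc0. Qed.
Lemma imr_lam b m : imr b (lam m) = lam (imr b m) + imr (d b) m.
Proof.
move: m; have h : linear (fun m => lam (imr b m) + imr (d b) m).
  by move=> c m m'; rewrite !linearP scalerDr addrACA.
apply: (@M2_eq _ _ _ (imr b \o lam) (mklin h)) => n x y /=.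
rewrite lamE !imr_pasc pascS; congr (_ + _).
by apply: eq_pasc => j; rewrite -iterSr.
Qed.

Lemma tau_mon n x y : tau (mon2 n x y) = iter n nu2 (tens2 y x).
Proof. by rewrite unlock; exact: (svalP (tau_sig d)). Qed.
Lemma tau_tens x y : tau (tens2 x y) = tens2 y x. Proof. exact: tau_mon. Qed.
Lemma tau_lam m : tau (lam m) = - Sout (tau m).
Proof.
by move: m; apply: (@M2_eq _ _ _ (tau \o lam) (nu2 \o tau)) => n x y /=;
  rewrite lamE !tau_mon.
Qed.

Lemma oml_linear m : linear (oml^~ m).
Proof.
move=> c a b; elim/M2_ind: m => [e m m' h h'|m h|x y]; rewrite ?linearP.
- by rewrite h h' !scalerDr !scalerA [e * c]mulrC addrACA.
- by rewrite !oml_lam h linearP.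
- by rewrite !oml_tens mulrDl -scalerAl (tensl y).
Qed.
Lemma omr_linear m : linear (omr^~ m).
Proof.
move=> c a b; elim/M2_ind: m => [e m m' h h'|m h|x y]; rewrite ?linearP.
- by rewrite h h' !scalerDr !scalerA [e * c]mulrC addrACA.
- by rewrite !omr_lam h linearP.
- by rewrite !omr_tens mulrDr -scalerAr (tensr x).
Qed.
(** The acting elements stay quantified during the induction, here and in the later proofs on inner
    actions: moving lambda across the action calls for the claim at their derivatives. *)
Lemma iml_linear m : linear (iml^~ m).
Proof.
elim/M2_ind: m => [e m m' h h'|m h|x y] c a b; rewrite ?linearP.
- by rewrite h h' !scalerDr !scalerA [e * c]mulrC addrACA.
- by rewrite !iml_lam h !linearP h scalerDr addrACA.
- by rewrite !iml_tens mulrDl -scalerAl (tensr x).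
Qed.
Lemma imr_linear m : linear (imr^~ m).
Proof.
elim/M2_ind: m => [e m m' h h'|m h|x y] c a b; rewrite ?linearP.
- by rewrite h h' !scalerDr !scalerA [e * c]mulrC addrACA.
- by rewrite !imr_lam h !linearP h scalerDr addrACA.
- by rewrite !imr_tens mulrDr -scalerAr (tensl y).
Qed.

Lemma imlD a b m : iml (a + b) m = iml a m + iml b m.
Proof. exact: (lin_D (iml_linear m)). Qed.
Lemma imrD a b m : imr (a + b) m = imr a m + imr b m.
Proof. exact: (lin_D (imr_linear m)). Qed.
Lemma iml0 m : iml 0 m = 0. Proof. exact: (lin_0 (iml_linear m)). Qed.
Lemma imr0 m : imr 0 m = 0. Proof. exact: (lin_0 (imr_linear m)). Qed.

Lemma SoutE m : Sout m = lam m + Dop m. Proof. by rewrite unlock. Qed.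
Lemma SinE m : Sin m = - lam m. Proof. by rewrite unlock. Qed.
Let tensE := (oml_tens, omr_tens, iml_tens, imr_tens, tau_tens, Dop_tens).

Lemma omlM a b m : oml (a * b) m = oml a (oml b m).
Proof.
elim/M2_ind: m a b => [c m m' h h'|m h|x y] a b; first by rewrite !linearP h h'.
  by rewrite !oml_lam h.
by rewrite !tensE mulrA.
Qed.
Lemma omrM a b m : omr (a * b) m = omr b (omr a m).
Proof.
elim/M2_ind: m a b => [c m m' h h'|m h|x y] a b; first by rewrite !linearP h h'.
  by rewrite !omr_lam h.
by rewrite !tensE mulrA.
Qed.
Lemma oml_omr a b m : oml a (omr b m) = omr b (oml a m).
Proof.
elim/M2_ind: m a b => [c m m' h h'|m h|x y] a b; first by rewrite !linearP h h'.
  by rewrite omr_lam !oml_lam omr_lam h.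
by rewrite !tensE.
Qed.
Lemma oml1 m : oml 1 m = m.
Proof.
elim/M2_ind: m => [c m m' h h'|m h|x y]; first by rewrite !linearP h h'.
  by rewrite oml_lam h.
by rewrite !tensE mul1r.
Qed.
Lemma omr1 m : omr 1 m = m.
Proof.
elim/M2_ind: m => [c m m' h h'|m h|x y]; first by rewrite !linearP h h'.
  by rewrite omr_lam h.
by rewrite !tensE mulr1.
Qed.
Lemma Dop_oml a m : Dop (oml a m) = oml (d a) m + oml a (Dop m).
Proof.
elim/M2_ind: m => [c m m' h h'|m h|x y].
- by rewrite !linearP h h' scalerDr addrACA.
- by rewrite !oml_lam !Dop_lam h !oml_lam linearD.
- by rewrite !tensE linearD !tensE hd tensDl addrA.
Qed.
Lemma Dop_omr a m : Dop (omr a m) = omr a (Dop m) + omr (d a) m.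
Proof.
elim/M2_ind: m => [c m m' h h'|m h|x y].
- by rewrite !linearP h h' scalerDr addrACA.
- by rewrite !omr_lam !Dop_lam h !omr_lam linearD.
- by rewrite !tensE linearD !tensE hd tensDr addrA.
Qed.
Lemma Sout_lam m : Sout (lam m) = lam (Sout m).
Proof. by rewrite !SoutE linearD Dop_lam. Qed.
Lemma Sout_oml a m : Sout (oml a m) = oml (d a) m + oml a (Sout m).
Proof. by rewrite !SoutE linearD Dop_oml oml_lam addrCA. Qed.
Lemma Sout_omr a m : Sout (omr a m) = omr a (Sout m) + omr (d a) m.
Proof. by rewrite !SoutE linearD Dop_omr omr_lam addrA. Qed.

Lemma imlM a b m : iml (a * b) m = iml a (iml b m).
Proof.
elim/M2_ind: m a b => [c m m' h h'|m h|x y] a b; first by rewrite !linearP h h'.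
  rewrite (iml_lam (a * b)) hd imlD !h [iml b (lam _)]iml_lam [iml a (_ + _)]linearD iml_lam.
  by rewrite -addrA; congr (_ + _).
by rewrite !tensE mulrA.
Qed.
Lemma imrM a b m : imr (a * b) m = imr b (imr a m).
Proof.
elim/M2_ind: m a b => [c m m' h h'|m h|x y] a b; first by rewrite !linearP h h'.
  rewrite (imr_lam (a * b)) hd imrD !h [imr a (lam _)]imr_lam [imr b (_ + _)]linearD imr_lam.
  by rewrite -addrA; congr (_ + _); rewrite addrC.
by rewrite !tensE mulrA.
Qed.
Lemma iml_imr a b m : iml a (imr b m) = imr b (iml a m).
Proof.
elim/M2_ind: m a b => [c m m' h h'|m h|x y] a b; first by rewrite !linearP h h'.
  rewrite imr_lam !iml_lam !linearD imr_lam iml_lam !h.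
  by rewrite -!addrA; congr (_ + _); rewrite addrC.
by rewrite !tensE.
Qed.
Lemma d1 : d 1 = 0.
Proof. apply: (addIr (d 1)); rewrite add0r; have := hd 1 1.
by rewrite !mulr1 mul1r => <-. Qed.
Lemma iml1 m : iml 1 m = m.
Proof.
elim/M2_ind: m => [c m m' h h'|m h|x y]; first by rewrite !linearP h h'.
  by rewrite iml_lam h d1 iml0 addr0.
by rewrite !tensE mul1r.
Qed.
Lemma imr1 m : imr 1 m = m.
Proof.
elim/M2_ind: m => [c m m' h h'|m h|x y]; first by rewrite !linearP h h'.
  by rewrite imr_lam h d1 imr0 addr0.
by rewrite !tensE mulr1.
Qed.
(** The twist makes - lambda a derivation over d: the term [iml (d a) m] arising from [iml_lam]
    cancels the one on the right. *)
Lemma Sin_iml a m : Sin (iml a m) = iml (d a) m + iml a (Sin m).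
Proof. by rewrite !SinE linearN iml_lam opprD addrC addrNK. Qed.
Lemma Sin_imr a m : Sin (imr a m) = imr a (Sin m) + imr (d a) m.
Proof. by rewrite !SinE linearN imr_lam opprD addrNK. Qed.

Lemma iml_oml a b m : iml a (oml b m) = oml b (iml a m).
Proof.
elim/M2_ind: m a b => [c m m' h h'|m h|x y] a b; first by rewrite !linearP h h'.
  by rewrite oml_lam !iml_lam linearD oml_lam !h.
by rewrite !tensE.
Qed.
Lemma iml_omr a b m : iml a (omr b m) = omr b (iml a m).
Proof.
elim/M2_ind: m a b => [c m m' h h'|m h|x y] a b; first by rewrite !linearP h h'.
  by rewrite omr_lam !iml_lam linearD omr_lam !h.
by rewrite !tensE mulrA.
Qed.
Lemma imr_oml a b m : imr a (oml b m) = oml b (imr a m).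
Proof.
elim/M2_ind: m a b => [c m m' h h'|m h|x y] a b; first by rewrite !linearP h h'.
  by rewrite oml_lam !imr_lam linearD oml_lam !h.
by rewrite !tensE mulrA.
Qed.
Lemma imr_omr a b m : imr a (omr b m) = omr b (imr a m).
Proof.
elim/M2_ind: m a b => [c m m' h h'|m h|x y] a b; first by rewrite !linearP h h'.
  by rewrite omr_lam !imr_lam linearD omr_lam !h.
by rewrite !tensE.
Qed.
(** On x (x) y the twist contributes x (x) (d a) y, precisely the term that the Leibniz rule for d
    (a y) asks for. *)
Lemma iml_Sout a m : iml a (Sout m) = Sout (iml a m).
Proof.
elim/M2_ind: m a => [c m m' h h'|m h|x y] a; first by rewrite !linearP h h'.
  by rewrite Sout_lam !iml_lam !h linearD Sout_lam.
rewrite SoutE linearD !iml_lam Dop_tens linearD !tensE SoutE Dop_tens hd -addrA.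
by congr (_ + _); rewrite tensDr addrCA.
Qed.
Lemma imr_Sout a m : imr a (Sout m) = Sout (imr a m).
Proof.
elim/M2_ind: m a => [c m m' h h'|m h|x y] a; first by rewrite !linearP h h'.
  by rewrite Sout_lam !imr_lam !h linearD Sout_lam.
rewrite SoutE linearD !imr_lam Dop_tens linearD !tensE SoutE Dop_tens hd -addrA.
by congr (_ + _); rewrite tensDl addrA [X in X + _]addrC.
Qed.

Lemma tau_D m : tau (Dop m) = Dop (tau m).
Proof.
elim/M2_ind: m => [c m m' h h'|m h|x y]; first by rewrite !linearP h h'.
  by rewrite Dop_lam !tau_lam h !SoutE linearN [Dop (_ + _)]linearD Dop_lam.
by rewrite Dop_tens linearD !tensE addrC.
Qed.
(** Since the reversal commutes with d, applying it twice sends lambda to - (- lambda - d) - d =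
    lambda. *)
Lemma tauK m : tau (tau m) = m.
Proof.
elim/M2_ind: m => [c m m' h h'|m h|x y]; first by rewrite !linearP h h'.
  by rewrite tau_lam linearN SoutE [tau (_ + _)]linearD tau_lam tau_D h SoutE opprD opprK addrK.
by rewrite !tensE.
Qed.
Lemma tau_Sin m : tau (Sin m) = Sout (tau m).
Proof. by rewrite SinE linearN tau_lam opprK. Qed.
Lemma tau_iml a m : tau (iml a m) = oml a (tau m).
Proof.
elim/M2_ind: m a => [c m m' h h'|m h|x y] a; first by rewrite !linearP h h'.
  rewrite iml_lam linearD !tau_lam !h linearN.
  by rewrite Sout_oml opprD addrC addrA subrr sub0r.
by rewrite !tensE.
Qed.
Lemma tau_imr a m : tau (imr a m) = omr a (tau m).
Proof.
elim/M2_ind: m a => [c m m' h h'|m h|x y] a; first by rewrite !linearP h h'.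
  by rewrite imr_lam linearD !tau_lam !h linearN Sout_omr opprD subrK.
by rewrite !tensE.
Qed.
Lemma tau_oml a m : tau (oml a m) = iml a (tau m).
Proof. by rewrite -[m in LHS]tauK -tau_iml tauK. Qed.
Lemma tau_omr a m : tau (omr a m) = imr a (tau m).
Proof. by rewrite -[m in LHS]tauK -tau_imr tauK. Qed.
Lemma tau_Sout m : tau (Sout m) = Sin (tau m).
Proof. by rewrite -[m in LHS]tauK -tau_Sin tauK. Qed.
End Operations2Theory.

(** * Operations on (V (x) V (x) V)[lambda, mu] *)

(** Indexes the expansion by the power of L rather than by the number of shifts, as the sums in
    [jacobi] do. *)
Lemma pasc_rev (k : fieldType) (W : lmodType k) (L : {linear W -> W}) F p :
  pasc L F p = \sum_(j < p.+1) iter j L (F (p - j)%N) *+ 'C(p, j).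
Proof.
rewrite /pasc (reindex_inj rev_ord_inj) /=; apply: eq_bigr => j _.
have jp : (j <= p)%N by rewrite -ltnS.
by rewrite subSS subKn // bin_sub.
Qed.

Lemma addr3ACA (W : zmodType) (a b c d e f : W) :
  a + b + (c + d) + (e + f) = a + c + e + (b + d + f).
Proof. by rewrite (addrACA a) (addrACA (a + c)). Qed.

Section Operations3.
Variables (k : fieldType) (V : algType k) (d : {linear V -> V}).
Local Notation M := (M2 V).
Local Notation N := (M3 V).
Local Notation lam3 := (@lam3 k V).
Local Notation mu3 := (@mu3 k V).

Lemma mon3l n m (y z : V) : linear (fun x : V => mon3 n m x y z).
Proof. by move=> c u v; case: (mon3_trilin n m c u v y z). Qed.
Lemma mon3m n m (x z : V) : linear (fun y : V => mon3 n m x y z).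
Proof. by move=> c u v; case: (mon3_trilin n m c u v x z). Qed.
Lemma mon3r n m (x y : V) : linear (fun z : V => mon3 n m x y z).
Proof. by move=> c u v; case: (mon3_trilin n m c u v x y). Qed.
Lemma tens3l (y z : V) : linear (fun x : V => tens3 x y z). Proof. exact: mon3l. Qed.
Lemma tens3m (x z : V) : linear (fun y : V => tens3 x y z). Proof. exact: mon3m. Qed.
Lemma tens3r (x y : V) : linear (fun z : V => tens3 x y z). Proof. exact: mon3r. Qed.

Lemma I1_sig y : {f : {linear M -> N} | forall n u v, f (mon2 n u v) = mon3 n 0 u v y}.
Proof. by apply: lift2 => n; apply: linear_bilin => z; [exact: mon3l|exact: mon3m]. Qed.

Lemma I2_sig x : {f : {linear M -> N} | forall n u v, f (mon2 n u v) = mon3 0 n x u v}.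
Proof. by apply: lift2 => n; apply: linear_bilin => z; [exact: mon3m|exact: mon3r]. Qed.

(** The expansion of u (x) (lambda + mu + d)^n y (x) v, the shape of the last term of the Jacobi
    identity; the outer [pasc] splits off lambda and the inner one mu. *)
Lemma I3_sig y : {f : {linear M -> N} | forall n u v, f (mon2 n u v) =
  pasc lam3 (pasc mu3 (fun j => tens3 u (iter j d y) v)) n}.
Proof.
by apply: lift2 => n; apply: linear_bilin => z c u v;
  do 2!(apply: pasc_lin => ?); [exact: tens3l|exact: tens3r].
Qed.

Lemma Dop3_sig : {f : {linear N -> N} | forall n m x y z, f (mon3 n m x y z) =
  mon3 n m (d x) y z + mon3 n m x (d y) z + mon3 n m x y (d z)}.
Proof.
apply: lift3 => n m; apply: linear_trilin => u v c x y; rewrite linearP.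
- by rewrite !(mon3l n m) !scalerDr addr3ACA.
- by rewrite !(mon3m n m) !scalerDr addr3ACA.
- by rewrite !(mon3r n m) !scalerDr addr3ACA.
Qed.

Lemma ml3_sig a : {f : {linear N -> N} |
  forall n m x y z, f (mon3 n m x y z) = mon3 n m (a * x) y z}.
Proof.
apply: lift3 => n m; apply: linear_trilin => u v; [|exact: mon3m|exact: mon3r].
by move=> c x y; rewrite mulrDr -scalerAr (mon3l n m).
Qed.

Lemma mr3_sig a : {f : {linear N -> N} |
  forall n m x y z, f (mon3 n m x y z) = mon3 n m x y (z * a)}.
Proof.
apply: lift3 => n m; apply: linear_trilin => u v; [exact: mon3l|exact: mon3m|].
by move=> c x y; rewrite mulrDl -scalerAl (mon3r n m).
Qed.
End Operations3.

HB.lock Definition I1 (k : fieldType) (V : algType k) (y : V) :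
  {linear M2 V -> M3 V} := sval (I1_sig y).
HB.lock Definition I2 (k : fieldType) (V : algType k) (x : V) :
  {linear M2 V -> M3 V} := sval (I2_sig x).
HB.lock Definition I3 (k : fieldType) (V : algType k) (d : {linear V -> V}) (y : V) :
  {linear M2 V -> M3 V} := sval (I3_sig d y).
HB.lock Definition Dop3 (k : fieldType) (V : algType k) (d : {linear V -> V}) :
  {linear M3 V -> M3 V} := sval (Dop3_sig d).
HB.lock Definition ml3 (k : fieldType) (V : algType k) (a : V) :
  {linear M3 V -> M3 V} := sval (ml3_sig a).
HB.lock Definition mr3 (k : fieldType) (V : algType k) (a : V) :
  {linear M3 V -> M3 V} := sval (mr3_sig a).

Section Shift3.
Variables (k : fieldType) (V : algType k) (d : {linear V -> V}).
Lemma S3_linear : linear (fun m : M3 V => lam3 m + mu3 m + Dop3 d m).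
Proof.
by move=> c m m'; rewrite !linearP !scalerDr addr3ACA.
Qed.
Lemma nu3_linear : linear (fun m : M3 V => - (lam3 m + mu3 m + Dop3 d m)).
Proof. by move=> c m m'; rewrite S3_linear opprD scalerN. Qed.
End Shift3.

HB.lock Definition S3 (k : fieldType) (V : algType k) (d : {linear V -> V}) :
  {linear M3 V -> M3 V} := mklin (S3_linear d).
HB.lock Definition nu3 (k : fieldType) (V : algType k) (d : {linear V -> V}) :
  {linear M3 V -> M3 V} := mklin (nu3_linear d).

Section Rho.
Variables (k : fieldType) (V : algType k) (d : {linear V -> V}).
(** With nu = - lambda - mu - d, the rotation sends lambda to mu, mu to nu and, by [rho_nu], nu back
    to lambda. *)
Lemma rho_sig : {f : {linear M3 V -> M3 V} | forall n m x y z,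
  f (mon3 n m x y z) = iter n mu3 (iter m (nu3 d) (tens3 z x y))}.
Proof.
by apply: lift3 => n m; apply: linear_trilin => u v c x y;
  rewrite -!iter_lin; do 2!congr (iter _ _ _); [exact: tens3m|exact: tens3r|exact: tens3l].
Qed.
End Rho.

HB.lock Definition rho (k : fieldType) (V : algType k) (d : {linear V -> V}) :
  {linear M3 V -> M3 V} := sval (rho_sig d).

Section Operations3Theory.
Variables (k : fieldType) (V : algType k) (d : {linear V -> V}).
Local Notation M := (M2 V).
Local Notation N := (M3 V).
Local Notation lam := (@lam k V).
Local Notation lam3 := (@lam3 k V).
Local Notation mu3 := (@mu3 k V).
Local Notation D := (Dop3 d).
Local Notation S3 := (S3 d).
Local Notation nu3 := (nu3 d).
Local Notation rho := (rho d).
Local Notation I1 := (@I1 k V).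
Local Notation I2 := (@I2 k V).
Local Notation I3 := (I3 d).
Local Notation ml3 := (@ml3 k V).
Local Notation mr3 := (@mr3 k V).
Implicit Types (m : M) (n : N) (a b x y z u v : V).

Lemma I1_mon i y u v : I1 y (mon2 i u v) = mon3 i 0 u v y.
Proof. by rewrite unlock; exact: (svalP (I1_sig y)). Qed.
Lemma I2_mon i x u v : I2 x (mon2 i u v) = mon3 0 i x u v.
Proof. by rewrite unlock; exact: (svalP (I2_sig x)). Qed.
Lemma I3_mon i y u v : I3 y (mon2 i u v) =
  pasc lam3 (pasc mu3 (fun j => tens3 u (iter j d y) v)) i.
Proof. by rewrite unlock; exact: (svalP (I3_sig d y)). Qed.
Lemma D_mon i j x y z : D (mon3 i j x y z) =
  mon3 i j (d x) y z + mon3 i j x (d y) z + mon3 i j x y (d z).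
Proof. by rewrite unlock; exact: (svalP (Dop3_sig d)). Qed.
Lemma ml3_mon a i j x y z : ml3 a (mon3 i j x y z) = mon3 i j (a * x) y z.
Proof. by rewrite unlock; exact: (svalP (ml3_sig a)). Qed.
Lemma mr3_mon a i j x y z : mr3 a (mon3 i j x y z) = mon3 i j x y (z * a).
Proof. by rewrite unlock; exact: (svalP (mr3_sig a)). Qed.
Lemma rho_mon i j x y z :
  rho (mon3 i j x y z) = iter i mu3 (iter j nu3 (tens3 z x y)).
Proof. by rewrite unlock; exact: (svalP (rho_sig d)). Qed.
Lemma S3E n : S3 n = lam3 n + mu3 n + D n. Proof. by rewrite unlock. Qed.
Lemma nu3E n : nu3 n = - S3 n. Proof. by rewrite S3E unlock. Qed.

Lemma I1_tens y u v : I1 y (tens2 u v) = tens3 u v y. Proof. exact: I1_mon. Qed.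
Lemma I2_tens x u v : I2 x (tens2 u v) = tens3 x u v. Proof. exact: I2_mon. Qed.
Lemma I3_tens y u v : I3 y (tens2 u v) = tens3 u y v.
Proof. by rewrite I3_mon !pasc0. Qed.
Lemma D_tens x y z : D (tens3 x y z) = tens3 (d x) y z + tens3 x (d y) z + tens3 x y (d z).
Proof. exact: D_mon. Qed.
Lemma ml3_tens a x y z : ml3 a (tens3 x y z) = tens3 (a * x) y z.
Proof. exact: ml3_mon. Qed.
Lemma mr3_tens a x y z : mr3 a (tens3 x y z) = tens3 x y (z * a).
Proof. exact: mr3_mon. Qed.
Lemma rho_tens x y z : rho (tens3 x y z) = tens3 z x y.
Proof. exact: rho_mon. Qed.

Lemma I1_lam y m : I1 y (lam m) = lam3 (I1 y m).
Proof.
move: m; apply: (@M2_eq _ _ _ (I1 y \o lam) (lam3 \o I1 y)) => i u v /=.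
by rewrite lamE !I1_mon lam3E.
Qed.
Lemma I2_lam x m : I2 x (lam m) = mu3 (I2 x m).
Proof.
move: m; apply: (@M2_eq _ _ _ (I2 x \o lam) (mu3 \o I2 x)) => i u v /=.
by rewrite lamE !I2_mon mu3E.
Qed.
Lemma pasc_comm (F : nat -> N) p : pasc lam3 (fun i => mu3 (F i)) p = mu3 (pasc lam3 F p).
Proof.
rewrite /pasc linear_sum; apply: eq_bigr => j _; rewrite linearMn.
by congr (_ *+ _); elim: (p - j)%N => //= e ->; rewrite lamuC.
Qed.
Lemma pasc_add (F G : nat -> N) p :
  pasc lam3 (fun i => F i + G i) p = pasc lam3 F p + pasc lam3 G p.
Proof.
rewrite (@pasc_lin _ _ lam3 1 F G) ?scale1r // => j.
by rewrite scale1r.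
Qed.
Lemma I3_lam y m : I3 y (lam m) = lam3 (I3 y m) + mu3 (I3 y m) + I3 (d y) m.
Proof.
move: m; have h : linear (fun m => lam3 (I3 y m) + mu3 (I3 y m) + I3 (d y) m).
  by move=> c m m'; rewrite !linearP !scalerDr addr3ACA.
apply: (@M2_eq _ _ _ (I3 y \o lam) (mklin h)) => i u v /=.
rewrite lamE !I3_mon pascS -addrA; congr (_ + _).
rewrite -pasc_comm -pasc_add; apply: eq_pasc => j.
by rewrite pascS; congr (_ + _); apply: eq_pasc => e; rewrite -iterSr.
Qed.
Lemma D_lam n : D (lam3 n) = lam3 (D n).
Proof.
move: n; apply: (@M3_eq _ _ _ (D \o lam3) (lam3 \o D)) => i j x y z /=.
by rewrite lam3E !D_mon !linearD !lam3E.
Qed.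
Lemma D_mu n : D (mu3 n) = mu3 (D n).
Proof.
move: n; apply: (@M3_eq _ _ _ (D \o mu3) (mu3 \o D)) => i j x y z /=.
by rewrite mu3E !D_mon !linearD !mu3E.
Qed.
Lemma ml3_lam a n : ml3 a (lam3 n) = lam3 (ml3 a n).
Proof.
move: n; apply: (@M3_eq _ _ _ (ml3 a \o lam3) (lam3 \o ml3 a)) => i j x y z /=.
by rewrite lam3E !ml3_mon lam3E.
Qed.
Lemma ml3_mu a n : ml3 a (mu3 n) = mu3 (ml3 a n).
Proof.
move: n; apply: (@M3_eq _ _ _ (ml3 a \o mu3) (mu3 \o ml3 a)) => i j x y z /=.
by rewrite mu3E !ml3_mon mu3E.
Qed.
Lemma mr3_lam a n : mr3 a (lam3 n) = lam3 (mr3 a n).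
Proof.
move: n; apply: (@M3_eq _ _ _ (mr3 a \o lam3) (lam3 \o mr3 a)) => i j x y z /=.
by rewrite lam3E !mr3_mon lam3E.
Qed.
Lemma mr3_mu a n : mr3 a (mu3 n) = mu3 (mr3 a n).
Proof.
move: n; apply: (@M3_eq _ _ _ (mr3 a \o mu3) (mu3 \o mr3 a)) => i j x y z /=.
by rewrite mu3E !mr3_mon mu3E.
Qed.
Lemma S3_lam n : S3 (lam3 n) = lam3 (S3 n).
Proof. by rewrite !S3E D_lam -lamuC !linearD. Qed.
Lemma S3_mu n : S3 (mu3 n) = mu3 (S3 n).
Proof. by rewrite !S3E D_mu lamuC !linearD. Qed.
Lemma nu_mu n : nu3 (mu3 n) = mu3 (nu3 n).
Proof. by rewrite !nu3E S3_mu linearN. Qed.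

Lemma rho_lam n : rho (lam3 n) = mu3 (rho n).
Proof.
move: n; apply: (@M3_eq _ _ _ (rho \o lam3) (mu3 \o rho)) => i j x y z /=.
by rewrite lam3E !rho_mon.
Qed.
Lemma rho_mu n : rho (mu3 n) = nu3 (rho n).
Proof.
move: n; apply: (@M3_eq _ _ _ (rho \o mu3) (nu3 \o rho)) => i j x y z /=.
rewrite mu3E !rho_mon /=; elim: i => //= i ->.
by rewrite nu_mu.
Qed.
Lemma D_nu n : D (nu3 n) = nu3 (D n).
Proof. by rewrite !nu3E linearN !S3E !linearD D_lam D_mu. Qed.
Lemma rho_D n : rho (D n) = D (rho n).
Proof.
elim/M3_ind: n => [c n n' h h'|n h|n h|x y z]; first by rewrite !linearP h h'.
- by rewrite D_lam !rho_lam h D_mu.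
- by rewrite D_mu !rho_mu h D_nu.
- by rewrite D_tens !linearD !rho_tens D_tens addrC addrA.
Qed.
Lemma rho_nu n : rho (nu3 n) = lam3 (rho n).
Proof.
rewrite nu3E S3E linearN !(linearD rho) rho_lam rho_mu rho_D nu3E S3E.
by rewrite opprD opprB addrAC addrK [lam3 _ + _]addrC [_ + _ - _]addrAC subrr add0r.
Qed.
Lemma rhoK n : rho (rho (rho n)) = n.
Proof.
elim/M3_ind: n => [c n n' h h'|n h|n h|x y z]; first by rewrite !linearP h h'.
- by rewrite rho_lam rho_mu rho_nu h.
- by rewrite rho_mu rho_nu rho_lam h.
- by rewrite !rho_tens.
Qed.

Lemma I1_linear m : linear (I1^~ m).
Proof.
move=> c a b; elim/M2_ind: m => [e m m' h h'|m h|x y]; rewrite ?linearP.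
- by rewrite h h' !scalerDr !scalerA [e * c]mulrC addrACA.
- by rewrite !I1_lam h linearP.
- by rewrite !I1_tens tens3r.
Qed.
Lemma I2_linear m : linear (I2^~ m).
Proof.
move=> c a b; elim/M2_ind: m => [e m m' h h'|m h|x y]; rewrite ?linearP.
- by rewrite h h' !scalerDr !scalerA [e * c]mulrC addrACA.
- by rewrite !I2_lam h linearP.
- by rewrite !I2_tens tens3l.
Qed.
Lemma I3_linear m : linear (I3^~ m).
Proof.
elim/M2_ind: m => [e m m' h h'|m h|x y] c a b; rewrite ?linearP.
- by rewrite h h' !scalerDr !scalerA [e * c]mulrC addrACA.
- by rewrite !I3_lam !linearP !h !linearP !scalerDr addr3ACA.
- by rewrite !I3_tens tens3m.
Qed.

Let tE := (I1_tens, I2_tens, I3_tens, ml3_tens, mr3_tens, oml_tens, omr_tens).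

Lemma I1_oml y a m : I1 y (oml a m) = ml3 a (I1 y m).
Proof.
elim/M2_ind: m => [e m m' h h'|m h|u v]; first by rewrite !linearP h h'.
  by rewrite oml_lam !I1_lam ml3_lam h.
by rewrite !tE.
Qed.
Lemma I1_mulr y b m : I1 (y * b) m = mr3 b (I1 y m).
Proof.
elim/M2_ind: m => [e m m' h h'|m h|u v]; first by rewrite !linearP h h'.
  by rewrite !I1_lam mr3_lam h.
by rewrite !tE.
Qed.
Lemma I2_mull a x m : I2 (a * x) m = ml3 a (I2 x m).
Proof.
elim/M2_ind: m => [e m m' h h'|m h|u v]; first by rewrite !linearP h h'.
  by rewrite !I2_lam ml3_mu h.
by rewrite !tE.
Qed.
Lemma I2_omr x b m : I2 x (omr b m) = mr3 b (I2 x m).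
Proof.
elim/M2_ind: m => [e m m' h h'|m h|u v]; first by rewrite !linearP h h'.
  by rewrite omr_lam !I2_lam mr3_mu h.
by rewrite !tE.
Qed.
Lemma I3_oml y a m : I3 y (oml a m) = ml3 a (I3 y m).
Proof.
elim/M2_ind: m y => [e m m' h h'|m h|u v] y; first by rewrite !linearP h h'.
  by rewrite oml_lam !I3_lam !h !linearD ml3_lam ml3_mu.
by rewrite !tE.
Qed.
Lemma I3_omr y b m : I3 y (omr b m) = mr3 b (I3 y m).
Proof.
elim/M2_ind: m y => [e m m' h h'|m h|u v] y; first by rewrite !linearP h h'.
  by rewrite omr_lam !I3_lam !h !linearD mr3_lam mr3_mu.
by rewrite !tE.
Qed.
Lemma I1_D y m : D (I1 y m) = I1 y (Dop d m) + I1 (d y) m.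
Proof.
elim/M2_ind: m => [e m m' h h'|m h|u v].
- by rewrite !linearP h h' scalerDr addrACA.
- by rewrite Dop_lam !I1_lam D_lam h linearD.
- by rewrite Dop_tens linearD !tE D_tens.
Qed.
Lemma I2_D x m : D (I2 x m) = I2 (d x) m + I2 x (Dop d m).
Proof.
elim/M2_ind: m => [e m m' h h'|m h|u v].
- by rewrite !linearP h h' scalerDr addrACA.
- by rewrite Dop_lam !I2_lam D_mu h linearD.
- by rewrite Dop_tens linearD !tE D_tens addrA.
Qed.
Lemma I3_D y m : D (I3 y m) = I3 y (Dop d m) + I3 (d y) m.
Proof.
elim/M2_ind: m y => [e m m' h h'|m h|u v] y.
- by rewrite !linearP h h' scalerDr addrACA.
- by rewrite Dop_lam !I3_lam !linearD D_lam D_mu !h !linearD addr3ACA.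
- by rewrite Dop_tens linearD !tE D_tens addrAC.
Qed.
Lemma I3_Sout y m : I3 y (Sout d m) = S3 (I3 y m).
Proof. by rewrite SoutE linearD I3_lam S3E I3_D -addrA [I3 _ m + _]addrC. Qed.
(** The reversal replaces lambda by - lambda - d, which [I3] turns into nu, and rho applied twice
    also takes lambda to nu. With [rho_I1], all three insertions reduce to rotations of [I1]. *)
Lemma I3_tau y m : I3 y (tau d m) = rho (rho (I1 y m)).
Proof.
elim/M2_ind: m => [e m m' h h'|m h|u v]; first by rewrite !linearP h h'.
  by rewrite tau_lam linearN I3_Sout h -nu3E I1_lam rho_lam rho_mu.
by rewrite tau_tens !tE !rho_tens.
Qed.
Lemma rho_I1 y m : rho (I1 y m) = I2 y m.
Proof.
elim/M2_ind: m => [e m m' h h'|m h|u v]; first by rewrite !linearP h h'.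
  by rewrite I1_lam rho_lam I2_lam h.
by rewrite !tE rho_tens.
Qed.
End Operations3Theory.

Lemma sub3ACA (W : zmodType) (p q s t u v : W) :
  p + q - (s + t) - (u + v) = p - s - u + (q - t - v).
Proof. by rewrite !opprD (addrACA p) (addrACA (p - s)). Qed.

(** * A bracket applied inside a bracket: the three terms of the Jacobi identity *)

Section Composites.
Variables (k : fieldType) (V : algType k) (d : {linear V -> V}).
Variable f : {linear V -> M2 V}.

(** In [Lop] the variable of the argument becomes mu, since there the argument is the bracket of b
    and c. In [Rop] and [Kop] it stays lambda, since there the argument is the bracket of a with c
    or with b. *)
Lemma Lop_sig : {F : {linear M2 V -> M3 V} |
  forall n x y, F (mon2 n x y) = iter n mu3 (I1 y (f x))}.
Proof.
apply: lift2 => n; apply: linear_bilin => z c x y; rewrite -iter_lin; congr iter.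
- by rewrite !linearP.
- by rewrite I1_linear.
Qed.
Lemma Rop_sig : {F : {linear M2 V -> M3 V} |
  forall n x y, F (mon2 n x y) = iter n lam3 (I2 x (f y))}.
Proof.
apply: lift2 => n; apply: linear_bilin => z c x y; rewrite -iter_lin; congr iter.
- by rewrite I2_linear.
- by rewrite !linearP.
Qed.
Lemma Kop_sig : {F : {linear M2 V -> M3 V} |
  forall n x y, F (mon2 n x y) = iter n lam3 (I3 d y (f x))}.
Proof.
apply: lift2 => n; apply: linear_bilin => z c x y; rewrite -iter_lin; congr iter.
- by rewrite !linearP.
- by rewrite I3_linear.
Qed.
End Composites.

HB.lock Definition Lop (k : fieldType) (V : algType k) (f : {linear V -> M2 V}) :
  {linear M2 V -> M3 V} := sval (Lop_sig f).
HB.lock Definition Rop (k : fieldType) (V : algType k) (f : {linear V -> M2 V}) :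
  {linear M2 V -> M3 V} := sval (Rop_sig f).
HB.lock Definition Kop (k : fieldType) (V : algType k) (d : {linear V -> V})
  (f : {linear V -> M2 V}) : {linear M2 V -> M3 V} := sval (Kop_sig d f).

Section CompositesTheory.
Variables (k : fieldType) (V : algType k) (d : {linear V -> V}).
Local Notation M := (M2 V).
Local Notation N := (M3 V).
Local Notation lam := (@lam k V).
Local Notation lam3 := (@lam3 k V).
Local Notation mu3 := (@mu3 k V).
Local Notation S3 := (S3 d).
Local Notation rho := (rho d).
Local Notation I1 := (@I1 k V).
Local Notation I2 := (@I2 k V).
Local Notation I3 := (I3 d).
Local Notation ml3 := (@ml3 k V).
Local Notation mr3 := (@mr3 k V).
Local Notation Kop := (Kop d).
Implicit Types (m : M) (n : N) (a b x y z u v : V) (f g h : {linear V -> M}).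

Lemma Lop_mon f i x y : Lop f (mon2 i x y) = iter i mu3 (I1 y (f x)).
Proof. by rewrite unlock; exact: (svalP (Lop_sig f)). Qed.
Lemma Rop_mon f i x y : Rop f (mon2 i x y) = iter i lam3 (I2 x (f y)).
Proof. by rewrite unlock; exact: (svalP (Rop_sig f)). Qed.
Lemma Kop_mon f i x y : Kop f (mon2 i x y) = iter i lam3 (I3 y (f x)).
Proof. by rewrite unlock; exact: (svalP (Kop_sig d f)). Qed.
Lemma Lop_tens f x y : Lop f (tens2 x y) = I1 y (f x). Proof. exact: Lop_mon. Qed.
Lemma Rop_tens f x y : Rop f (tens2 x y) = I2 x (f y). Proof. exact: Rop_mon. Qed.
Lemma Kop_tens f x y : Kop f (tens2 x y) = I3 y (f x). Proof. exact: Kop_mon. Qed.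
Lemma Lop_lam f m : Lop f (lam m) = mu3 (Lop f m).
Proof.
move: m; apply: (@M2_eq _ _ _ (Lop f \o lam) (mu3 \o Lop f)) => i u v /=.
by rewrite lamE !Lop_mon.
Qed.
Lemma Rop_lam f m : Rop f (lam m) = lam3 (Rop f m).
Proof.
move: m; apply: (@M2_eq _ _ _ (Rop f \o lam) (lam3 \o Rop f)) => i u v /=.
by rewrite lamE !Rop_mon.
Qed.
Lemma Kop_lam f m : Kop f (lam m) = lam3 (Kop f m).
Proof.
move: m; apply: (@M2_eq _ _ _ (Kop f \o lam) (lam3 \o Kop f)) => i u v /=.
by rewrite lamE !Kop_mon.
Qed.

Lemma Lop_Sout f m : (forall x, f (d x) = Sout d (f x)) -> Lop f (Sout d m) = S3 (Lop f m).
Proof.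
move=> fd; elim/M2_ind: m => [e m m' h h'|m h|x y]; first by rewrite !linearP h h'.
  by rewrite Sout_lam !Lop_lam S3_mu h.
rewrite SoutE linearD Lop_lam Dop_tens linearD !Lop_tens fd SoutE linearD I1_lam.
by rewrite S3E (I1_D d) [lam3 _ + mu3 _]addrC !addrA.
Qed.
Lemma Rop_Sout f m : (forall x, f (d x) = Sout d (f x)) -> Rop f (Sout d m) = S3 (Rop f m).
Proof.
move=> fd; elim/M2_ind: m => [e m m' h h'|m h|x y]; first by rewrite !linearP h h'.
  by rewrite Sout_lam !Rop_lam S3_lam h.
rewrite SoutE linearD Rop_lam Dop_tens linearD !Rop_tens fd SoutE linearD I2_lam.
by rewrite S3E (I2_D d) -[lam3 _ + _ + _]addrA; congr (_ + _); rewrite addrCA.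
Qed.
Lemma Lop_omr f b m : Lop f (omr b m) = mr3 b (Lop f m).
Proof.
elim/M2_ind: m => [e m m' h h'|m h|x y]; first by rewrite !linearP h h'.
  by rewrite omr_lam !Lop_lam mr3_mu h.
by rewrite omr_tens !Lop_tens I1_mulr.
Qed.
Lemma Rop_oml f b m : Rop f (oml b m) = ml3 b (Rop f m).
Proof.
elim/M2_ind: m => [e m m' h h'|m h|x y]; first by rewrite !linearP h h'.
  by rewrite oml_lam !Rop_lam ml3_lam h.
by rewrite oml_tens !Rop_tens I2_mull.
Qed.

(** Right multiplication of a fixed m. With it the cross terms produced by the Leibniz rule in [Lop]
    and in [Rop] both take the form [Lop (omrf (B a c)) (B b c')], so that they cancel literally. *)
Definition omrf m : {linear V -> M} := mklin (omr_linear m).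

Lemma Lop_oml f c m : (forall x y, f (x * y) = oml x (f y) + omr y (f x)) ->
  Lop f (oml c m) = ml3 c (Lop f m) + Lop (omrf (f c)) m.
Proof.
move=> fM; elim/M2_ind: m => [e m m' h h'|m h|x y].
- by rewrite !linearP h h' scalerDr addrACA.
- by rewrite oml_lam !Lop_lam ml3_mu h linearD.
- by rewrite oml_tens !Lop_tens fM linearD I1_oml.
Qed.
Lemma Lop_omrf_lam m m' : Lop (omrf (lam m)) m' = lam3 (Lop (omrf m) m').
Proof.
elim/M2_ind: m' => [e n n' h h'|n h|x y]; first by rewrite !linearP h h'.
  by rewrite !Lop_lam h lamuC.
by rewrite !Lop_tens /= omr_lam I1_lam.
Qed.
Lemma Lop_omrf_linear m' : linear (fun m => Lop (omrf m) m').
Proof.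
move=> c m n; elim/M2_ind: m' => [e p p' h h'|p h|x y]; rewrite ?linearP.
- by rewrite h h' !scalerDr !scalerA [e * c]mulrC addrACA.
- by rewrite !Lop_lam h linearP.
- by rewrite !Lop_tens /= !linearP.
Qed.
Lemma Lop_omrf_tens x y m : Lop (omrf (tens2 x y)) m = I2 x (oml y m).
Proof.
elim/M2_ind: m => [e n n' h h'|n h|u v]; first by rewrite !linearP h h'.
  by rewrite oml_lam !I2_lam Lop_lam h.
by rewrite oml_tens Lop_tens /= omr_tens I1_tens I2_tens.
Qed.
Lemma Rop_omr f c m : (forall x y, f (x * y) = oml x (f y) + omr y (f x)) ->
  Rop f (omr c m) = mr3 c (Rop f m) + Lop (omrf m) (f c).
Proof.
move=> fM; elim/M2_ind: m => [e m m' h h'|m h|x y].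
- by rewrite Lop_omrf_linear !linearP h h' scalerDr addrACA.
- by rewrite omr_lam !Rop_lam mr3_lam h linearD Lop_omrf_lam.
- by rewrite omr_tens !Rop_tens fM linearD I2_omr Lop_omrf_tens addrC.
Qed.

(** No cross term arises: the second factor of m is inserted in the middle, while a and b multiply
    the outer slots. *)
Lemma Kop_mul f g h a b m : (forall x, f x = oml a (g x) + omr b (h x)) ->
  Kop f m = ml3 a (Kop g m) + mr3 b (Kop h m).
Proof.
move=> fE; elim/M2_ind: m => [e m m' q q'|m q|x y].
- by rewrite !linearP q q' scalerDr addrACA.
- by rewrite !Kop_lam q linearD ml3_lam mr3_lam.
- by rewrite !Kop_tens fE linearD I3_oml I3_omr.
Qed.
Lemma Kop_S f g m : (forall x, f x = Sout d (g x)) -> Kop f m = S3 (Kop g m).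
Proof.
move=> fE; elim/M2_ind: m => [e m m' q q'|m q|x y]; first by rewrite !linearP q q'.
- by rewrite !Kop_lam q S3_lam.
- by rewrite !Kop_tens fE I3_Sout.
Qed.

(** The reversal produces powers of - lambda - d, and d has to pass through f; hence the assumption
    on f. *)
Lemma Rop_tau f m : (forall x, f (d x) = Sout d (f x)) -> Rop f (tau d m) = rho (Lop f m).
Proof.
move=> fd; elim/M2_ind: m => [e m m' h h'|m h|x y]; first by rewrite !linearP h h'.
  by rewrite tau_lam linearN Rop_Sout // h -nu3E Lop_lam rho_mu.
by rewrite tau_tens Rop_tens Lop_tens rho_I1.
Qed.
Lemma Kop_tau f g m : (forall x, g x = - tau d (f x)) -> Kop g m = - rho (rho (Lop f m)).
Proof.
move=> gE; elim/M2_ind: m => [e m m' h h'|m h|x y].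
- by rewrite !linearP h h'.
- by rewrite Kop_lam Lop_lam rho_mu rho_nu h linearN.
- by rewrite Kop_tens Lop_tens gE linearN I3_tau.
Qed.
End CompositesTheory.

(** * The Jacobi identity *)

Section Jacobiator.
Variables (k : fieldType) (V : algType k) (d : {linear V -> V}).
Variables (B : V -> {linear V -> M2 V}) (B' : V -> {linear V -> M2 V}).
Hypothesis BB' : forall x y, B' y x = B x y.

(** In the last term c is fixed and the first argument of the bracket varies, so [Kop] needs the
    bracket bundled as a linear map of that argument; this is [B']. *)
Definition jacobiator a b c : M3 V :=
  Lop (B a) (B b c) - Rop (B b) (B a c) - Kop d (B' c) (B a b).

Hypothesis Bd : forall a x, B a (d x) = Sout d (B a x).
Hypothesis BM : forall a x y, B a (x * y) = oml x (B a y) + omr y (B a x).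

Lemma jacobiator_d a b c : jacobiator a b (d c) = S3 d (jacobiator a b c).
Proof.
rewrite /jacobiator !Bd Lop_Sout // Rop_Sout // (@Kop_S _ _ _ _ (B' c)) ?linearB //.
by move=> x; rewrite !BB' Bd.
Qed.

(* The two terms in which [a] and [b] act on different factors cancel. *)
Lemma jacobiator_mulr a b c c' :
  jacobiator a b (c * c') = ml3 c (jacobiator a b c') + mr3 c' (jacobiator a b c).
Proof.
rewrite /jacobiator !BM (linearD (Lop _)) (linearD (Rop _)) (Lop_oml _ _ (BM a)) Lop_omr.
rewrite Rop_oml (Rop_omr _ _ (BM b)) (@Kop_mul _ _ _ _ (B' c') (B' c) c c'); last first.
  by move=> x; rewrite !BB' BM.
rewrite [X in X - _ - _]addrAC [X in _ - X - _]addrA opprD [X in X - _]addrACA subrr addr0.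
by rewrite sub3ACA !linearB.
Qed.

Hypothesis skewB : forall a b, B a b = - tau d (B b a).

Lemma jacobiatorE a b c : jacobiator a b c =
  Lop (B a) (B b c) + rho d (Lop (B b) (B c a)) + rho d (rho d (Lop (B c) (B a b))).
Proof.
rewrite /jacobiator (skewB a c) linearN opprK Rop_tau //.
by rewrite (@Kop_tau _ _ _ (B c)) ?opprK // => x; rewrite BB' skewB.
Qed.

Lemma jacobiator_cycle a b c : rho d (jacobiator b c a) = jacobiator a b c.
Proof. by rewrite !jacobiatorE !linearD /= rhoK addrC addrA. Qed.

Section Generators.
Variable G : V -> Prop.
Hypothesis G_ind : forall h : V -> M3 V, linear h ->
  (forall x, h (d x) = S3 d (h x)) ->
  (forall x y, h (x * y) = ml3 x (h y) + mr3 y (h x)) ->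
  (forall x, G x -> h x = 0) -> forall x, h x = 0.
Hypothesis Jgen : forall a b c, G a -> G b -> G c -> jacobiator a b c = 0.

Lemma jacobiator_linear a b : linear (jacobiator a b).
Proof.
move=> c x y; rewrite /jacobiator !(linearP (B _)) (linearP (Lop _)) (linearP (Rop _)).
have -> m : Kop d (B' (c *: x + y)) m = c *: Kop d (B' x) m + Kop d (B' y) m.
  elim/M2_ind: m => [e m m' h h'|m h|u v]; rewrite ?linearP.
  - by rewrite h h' !scalerDr !scalerA [e * c]mulrC addrACA.
  - by rewrite !Kop_lam h linearP.
  - by rewrite !Kop_tens !BB' !linearP.
by rewrite sub3ACA !scalerBr.
Qed.

Lemma jacobiator0 a b c : jacobiator a b c = 0.
Proof.
(* [J3] frees the last slot. Thereafter, testing the last slot on a generator u and rotating twice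
   moves u to the front, where the preceding step already allows one more arbitrary argument. *)
have J3 x y : (forall z, G z -> jacobiator x y z = 0) -> forall z, jacobiator x y z = 0.
  apply: G_ind; [exact: jacobiator_linear|exact: jacobiator_d|exact: jacobiator_mulr].
have Jcyc x y z : jacobiator x y z = 0 -> jacobiator z x y = 0.
  by move=> h; rewrite -jacobiator_cycle h linear0.
have J1 x y z : G x -> G y -> jacobiator x y z = 0.
  by move=> Gx Gy; apply: J3 => u Gu; exact: Jgen.
have J2 x y z : G x -> jacobiator x y z = 0.
  by move=> Gx; apply: J3 => u Gu; apply/Jcyc/Jcyc/J1.
by apply: J3 => u Gu; apply/Jcyc/Jcyc/J2.
Qed.
End Generators.
End Jacobiator.

(** * Derivations of freely generated algebras *)

(* A bimodule is encoded by its left action [l] and its right action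
   [r a e = e a]. *)
Record bimodule (k : fieldType) (A : algType k) (E : lmodType k) (l r : A -> E -> E) := {
  bim_ll : forall e, linear (l^~ e);
  bim_lr : forall a, linear (l a);
  bim_rl : forall e, linear (r^~ e);
  bim_rr : forall a, linear (r a);
  bim_lM : forall a b e, l (a * b) e = l a (l b e);
  bim_rM : forall a b e, r (a * b) e = r b (r a e);
  bim_C : forall a b e, l a (r b e) = r b (l a e);
  bim_l1 : forall e, l 1 e = e;
  bim_r1 : forall e, r 1 e = e
}.

Section SquareZero.
Variables (k : fieldType) (A : algType k) (E : lmodType k) (l r : A -> E -> E).

(** The type is indexed by the bimodule axioms so that the algebra structure, which depends on them,
    can be attached to it. *)
Definition sqzero of bimodule l r := (A * E)%type.
Variable bim : bimodule l r.
Local Notation W := (sqzero bim).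
HB.instance Definition _ := GRing.Lmodule.copy W (A * E)%type.

Definition sqmul (x y : W) : W := (x.1 * y.1, l x.1 y.2 + r y.1 x.2).
Definition sqone : W := (1, 0).

Let lD a x y : l a (x + y) = l a x + l a y. Proof. exact: (lin_D (bim_lr bim a)). Qed.
Let rD a x y : r a (x + y) = r a x + r a y. Proof. exact: (lin_D (bim_rr bim a)). Qed.
Let l0 a : l a 0 = 0. Proof. exact: (lin_0 (bim_lr bim a)). Qed.
Let r0 a : r a 0 = 0. Proof. exact: (lin_0 (bim_rr bim a)). Qed.
Let lDl a b x : l (a + b) x = l a x + l b x. Proof. exact: (lin_D (bim_ll bim x)). Qed.
Let rDl a b x : r (a + b) x = r a x + r b x. Proof. exact: (lin_D (bim_rl bim x)). Qed.

Lemma sqmulA : associative sqmul.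
Proof.
move=> x y z; rewrite /sqmul /= mulrA lD rD (bim_lM bim) (bim_rM bim) (bim_C bim).
by rewrite addrA.
Qed.
Lemma sqmul1r : left_id sqone sqmul.
Proof. by move=> [x e]; rewrite /sqmul /= mul1r (bim_l1 bim) r0 addr0. Qed.
Lemma sqmulr1 : right_id sqone sqmul.
Proof. by move=> [x e]; rewrite /sqmul /= mulr1 (bim_r1 bim) l0 add0r. Qed.
Lemma sqmulDl : left_distributive sqmul +%R.
Proof.
by move=> x y z; congr pair; rewrite /= ?mulrDl // lDl rD addrACA.
Qed.
Lemma sqmulDr : right_distributive sqmul +%R.
Proof.
by move=> x y z; congr pair; rewrite /= ?mulrDr // lD rDl addrACA.
Qed.
Lemma sqone_neq0 : sqone != 0.
Proof. by apply/eqP => /(congr1 fst) /= /eqP; rewrite oner_eq0. Qed.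
HB.instance Definition _ := GRing.Zmodule_isNzRing.Build W
  sqmulA sqmul1r sqmulr1 sqmulDl sqmulDr sqone_neq0.

Lemma sqscaleAl (c : k) (x y : W) : c *: (x * y) = (c *: x) * y.
Proof.
congr pair; rewrite /= ?scalerAl // scalerDr.
by rewrite (lin_Z (bim_ll bim _)) (lin_Z (bim_rr bim _)).
Qed.
HB.instance Definition _ := GRing.Lmodule_isLalgebra.Build k W sqscaleAl.
Lemma sqscaleAr (c : k) (x y : W) : c *: (x * y) = x * (c *: y).
Proof.
congr pair; rewrite /= ?scalerAr // scalerDr.
by rewrite (lin_Z (bim_lr bim _)) (lin_Z (bim_rl bim _)).
Qed.
HB.instance Definition _ := GRing.Lalgebra_isAlgebra.Build k W sqscaleAr.
Lemma sqmulE (x y : W) : x * y = (x.1 * y.1, l x.1 y.2 + r y.1 x.2).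
Proof. by []. Qed.
End SquareZero.

Section Subalgebra.
Variables (k : fieldType) (V : algType k) (P : V -> Prop).

Definition subpred : {pred V} := fun x => `[< P x >].
Lemma subpred_closed : P 1 -> (forall (c : k) x y, P x -> P y -> P (c *: x + y)) ->
  (forall x y, P x -> P y -> P (x * y)) -> subalg_closed subpred.
Proof.
move=> P1 Plin Pmul; split; rewrite ?unfold_in; first exact/asboolP.
- by move=> c x y /asboolP hx /asboolP hy; apply/asboolP/Plin.
- by move=> x y /asboolP hx /asboolP hy; apply/asboolP/Pmul.
Qed.

Definition subalg of subalg_closed subpred := {x : V | subpred x}.
Variable closedP : subalg_closed subpred.
HB.instance Definition _ := SubChoice.on (subalg closedP).
HB.instance Definition _ :=
  GRing.SubChoice_isSubAlgebra.Build k V subpred (subalg closedP) closedP.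

Lemma subalgP (c : k) (x y : subalg closedP) : val (c *: x + y) = c *: val x + val y.
Proof. exact: linearP. Qed.
Lemma subalgM (x y : subalg closedP) : val (x * y) = val x * val y.
Proof. exact: rmorphM. Qed.
Lemma subalgD (x y : subalg closedP) : val (x + y) = val x + val y.
Proof. exact: raddfD. Qed.
Lemma subalg1 : val (1 : subalg closedP) = 1. Proof. exact: rmorph1. Qed.

Lemma subalg_transfer (d : {linear V -> V}) (D' : forall x, P x -> P (d x)) :
  exists D : subalg closedP -> subalg closedP, forall x, val (D x) = d (val x).
Proof.
have h (x : subalg closedP) : subpred (d (val x)).
  by apply/asboolP/D'; apply/asboolP; exact: (valP x).
by exists (fun x => Sub (d (val x)) (h x)) => x; rewrite SubK.
Qed.
End Subalgebra.

Section FreelyGenerated.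
Variables (k : fieldType) (V : algType k) (Vg : nat -> V -> Prop) (d : {linear V -> V}).
Hypotheses (gV : graded_diff_alg Vg d) (fV : freely_generated Vg d).
Local Notation A := (Vg 0%N).
Local Notation E := (Vg 1%N).

Lemma dM x y : d (x * y) = d x * y + x * d y.
Proof. by case: gV => _ [_]. Qed.
Lemma Vg0 n : Vg n 0. Proof. by case: gV => [[h _ _ _] _ _]; case: (h n). Qed.
Lemma VgP n (c : k) x y : Vg n x -> Vg n y -> Vg n (c *: x + y).
Proof. by case: gV => [[h _ _ _] _ _]; case: (h n) => _; apply. Qed.
Lemma VgD n x y : Vg n x -> Vg n y -> Vg n (x + y).
Proof. by move=> hx hy; rewrite -[x]scale1r; apply: VgP. Qed.
Lemma VgZ n c x : Vg n x -> Vg n (c *: x).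
Proof. by move=> hx; rewrite -[_ *: _]addr0; apply: VgP => //; exact: Vg0. Qed.
Lemma VgN n x : Vg n x -> Vg n (- x).
Proof. by move=> hx; rewrite -scaleN1r; apply: VgZ. Qed.
Lemma VgM m n x y : Vg m x -> Vg n y -> Vg (m + n) (x * y).
Proof. by case: gV => [[_ _ _ h] _ _]; apply: h. Qed.
Lemma Vgd n x : Vg n x -> Vg n.+1 (d x).
Proof. by case: gV => _ _; apply. Qed.

Lemma Vg_span v : exists N (c : nat -> V), (forall i, Vg i (c i)) /\ v = \sum_(i < N) c i.
Proof. by case: gV => [[_ h _ _] _ _]; apply: h. Qed.
Lemma Vg_indep N (c : nat -> V) : (forall i, Vg i (c i)) ->
  \sum_(i < N) c i = 0 -> forall i, (i < N)%N -> c i = 0.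
Proof. by case: gV => [[_ _ h _] _ _]; apply: h. Qed.

(* The degree-0 component of 1 is a left unit on homogeneous elements. *)
Lemma A1 : A 1.
Proof.
have [N [c [hc c1]]] := Vg_span 1.
have N0 : (0 < N)%N.
  by case: N c1 => // /eqP; rewrite big_ord0 oner_eq0.
have c0V n y : Vg n y -> c 0%N * y = y.
  (* The homogeneous components of 1 y - y, with c i y placed in degree i + n. They sum to 0, so the
     component of degree n, which is c 0 y - y, vanishes. *)
  move=> hy; pose e j := if (j < n)%N then 0 else c (j - n)%N * y - (if j == n then y else 0).
  have he j : Vg j (e j).
    rewrite /e; case: ltnP => [_|nj]; first exact: Vg0.
    apply: VgD; first by rewrite -[X in Vg X _](subnK nj); apply: VgM.
    by apply: VgN; case: eqP => [->|_] //; exact: Vg0.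
  have := @Vg_indep (n + N) e he.
  rewrite big_split_ord big1 => [|i _]; last by rewrite /e /= ltn_ord.
  have -> : \sum_(i < N) e (rshift n i) = 0.
    under eq_bigr => i _ do rewrite /e /= ltnNge leq_addr /= addKn -[X in _ == X]addn0 eqn_add2l.
    rewrite sumrB -mulr_suml -c1 mul1r -(big_mkord xpredT (fun i => if i == 0%N then y else 0)).
    rewrite big_ltn // big1_seq ?addr0 ?subrr // => i /andP[_]; rewrite mem_index_iota.
    by case: i.
  move=> /(_ (addr0 _) n); rewrite /e ltnn subnn eqxx -[X in (X < _)%N]addn0 ltn_add2l.
  by move=> /(_ N0) /eqP; rewrite subr_eq0 => /eqP.
suff c0l x : c 0%N * x = x by rewrite -(c0l 1) mulr1.
have [N' [y [hy ->]]] := Vg_span x.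
by rewrite mulr_sumr; apply: eq_bigr => i _; apply: c0V.
Qed.

(** Uniqueness in the universal property with target V itself. *)
Lemma free_id (Psi : V -> V) : ext_hom Vg d id id d Psi -> forall x, Psi x = x.
Proof.
have [||//|//|//|//|//|//|P [_ uP]] := @fV V d id id.
- exact: linearP.
- exact: dM.
by move=> hPsi x; rewrite (uP _ hPsi) -(uP id).
Qed.

(* Map V to the subalgebra of the elements satisfying [P]. *)
Lemma free_ind (P : V -> Prop) :
  (forall c x y, P x -> P y -> P (c *: x + y)) -> (forall x y, P x -> P y -> P (x * y)) ->
  (forall x, P x -> P (d x)) -> (forall a, A a -> P a) -> (forall e, E e -> P e) ->
  forall x, P x.
Proof.
move=> Plin Pmul Pd PA PE.
have closedP := subpred_closed (PA 1 A1) Plin Pmul.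
pose W := subalg closedP; have [D hD] := subalg_transfer closedP Pd.
(* The universal property takes maps defined on all of V and constrained only on A and E, so the
   lifts to the subalgebra get the default value 0 where no membership in P is available. *)
have hA a : exists w : W, A a -> val w = a.
  have [/asboolP Pa|nPa] := pselect (P a); last by exists 0 => /PA.
  by exists (Sub a Pa : W) => _; rewrite SubK.
have hE e : exists w : W, E e -> val w = e.
  have [/asboolP Pa|nPa] := pselect (P e); last by exists 0 => /PE.
  by exists (Sub e Pa : W) => _; rewrite SubK.
pose p0 a := projT1 (cid (hA a)); pose p1 e := projT1 (cid (hE e)).
have p0E a : A a -> val (p0 a) = a by rewrite /p0; case: cid => w /= h /h.
have p1E a : E a -> val (p1 a) = a by rewrite /p1; case: cid => w /= h /h.
have [||||||||Psi [[Pl [PM P1] Pd' PA' PE'] _]] := @fV W D p0 p1.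
- by move=> c x y; apply: val_inj; rewrite hD !subalgP !hD linearP.
- by move=> x y; apply: val_inj; rewrite hD subalgD !subalgM !hD dM.
- move=> c a b ha hb; apply: val_inj; rewrite subalgP p0E ?p0E //.
  exact: VgP.
- move=> a b ha hb; apply: val_inj; rewrite subalgM !p0E //.
  by rewrite -[0%N]addn0; apply: VgM.
- by apply: val_inj; rewrite p0E ?subalg1 //; exact: A1.
- move=> c a b ha hb; apply: val_inj; rewrite subalgP p1E ?p1E //.
  exact: VgP.
- move=> a e b ha he hb; apply: val_inj; rewrite !subalgM p1E ?p0E ?p1E //.
  by rewrite -[1%N]addn0; apply: VgM => //; rewrite -[1%N]add0n; apply: VgM.
- move=> a ha; apply: val_inj; rewrite hD p0E // p1E //.
  exact: Vgd.
(* The composite of V -> W with the inclusion W -> V fixes A and E, hence is the identity, so every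
   x lies in the subalgebra. *)
move=> x; suff <- : val (Psi x) = x by apply/asboolP; exact: (valP (Psi x)).
move: x; apply: (@free_id (fun x => val (Psi x))); split.
- by move=> c x y; rewrite Pl subalgP.
- by split=> [x y|]; rewrite ?PM ?subalgM ?P1 ?subalg1.
- by move=> x; rewrite Pd' hD.
- by move=> a ha; rewrite PA' ?p0E.
- by move=> a ha; rewrite PE' ?p1E.
Qed.

Section Derivations.
Variables (M : lmodType k) (l r : V -> M -> M) (S : {linear M -> M}).
Hypothesis bim : bimodule l r.
Hypotheses (Sl : forall a m, S (l a m) = l (d a) m + l a (S m))
  (Sr : forall a m, S (r a m) = r a (S m) + r (d a) m).

Record is_der (h : V -> M) := {
  der_lin : linear h;
  der_mul : forall x y, h (x * y) = l x (h y) + r y (h x);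
  der_d : forall x, h (d x) = S (h x)
}.

Lemma der0 h : is_der h -> (forall a, A a -> h a = 0) -> (forall e, E e -> h e = 0) ->
  forall x, h x = 0.
Proof.
move=> [hl hm hd] hA hE; apply: free_ind => //.
- by move=> c x y hx hy; rewrite hl hx hy scaler0 addr0.
- move=> x y hx hy.
  by rewrite hm hx hy (lin_0 (bim_lr bim _)) (lin_0 (bim_rr bim _)) addr0.
- by move=> x hx; rewrite hd hx linear0.
Qed.

Lemma der_sub h h' : is_der h -> is_der h' -> is_der (fun x => h x - h' x).
Proof.
move=> [hl hm hd] [hl' hm' hd']; split.
- by move=> c x y; rewrite hl hl' scalerBr opprD addrACA.
- move=> x y; rewrite hm hm' (lin_D (bim_lr bim _)) (lin_D (bim_rr bim _)).
  by rewrite (lin_N (bim_lr bim _)) (lin_N (bim_rr bim _)) opprD addrACA.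
- by move=> x; rewrite hd hd' linearB.
Qed.

Lemma der_eq h h' : is_der h -> is_der h' -> (forall a, A a -> h a = h' a) ->
  (forall e, E e -> h e = h' e) -> forall x, h x = h' x.
Proof.
move=> dh dh' hA hE x; apply/eqP; rewrite -subr_eq0; apply/eqP; move: x.
by apply: der0 => [|a /hA ->|e /hE ->]; rewrite ?subrr //; apply: der_sub.
Qed.

(* The extension is the second component of a differential algebra map
   into the square-zero extension V (+) M. *)
Lemma der_ext (h0 h1 : V -> M) :
  (forall (c : k) a b, A a -> A b -> h0 (c *: a + b) = c *: h0 a + h0 b) ->
  (forall a b, A a -> A b -> h0 (a * b) = l a (h0 b) + r b (h0 a)) ->
  (forall (c : k) e f, E e -> E f -> h1 (c *: e + f) = c *: h1 e + h1 f) ->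
  (forall a e b, A a -> E e -> A b ->
     h1 (a * e * b) = l (a * e) (h0 b) + r b (l a (h1 e) + r e (h0 a))) ->
  (forall a, A a -> h1 (d a) = S (h0 a)) ->
  {h : V -> M | [/\ is_der h, forall a, A a -> h a = h0 a & forall e, E e -> h e = h1 e]}.
Proof.
move=> hl0 hm0 hl1 hm1 hd; apply: cid.
pose W := sqzero bim; pose D (w : W) : W := (d w.1, S w.2).
have h01 : h0 1 = 0.
  apply: (addIr (h0 1)); rewrite add0r -[in RHS](mulr1 1) hm0; try exact: A1.
  by rewrite (bim_l1 bim) (bim_r1 bim).
have [||||||||Psi [[Pl [PM P1] Pd PA PE] _]] :=
  @fV W D (fun a => (a, h0 a)) (fun e => (e, h1 e)).
- by move=> c x y; congr pair; rewrite /= linearP.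
- move=> x y; congr pair; rewrite /= ?dM // linearD Sl Sr.
  by rewrite addrACA [X in X + _]addrC [X in _ + X]addrC addrACA addrC.
- by move=> c a b ha hb; rewrite hl0.
- by move=> a b ha hb; congr pair; rewrite hm0.
- by rewrite h01.
- by move=> c a b ha hb; rewrite hl1.
- by move=> a e b ha he hb; congr pair; rewrite hm1.
- by move=> a ha; congr pair; rewrite hd.
(* The first component is an endomorphism fixing A and E. Once it is the identity, multiplicativity
   in the second component reads as the Leibniz rule over V. *)
have Psi1 x : (Psi x).1 = x.
  apply: (@free_id (fun x => (Psi x).1)); split.
  - by move=> c u v; rewrite Pl.
  - by split=> [u v|]; rewrite ?PM ?P1.
  - by move=> u; rewrite Pd.
  - by move=> a ha; rewrite PA.
  - by move=> e he; rewrite PE.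
exists (fun x => (Psi x).2); split; first split.
- by move=> c u v; rewrite Pl.
- by move=> u v; rewrite PM sqmulE !Psi1.
- by move=> u; rewrite Pd.
- by move=> a ha; rewrite PA.
- by move=> e he; rewrite PE.
Qed.
End Derivations.
End FreelyGenerated.

(** * Brackets in terms of representatives *)

Lemma big_flatten_map (W : zmodType) (I J : Type) (F : I -> seq J) (s : seq I) (G : J -> W) :
  \sum_(j <- flatten [seq F i | i <- s]) G j = \sum_(i <- s) \sum_(j <- F i) G j.
Proof. by rewrite big_flatten big_map. Qed.
Lemma big_iota0 (W : zmodType) n (F : nat -> W) :
  \sum_(j <- iota 0 n) F j = \sum_(j < n) F j.
Proof. by rewrite -(big_mkord xpredT) /index_iota subn0. Qed.

Section Representatives.
Variables (k : fieldType) (V : algType k) (d : {linear V -> V}).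
Local Notation M := (M2 V).
Local Notation lam := (@lam k V).
Implicit Types (P Q : P2 V) (t s : T2 V) (a b x y : V).

Lemma mon2Zl n c x y : mon2 n (c *: x) y = c *: mon2 n x y.
Proof. exact: (lin_Z (mon2l n y)). Qed.

Lemma iter_sum (W : lmodType k) (L : {linear W -> W}) n I (r : seq I) (F : I -> W) :
  iter n L (\sum_(i <- r) F i) = \sum_(i <- r) iter n L (F i).
Proof. by elim: n => //= n ->; rewrite linear_sum. Qed.
Lemma iter_Mn (W : lmodType k) (L : {linear W -> W}) n (w : W) m :
  iter n L (w *+ m) = iter n L w *+ m.
Proof. by elim: n => //= n ->; rewrite linearMn. Qed.
Lemma iter_lamE i n x y : iter i lam (mon2 n x y) = mon2 (i + n) x y.
Proof. by elim: i => //= i ->; rewrite lamE. Qed.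

Lemma q2_scP2 c P : q2 (scP2 c P) = c *: q2 P.
Proof.
by rewrite /q2 big_map scaler_sumr; apply: eq_bigr => m _; rewrite mon2Zl.
Qed.
Lemma q2_Sin P : q2 [seq (m.1.+1, (- m.2.1, m.2.2)) | m <- P] = Sin _ (q2 P).
Proof.
rewrite /q2 big_map SinE linear_sum -sumrN; apply: eq_bigr => m _ /=.
by rewrite -scaleN1r mon2Zl scaleN1r lamE.
Qed.
Lemma q2_lam P : q2 [seq (m.1.+1, m.2) | m <- P] = lam (q2 P).
Proof. by rewrite /q2 big_map linear_sum; apply: eq_bigr => m _; rewrite lamE. Qed.
Lemma q2_Dop P :
  q2 (flatten [seq [seq (m.1, z) | z <- D2 d [:: m.2]] | m <- P]) = Dop d (q2 P).
Proof.
rewrite /q2 big_flatten_map linear_sum; apply: eq_bigr => m _.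
by rewrite Dop_mon /D2 /= !big_cons big_nil addr0.
Qed.
Lemma q2_oml b P : q2 [seq (m.1, (b * m.2.1, m.2.2)) | m <- P] = oml b (q2 P).
Proof. by rewrite /q2 big_map linear_sum; apply: eq_bigr => m _; rewrite oml_mon. Qed.
Lemma q2_omr b P : q2 [seq (m.1, (m.2.1, m.2.2 * b)) | m <- P] = omr b (q2 P).
Proof. by rewrite /q2 big_map linear_sum; apply: eq_bigr => m _; rewrite omr_mon. Qed.
Lemma q2_imr b P :
  q2 (flatten [seq [seq ((m.1 - j)%N, (('C(m.1, j))%:R *: (m.2.1 * iter j d b), m.2.2))
                  | j <- iota 0 m.1.+1] | m <- P]) = imr d b (q2 P).
Proof.
rewrite /q2 big_flatten_map linear_sum; apply: eq_bigr => m _.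
rewrite imr_mon big_map big_iota0; apply: eq_bigr => j _ /=.
by rewrite mon2Zl scaler_nat.
Qed.
Lemma q2_iml a P :
  q2 (flatten [seq [seq ((m.1 - j)%N, (('C(m.1, j))%:R *: m.2.1, iter j d a * m.2.2))
                  | j <- iota 0 m.1.+1] | m <- P]) = iml d a (q2 P).
Proof.
rewrite /q2 big_flatten_map linear_sum; apply: eq_bigr => m _.
rewrite iml_mon big_map big_iota0; apply: eq_bigr => j _ /=.
by rewrite mon2Zl scaler_nat.
Qed.

Lemma qt_sc2 c t : qt (sc2 c t) = c *: qt t.
Proof.
by rewrite /qt big_map scaler_sumr; apply: eq_bigr => p _; rewrite [LHS]mon2Zl.
Qed.
Lemma qt_oml a t : qt (lmul2 a t) = oml a (qt t).
Proof. by rewrite /qt big_map linear_sum; apply: eq_bigr => p _; rewrite oml_tens. Qed.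
Lemma qt_omr a t : qt (rmul2 t a) = omr a (qt t).
Proof. by rewrite /qt big_map linear_sum; apply: eq_bigr => p _; rewrite omr_tens. Qed.
Lemma qt_tau t : qt (sig2 t) = tau d (qt t).
Proof. by rewrite /qt big_map linear_sum; apply: eq_bigr => p _; rewrite tau_tens. Qed.
Lemma qt_Dop t : qt (D2 d t) = Dop d (qt t).
Proof.
rewrite /qt big_flatten_map linear_sum; apply: eq_bigr => p _.
by rewrite Dop_tens !big_cons big_nil addr0.
Qed.
Lemma qt_outer a b t : qt [seq (a * p.1, p.2 * b) | p <- t] = oml a (omr b (qt t)).
Proof.
rewrite /qt big_map !linear_sum; apply: eq_bigr => p _.
by rewrite omr_tens oml_tens.
Qed.
Lemma qt_inner a b t : qt [seq (p.1 * b, a * p.2) | p <- t] = imr d b (iml d a (qt t)).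
Proof.
rewrite /qt big_map !linear_sum; apply: eq_bigr => p _.
by rewrite iml_tens imr_tens.
Qed.
Lemma qt_opp t : qt [seq (- p.1, p.2) | p <- t] = - qt t.
Proof.
rewrite /qt big_map -sumrN; apply: eq_bigr => p _.
by rewrite -scaleN1r [LHS]mon2Zl scaleN1r.
Qed.

Lemma iter_Sout n m : iter n (Sout d) m = pasc lam (fun j => iter j (Dop d) m) n.
Proof.
elim: n => [|n IHn]; first by rewrite pasc0.
rewrite pascS /= IHn SoutE; congr (_ + _); rewrite /pasc linear_sum.
apply: eq_bigr => j _; rewrite linearMn; congr (_ *+ _).
by elim: (n - j)%N => //= e <-; rewrite Dop_lam.
Qed.

Lemma iter_nu2 n m : iter n (nu2 d) m = (-1) ^+ n *: iter n (Sout d) m.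
Proof.
elim: n => [|n IHn] /=; first by rewrite scale1r.
by rewrite IHn linearZZ exprS -scalerA scaleN1r.
Qed.

(** The power (- lambda - d)^p is expanded in two stages: the sign is pulled out, then lambda and
    [Dop] are separated binomially, which is possible because they commute. *)
Lemma q2_tau P :
  q2 (flatten [seq flatten [seq
        [seq ((m.1 - j)%N, (- ((-1) ^+ m.1 * ('C(m.1, j))%:R) *: z.1, z.2))
        | z <- iter j (D2 d) [:: (m.2.2, m.2.1)]]
      | j <- iota 0 m.1.+1] | m <- P]) = - tau d (q2 P).
Proof.
rewrite /q2 big_flatten_map linear_sum -sumrN; apply: eq_bigr => m _.
rewrite tau_mon iter_nu2 iter_Sout big_flatten_map big_iota0.
rewrite /pasc scaler_sumr -sumrN; apply: eq_bigr => j _; rewrite big_map /=.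
under eq_bigr => z _ do rewrite mon2Zl scaleNr -scalerA scaler_nat.
rewrite sumrN -scaler_sumr sumrMnl; congr (- _); congr (_ *: _); congr (_ *+ _).
have -> : iter j (Dop d) (tens2 m.2.2 m.2.1) = qt (iter j (D2 d) [:: (m.2.2, m.2.1)]).
  elim: (nat_of_ord j) => [|e IHe] /=; last by rewrite IHe qt_Dop.
  by rewrite /qt big_seq1.
rewrite /qt iter_sum; apply: eq_bigr => z _.
by rewrite iter_lamE addn0.
Qed.

Variable br : V -> V -> P2 V.
Let b x y : M := q2 (br x y).

Lemma br_bilinP : br_bilin br <-> (forall x, linear (b x)) /\ (forall y, linear (b^~ y)).
Proof.
split=> [h|[h1 h2] c x y z].
  by split=> z c x y; case: (h c x y z) => /q2_eq + /q2_eq; rewrite !q2_cat !q2_scP2.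
by split; apply/q2_eq; rewrite q2_cat q2_scP2; [exact: h2|exact: h1].
Qed.
Lemma sesq_lP : sesq_l d br <-> forall x y, b (d x) y = Sin _ (b x y).
Proof. by split=> h x y; [move/q2_eq: (h x y)|apply/q2_eq]; rewrite q2_Sin //; exact: h. Qed.
Lemma sesq_rP : sesq_r d br <-> forall x y, b x (d y) = Sout d (b x y).
Proof.
split=> h x y; [move/q2_eq: (h x y)|apply/q2_eq]; rewrite q2_cat q2_lam q2_Dop -SoutE //.
exact: h.
Qed.
Lemma leibniz_lP : leibniz_l br <-> forall x y z, b x (y * z) = oml y (b x z) + omr z (b x y).
Proof.
split=> h x y z; [move/q2_eq: (h x y z)|apply/q2_eq]; rewrite q2_cat q2_oml q2_omr //.
exact: h.
Qed.
Lemma leibniz_rP : leibniz_r d br <->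
  forall x y z, b (x * y) z = iml d x (b y z) + imr d y (b x z).
Proof.
split=> h x y z; [move/q2_eq: (h x y z)|apply/q2_eq]; rewrite q2_cat q2_imr q2_iml addrC //.
exact: h.
Qed.
Lemma skewsymP : skewsym d br <-> forall x y, b x y = - tau d (b y x).
Proof. by split=> h x y; [move/q2_eq: (h x y)|apply/q2_eq]; rewrite q2_tau //; exact: h. Qed.

Lemma mon3Mn n m x y z e : mon3 n m x (y *+ e) z = mon3 n m x y z *+ e.
Proof. by rewrite -scaler_nat (lin_Z (mon3m n m x z)) scaler_nat. Qed.
Lemma iter_lam3E i n m x y z : iter i (@lam3 k V) (mon3 n m x y z) = mon3 (i + n) m x y z.
Proof. by elim: i => //= i ->; rewrite lam3E. Qed.
Lemma iter_mu3E i n m x y z : iter i (@mu3 k V) (mon3 n m x y z) = mon3 n (i + m) x y z.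
Proof. by elim: i => //= i ->; rewrite mu3E. Qed.

Variables B B' : V -> {linear V -> M}.
Hypotheses (bB : forall x y, B x y = b x y) (bB' : forall x y, B' y x = b x y).

Lemma jacobiP : jacobi d br <-> forall x y z, jacobiator d B B' x y z = 0.
Proof.
have L1 x y z : q3 (flatten [seq [seq ((p.1, q.1), (p.2.1, p.2.2, q.2.2)) | p <- br x q.2.1]
             | q <- br y z]) = Lop (B x) (B y z).
  rewrite bB /q3 big_flatten_map /b linear_sum; apply: eq_bigr => q _.
  rewrite Lop_mon bB /b !linear_sum iter_sum big_map; apply: eq_bigr => p _ /=.
  by rewrite I1_mon iter_mu3E addn0.
have L2 x y z : q3 (flatten [seq [seq ((p.1, q.1), (p.2.1, q.2.1, q.2.2)) | q <- br y p.2.2]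
             | p <- br x z]) = Rop (B y) (B x z).
  rewrite bB /q3 big_flatten_map /b linear_sum; apply: eq_bigr => q _.
  rewrite Rop_mon bB /b !linear_sum iter_sum big_map; apply: eq_bigr => p _ /=.
  by rewrite I2_mon iter_lam3E addn0.
have L3 x y z : q3 (flatten [seq flatten [seq flatten [seq
        [seq (((p.1 + i)%N, j),
              (q.2.1,
               iter (q.1 - i - j) d p.2.2 *+ ('C(q.1, i) * 'C(q.1 - i, j)),
               q.2.2))
        | j <- iota 0 (q.1 - i).+1]
      | i <- iota 0 q.1.+1] | q <- br p.2.1 z] | p <- br x y]) = Kop d (B' z) (B x y).
  rewrite bB /q3 big_flatten_map /b linear_sum; apply: eq_bigr => p _.
  rewrite Kop_mon bB' /b !linear_sum iter_sum big_flatten_map; apply: eq_bigr => q _.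
  (* In [jacobi] the indices i and j count powers of lambda and mu, whereas [pasc] counts
     derivatives; both expansions are reversed before they are compared. *)
  rewrite I3_mon pasc_rev iter_sum big_flatten_map big_iota0.
  apply: eq_bigr => i _; rewrite pasc_rev iter_Mn !iter_sum -sumrMnl.
  rewrite big_map big_iota0; apply: eq_bigr => j _ /=.
  by rewrite !iter_Mn iter_mu3E !iter_lam3E !addn0 mon3Mn mulnC mulrnA.
split=> h x y z; [move/q3_eq: (h x y z)|apply/q3_eq; move: (h x y z)].
  by rewrite !q3_cat L1 L2 L3 /jacobiator => ->; rewrite -addrA -opprD subrr.
by rewrite !q3_cat L1 L2 L3 /jacobiator => /eqP; rewrite -addrA -opprD subr_eq0 => /eqP.
Qed.
End Representatives.

(** Sorts the thirteen terms of J(e,f,g), for e, f, g in E, into the coefficients of 1, lambda and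
    mu, in this order. *)
Lemma sub_regroup (W : zmodType) (a1 a2 a3 a4 b1 b2 b3 b4 c1 c2 c3 c4 c5 : W) :
  a1 + a2 + a3 + a4 - (b1 + (b2 + b3) + b4) - (c1 + c2 + c3 + c4 + c5) =
  a1 + a3 - (b1 + b2 + (c1 + c4)) + (a2 - (b4 + (c2 + c5))) + (a4 - (b3 + c3)).
Proof.
by rewrite !opprD !addrA [LHS](ACl (1*3*5*6*9*12*2*8*10*13*4*7*11)).
Qed.

(** * Nested brackets of homogeneous elements as lists of tensors *)

Section Insertions.
Variables (k : fieldType) (V : algType k) (d : {linear V -> V}).
Local Notation M := (M2 V).
Implicit Types (F G : V -> T2 V) (s t : T2 V) (f : {linear V -> M}) (P Q : V -> Prop).

(** These three lists have literally the form of those in [CD6] and [CD7], so that the axioms match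
    after unfolding. *)
Definition ins1 F s : T3 V := flatten [seq [seq (x.1, x.2, p.2) | x <- F p.1] | p <- s].
Definition ins2 F s : T3 V := flatten [seq [seq (p.1, x.1, x.2) | x <- F p.2] | p <- s].
Definition ins3 F s : T3 V := flatten [seq [seq (x.1, p.2, x.2) | x <- F p.1] | p <- s].

Lemma I1_qt y t : I1 y (qt t) = qt3 [seq (x.1, x.2, y) | x <- t].
Proof. by rewrite /qt3 big_map linear_sum; apply: eq_bigr => x _; rewrite I1_tens. Qed.
Lemma I2_qt y t : I2 y (qt t) = qt3 [seq (y, x.1, x.2) | x <- t].
Proof. by rewrite /qt3 big_map linear_sum; apply: eq_bigr => x _; rewrite I2_tens. Qed.
Lemma I3_qt y t : I3 d y (qt t) = qt3 [seq (x.1, y, x.2) | x <- t].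
Proof. by rewrite /qt3 big_map linear_sum; apply: eq_bigr => x _; rewrite I3_tens. Qed.
Lemma I3_qtN y t : I3 d y (- qt t) = qt3 [seq (- x.1, y, x.2) | x <- t].
Proof. by rewrite -qt_opp I3_qt -map_comp. Qed.

Lemma qt3_ins1 F s : qt3 (ins1 F s) = \sum_(p <- s) I1 p.2 (qt (F p.1)).
Proof. by rewrite /qt3 big_flatten_map; apply: eq_bigr => p _; rewrite I1_qt. Qed.
Lemma qt3_ins2 F s : qt3 (ins2 F s) = \sum_(p <- s) I2 p.1 (qt (F p.2)).
Proof. by rewrite /qt3 big_flatten_map; apply: eq_bigr => p _; rewrite I2_qt. Qed.
Lemma qt3_ins3 F s : qt3 (ins3 F s) = \sum_(p <- s) I3 d p.2 (qt (F p.1)).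
Proof. by rewrite /qt3 big_flatten_map; apply: eq_bigr => p _; rewrite I3_qt. Qed.

Lemma Lop_hom0 P Q f F s : hom2 P Q s -> (forall x, P x -> f x = qt (F x)) ->
  Lop f (qt s) = qt3 (ins1 F s).
Proof.
move=> hs hf; rewrite qt3_ins1 linear_sum; apply: eq_big_seq => p /hs [hp _].
by rewrite Lop_tens hf.
Qed.
Lemma Lop_hom1 P Q f F G s : hom2 P Q s ->
  (forall x, P x -> f x = qt (F x) + lam (qt (G x))) ->
  Lop f (qt s) = qt3 (ins1 F s) + lam3 (qt3 (ins1 G s)).
Proof.
move=> hs hf; rewrite !qt3_ins1 !linear_sum -big_split; apply: eq_big_seq => p /hs [hp _].
by rewrite Lop_tens hf // linearD I1_lam.
Qed.
Lemma Rop_hom0 P Q f F s : hom2 P Q s -> (forall x, Q x -> f x = qt (F x)) ->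
  Rop f (qt s) = qt3 (ins2 F s).
Proof.
move=> hs hf; rewrite qt3_ins2 linear_sum; apply: eq_big_seq => p /hs [_ hp].
by rewrite Rop_tens hf.
Qed.
Lemma Rop_hom1 P Q f F G s : hom2 P Q s ->
  (forall x, Q x -> f x = qt (F x) + lam (qt (G x))) ->
  Rop f (qt s) = qt3 (ins2 F s) + mu3 (qt3 (ins2 G s)).
Proof.
move=> hs hf; rewrite !qt3_ins2 !linear_sum -big_split; apply: eq_big_seq => p /hs [_ hp].
by rewrite Rop_tens hf // linearD I2_lam.
Qed.
Lemma Kop_hom0 P Q f F s : hom2 P Q s -> (forall x, P x -> f x = qt (F x)) ->
  Kop d f (qt s) = qt3 (ins3 F s).
Proof.
move=> hs hf; rewrite qt3_ins3 linear_sum; apply: eq_big_seq => p /hs [hp _].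
by rewrite Kop_tens hf.
Qed.
Lemma Kop_hom0N P Q f F s : hom2 P Q s -> (forall x, P x -> f x = - qt (F x)) ->
  Kop d f (qt s) = qt3 (flatten [seq [seq (- x.1, p.2, x.2) | x <- F p.1] | p <- s]).
Proof.
move=> hs hf; rewrite /qt3 big_flatten_map linear_sum; apply: eq_big_seq => p /hs [hp _].
by rewrite Kop_tens hf // I3_qtN.
Qed.
(** [I3] turns lambda into lambda + mu + d. The d-part acts on the middle factor and accounts for
    the pairing term with a differentiated middle entry in [CD6]. *)
Lemma Kop_hom1 P Q f F G s : hom2 P Q s ->
  (forall x, P x -> f x = qt (F x) + lam (qt (G x))) ->
  Kop d f (qt s) = qt3 (flatten [seq [seq (x.1, p.2, x.2) | x <- F p.1] ++
                                    [seq (x.1, d p.2, x.2) | x <- G p.1] | p <- s])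
   + lam3 (qt3 (ins3 G s)) + mu3 (qt3 (ins3 G s)).
Proof.
move=> hs hf; rewrite !qt3_ins3 !linear_sum /qt3 big_flatten_map -!big_split.
apply: eq_big_seq => p /hs [hp _] /=; rewrite Kop_tens hf // linearD (I3_lam d) I3_qt.
by rewrite big_cat /= -[\sum_(i <- map _ (F _)) _]/(qt3 _) -[\sum_(i <- map _ (G _)) _]/(qt3 _)
  [I3 d (d _) _]I3_qt [X in _ + X = _]addrC !addrA.
Qed.

Lemma qt3N (u : T3 V) : - qt3 u = qt3 [seq (- x.1.1, x.1.2, x.2) | x <- u].
Proof.
rewrite /qt3 big_map -sumrN; apply: eq_bigr => x _.
by rewrite -scaleN1r -[- x.1.1]scaleN1r (lin_Z (tens3l _ _)).
Qed.
Lemma qt3B (s t : T3 V) : exists u, qt3 s - qt3 t = qt3 u.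
Proof. by rewrite qt3N -qt3_cat; eexists. Qed.
Lemma rho_qt3 (t : T3 V) : rho d (qt3 t) = qt3 [seq (x.2, x.1.1, x.1.2) | x <- t].
Proof. by rewrite /qt3 big_map linear_sum; apply: eq_bigr => x _; rewrite rho_tens. Qed.
Lemma qt3_indepB (s s' t u u' : T3 V) :
  qt3 s - qt3 s' + lam3 (qt3 t) + mu3 (qt3 u - qt3 u') = 0 ->
  [/\ qt3 s = qt3 s', qt3 t = 0 & qt3 u = qt3 u'].
Proof.
have [v hv] := qt3B s s'; have [w hw] := qt3B u u'.
rewrite hv hw => /qt3_indep[]; rewrite -hv -hw => /eqP + -> /eqP.
by rewrite !subr_eq0 => /eqP -> /eqP ->.
Qed.
End Insertions.

(** * The Jacobi expression on A and E *)

Section JacobiatorOnGenerators.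
Variables (k : fieldType) (V : algType k) (Vg : nat -> V -> Prop) (d : {linear V -> V}).
Variables (B B' : V -> {linear V -> M2 V}) (pr cb : V -> V -> T2 V).
Local Notation A := (Vg 0%N).
Local Notation E := (Vg 1%N).
Local Notation J := (jacobiator d B B').
Hypothesis BB' : forall x y, B' y x = B x y.
Hypotheses (BEE : forall e f, E e -> E f -> B e f = qt (cb e f) + lam (qt (pr e f)))
  (BEA : forall e a, E e -> A a -> B e a = qt (pr e (d a)))
  (BAE : forall a e, A a -> E e -> B a e = - qt (pr (d a) e))
  (BAA : forall a b, A a -> A b -> B a b = 0).

(* The coefficients of 1 and mu are the two sides of the axioms CD6 and CD7. *)
Lemma jacobiator_EEE e f g s1 s2 s3 tl1 tr1 tl2 tr2 tl3 tr3 : E e -> E f -> E g ->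
  t2eq (pr f g) s1 -> hom2 A A s1 -> t2eq (pr e g) s2 -> hom2 A A s2 ->
  t2eq (pr e f) s3 -> hom2 A A s3 ->
  t2eq (cb f g) (tl1 ++ tr1) -> hom2 E A tl1 -> hom2 A E tr1 ->
  t2eq (cb e g) (tl2 ++ tr2) -> hom2 E A tl2 -> hom2 A E tr2 ->
  t2eq (cb e f) (tl3 ++ tr3) -> hom2 E A tl3 -> hom2 A E tr3 ->
  exists c1,
  J e f g =
    qt3 (ins1 (cb e) tl1 ++ ins1 (fun x => pr e (d x)) tr1) -
    qt3 ((ins2 (fun x => pr f (d x)) tl2 ++ ins2 (cb f) tr2) ++
     (flatten [seq [seq (x.1, p.2, x.2) | x <- cb p.1 g] ++
                   [seq (x.1, d p.2, x.2) | x <- pr p.1 g] | p <- tl3] ++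
      flatten [seq [seq (- x.1, p.2, x.2) | x <- pr (d p.1) g] | p <- tr3]))
    + lam3 (qt3 c1) +
    mu3 (qt3 (ins1 (fun x => pr e (d x)) s1) -
      qt3 (ins2 (pr f) tr2 ++ ins3 (pr^~ g) tl3)).
Proof.
move=> Ee Ef Eg /qt_eq q1 h1 /qt_eq q2 h2 /qt_eq q3 h3 /qt_eq p1 hl1 hr1.
move=> /qt_eq p2 hl2 hr2 /qt_eq p3 hl3 hr3.
have Be1 x : E x -> B e x = qt (cb e x) + lam (qt (pr e x)) by exact: BEE.
have Be0 x : A x -> B e x = qt (pr e (d x)) by exact: BEA.
have Bf1 x : E x -> B f x = qt (cb f x) + lam (qt (pr f x)) by exact: BEE.
have Bf0 x : A x -> B f x = qt (pr f (d x)) by exact: BEA.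
have Bg1 x : E x -> B' g x = qt (cb x g) + lam (qt (pr x g)) by move=> ?; rewrite BB' BEE.
have Bg0 x : A x -> B' g x = - qt (pr (d x) g) by move=> ?; rewrite BB' BAE.
have L : Lop (B e) (B f g) =
    qt3 (ins1 (cb e) tl1) + lam3 (qt3 (ins1 (pr e) tl1)) +
    qt3 (ins1 (fun x => pr e (d x)) tr1) + mu3 (qt3 (ins1 (fun x => pr e (d x)) s1)).
  rewrite BEE // p1 q1 qt_cat !linearD Lop_lam.
  by rewrite (Lop_hom1 hl1 Be1) (Lop_hom0 hr1 Be0) (Lop_hom0 h1 Be0).
have R : Rop (B f) (B e g) = qt3 (ins2 (fun x => pr f (d x)) tl2) +
    (qt3 (ins2 (cb f) tr2) + mu3 (qt3 (ins2 (pr f) tr2))) +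
    lam3 (qt3 (ins2 (fun x => pr f (d x)) s2)).
  rewrite BEE // p2 q2 qt_cat !linearD Rop_lam.
  by rewrite (Rop_hom1 hr2 Bf1) (Rop_hom0 hl2 Bf0) (Rop_hom0 h2 Bf0).
have := Kop_hom1 d hl3 Bg1; have := Kop_hom0N d hr3 Bg0; have := Kop_hom0N d h3 Bg0.
set k0 := flatten _ => K0; set k1 := flatten _ => K1; set k2 := flatten _ => K2.
have K : Kop d (B' g) (B e f) = qt3 k2 + lam3 (qt3 (ins3 (pr^~ g) tl3)) +
    mu3 (qt3 (ins3 (pr^~ g) tl3)) + qt3 k1 + lam3 (qt3 k0).
  by rewrite BEE // p3 q3 qt_cat !linearD Kop_lam K0 K1 K2.
(* Of the coefficient of lambda only its being a constant tensor matters: it will be eliminated by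
   rotation, not by an axiom of its own. *)
have [u hu] := qt3B (ins1 (pr e) tl1)
  (ins2 (fun x => pr f (d x)) s2 ++ (ins3 (pr^~ g) tl3 ++ k0)).
exists u; rewrite -hu /jacobiator L R K !qt3_cat (linearB lam3) (linearB mu3).
rewrite !(linearD lam3) !(linearD mu3); exact: sub_regroup.
Qed.

(** The result is shaped as the difference of the two sides of [CD7] at (e, f, d a): the
    differentiated list will serve as the A (x) E part of [[e, d a]], which [CD1] and [CD2] identify
    with d<<e, d a>>. *)
Lemma jacobiator_EEA e f a s s' s3 tl3 tr3 : E e -> E f -> A a ->
  t2eq (pr f (d a)) s -> hom2 A A s -> t2eq (pr e (d a)) s' -> hom2 A A s' ->
  t2eq (pr e f) s3 -> hom2 A A s3 ->
  t2eq (cb e f) (tl3 ++ tr3) -> hom2 E A tl3 -> hom2 A E tr3 ->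
  J e f a = qt3 (ins1 (fun x => pr e (d x)) s) -
    qt3 (ins2 (pr f) [seq (p.1, d p.2) | p <- s'] ++ ins3 (pr^~ (d a)) tl3).
Proof.
move=> Ee Ef Aa /qt_eq q h /qt_eq q' h' /qt_eq q3 h3 /qt_eq p3 hl3 hr3.
have Be0 x : A x -> B e x = qt (pr e (d x)) by exact: BEA.
have Bf0 x : A x -> B f x = qt (pr f (d x)) by exact: BEA.
have Ba1 x : E x -> B' a x = qt (pr x (d a)) by move=> ?; rewrite BB' BEA.
have Ba0 x : A x -> B' a x = qt [::] by move=> ?; rewrite BB' BAA // qt_nil.
rewrite /jacobiator (BEA Ef Aa) (BEA Ee Aa) (BEE Ee Ef) q q' p3 q3 qt_cat !(linearD (Kop d _)) Kop_lam.
rewrite (Lop_hom0 h Be0) (Rop_hom0 h' Bf0) (Kop_hom0 d hl3 Ba1).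
rewrite (Kop_hom0 d hr3 Ba0) (Kop_hom0 d h3 Ba0).
have nil3 t : qt3 (ins3 (fun=> [::]) t) = 0 :> M3 V.
  by rewrite /qt3 big_flatten_map big1 // => p _; rewrite big_nil.
rewrite !nil3 linear0 !addr0 qt3_cat opprD addrA; congr (_ + _ + _); congr (- _).
by rewrite !qt3_ins2 big_map.
Qed.

Lemma jacobiator_AA a b x s s' : A a -> A b -> B b x = qt s -> B a x = qt s' ->
  hom2 A A s -> hom2 A A s' -> J a b x = 0.
Proof.
move=> Aa Ab hs hs' h h'; rewrite /jacobiator hs hs' BAA // linear0 subr0.
have Z c : A c -> forall x, A x -> B c x = qt [::].
  by move=> Ac y Ay; rewrite BAA // qt_nil.
rewrite (Lop_hom0 h (Z a Aa)) (Rop_hom0 h' (Z b Ab)) !qt3_ins1 !qt3_ins2.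
by rewrite !big1 ?subr0 // => p _; rewrite qt_nil linear0.
Qed.
End JacobiatorOnGenerators.

(** * From double Poisson vertex algebras to double Courant-Dorfman algebras *)

Section Coefficients.
Variables (k : fieldType) (V : algType k).
Local Notation M := (M2 V).
Implicit Types (m : M) (a : V).

Lemma M2_cf_eq m m' : (forall n, cf2 n m = cf2 n m') -> m = m'.
Proof.
have [P ->] := q2_surj m; have [Q ->] := q2_surj m' => h.
by apply/q2_eq => n; apply/qt_eq; rewrite !qt_coef2.
Qed.
Lemma q2_lam0N (t : T2 V) : q2 [seq (0%N, (- p.1, p.2)) | p <- t] = - qt t.
Proof. by rewrite -qt_opp -q2_lam0 -map_comp. Qed.
Lemma cf2_oml n a m : cf2 n (oml a m) = oml a (cf2 n m).
Proof.
move: m; apply: (@M2_eq _ _ _ (cf2 n \o oml a) (oml a \o cf2 n)) => i x y /=.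
by rewrite oml_mon !cf2E; case: eqP; rewrite ?oml_tens ?linear0.
Qed.
Lemma cf2_omr n a m : cf2 n (omr a m) = omr a (cf2 n m).
Proof.
move: m; apply: (@M2_eq _ _ _ (cf2 n \o omr a) (omr a \o cf2 n)) => i x y /=.
by rewrite omr_mon !cf2E; case: eqP; rewrite ?omr_tens ?linear0.
Qed.
End Coefficients.

Section FromPVA.
Variables (k : fieldType) (V : algType k) (Vg : nat -> V -> Prop) (d : {linear V -> V}).
Hypothesis gV : graded_diff_alg Vg d.
Variable br : V -> V -> P2 V.
Hypothesis hbr : graded_double_PVA Vg d br.
Local Notation A := (Vg 0%N).
Local Notation E := (Vg 1%N).
Let b x y : M2 V := q2 (br x y).
Let pr x y : T2 V := coef2 (br x y) 1.
Let cb x y : T2 V := coef2 (br x y) 0.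
Let dMul : forall x y, d (x * y) = d x * y + x * d y. Proof. exact: dM gV. Qed.

Let bl : (forall x, linear (b x)) /\ (forall y, linear (b^~ y)).
Proof. by case: hbr => -[[/br_bilinP ? _ _ _ _] _ _] _. Qed.
Let bSin x y : b (d x) y = Sin _ (b x y).
Proof. by case: hbr => -[[_ /sesq_lP h _ _ _] _ _] _; exact: h. Qed.
Let bSout x y : b x (d y) = Sout d (b x y).
Proof. by case: hbr => -[[_ _ /sesq_rP h _ _] _ _] _; exact: h. Qed.
Let bMul x y z : b x (y * z) = oml y (b x z) + omr z (b x y).
Proof. by case: hbr => -[[_ _ _ /leibniz_lP h _] _ _] _; exact: h. Qed.
Let bskew x y : b x y = - tau d (b y x).
Proof. by case: hbr => -[_ /skewsymP h _] _; exact: h. Qed.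
Let B x : {linear V -> M2 V} := mklin (bl.1 x).
Let B' y : {linear V -> M2 V} := mklin (bl.2 y).
Let Jac x y z : jacobiator d B B' x y z = 0.
Proof. by case: hbr => -[_ _ h] _; apply: ((@jacobiP _ _ d br B B' _ _).1 h). Qed.

Let qpr x y : qt (pr x y) = cf2 1 (b x y). Proof. exact: qt_coef2. Qed.
Let qcb x y : qt (cb x y) = cf2 0 (b x y). Proof. exact: qt_coef2. Qed.

Lemma inVV_neg (n : int) t : inVV Vg n t -> n < 0 -> qt t = 0.
Proof.
move=> [t' [/qt_eq -> ht']] n0; case: t' ht' => [|p t'] ht'; first exact: qt_nil.
by have [r [s [rs _]]] := ht' p (mem_head _ _); move: n0; rewrite -rs.
Qed.
Lemma inVV_0 t : inVV Vg 0 t -> exists t', t2eq t t' /\ hom2 A A t'.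
Proof.
move=> [t' [tt' ht']]; exists t'; split=> // p /ht' [r [s [rs [hr hs]]]].
by move: r s rs hr hs => [|r] [|s].
Qed.
Lemma inVV_1 t : inVV Vg 1 t -> in_EA_AE Vg t.
Proof.
move=> [t' [/qt_eq tt' ht']].
pose isEA (p : V * V) := `[< E p.1 /\ A p.2 >].
exists [seq p <- t' | isEA p], [seq p <- t' | ~~ isEA p]; split.
  apply/qt_eq; rewrite tt' qt_cat /qt !big_filter.
  by rewrite (bigID isEA).
split=> p; rewrite mem_filter => /andP[/asboolP hp pt'] //.
have [[|[|r]] [[|[|s]] [rs [hr hs]]]] := ht' p pt' => //.
by case: hp; split.
Qed.

Let deg_neg i j q x y : Vg i x -> Vg j y -> (i + j < q.+1)%N -> cf2 q (b x y) = 0.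
Proof.
move=> hx hy ijq; rewrite -qt_coef2; case: hbr => _ /(_ i j q _ _ hx hy) /inVV_neg; apply.
by rewrite -addrA -opprD -!PoszD Num.Theory.subr_lt0 addn1.
Qed.

Let bEE e f : E e -> E f -> b e f = qt (cb e f) + lam (qt (pr e f)).
Proof.
move=> Ee Ef; apply: M2_cf_eq => n; rewrite linearD.
case: n => [|[|n]].
- by rewrite cf20_lam qcb -qcb cf2_qt addr0.
- by rewrite cf2_lam !cf2_qt add0r qpr.
- by rewrite cf2_lam !cf2_qt addr0; apply: deg_neg Ee Ef _.
Qed.
Let bqt i j x y : Vg i x -> Vg j y -> (i + j <= 1)%N -> b x y = qt (cb x y).
Proof.
move=> hx hy ij; apply: M2_cf_eq => -[|n]; rewrite cf2_qt /=; first by rewrite qcb.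
by apply: deg_neg hx hy _; rewrite ltnS (leq_trans ij).
Qed.
(** Compares the coefficients of lambda in {e, d a} = (lambda + d){e, a}, where {e, a} is constant
    in lambda for reasons of degree. *)
Let bEA e a : E e -> A a -> b e a = qt (pr e (d a)).
Proof.
move=> Ee Aa; rewrite qpr bSout SoutE linearD cf2_lam.
by rewrite (bqt Ee Aa) // -qt_Dop !cf2_qt addr0.
Qed.
Let bAE a e : A a -> E e -> b a e = - qt (pr (d a) e).
Proof.
move=> Aa Ee; rewrite qpr bSin SinE linearN cf2_lam opprK.
by rewrite (bqt Aa Ee) // cf2_qt.
Qed.
Let bAA a a' : A a -> A a' -> b a a' = 0.
Proof.
move=> Aa Aa'; apply: M2_cf_eq => n; rewrite linear0.
exact: deg_neg Aa Aa' _.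
Qed.

Let pr_hom e f : E e -> E f -> exists t, t2eq (pr e f) t /\ hom2 A A t.
Proof. by move=> Ee Ef; apply: inVV_0; case: hbr => _ /(_ 1 1 1 _ _ Ee Ef)%N. Qed.
Let cb_hom e f : E e -> E f -> in_EA_AE Vg (cb e f).
Proof. by move=> Ee Ef; apply: inVV_1; case: hbr => _ /(_ 1 1 0 _ _ Ee Ef)%N. Qed.

Let tauEE e f : E e -> E f -> tau d (b f e) =
  qt (sig2 (cb f e)) - (lam (qt (sig2 (pr f e))) + qt (D2 d (sig2 (pr f e)))).
Proof.
by move=> Ee Ef; rewrite bEE // linearD tau_lam SoutE !(qt_tau d) qt_Dop // (qt_tau d).
Qed.
Let pr_sym e f : E e -> E f -> qt (pr e f) = tau d (qt (pr f e)).
Proof.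
move=> Ee Ef; rewrite qpr bskew tauEE // (linearN (cf2 1)) (linearB (cf2 1)) (linearD (cf2 1)) cf2_lam !cf2_qt /=.
by rewrite addr0 sub0r opprK (qt_tau d).
Qed.

Lemma CD_of_PVA : exists pr cb : V -> V -> T2 V, double_CD Vg d pr cb /\ corresponds Vg d pr cb br.
Proof.
exists pr, cb; split; last first.
  move=> e f a a' Ee Ef Aa Aa'; split; apply/q2_eq.
  - by rewrite q2_cat q2_lam0 q2_lam1 -bEE.
  - by rewrite q2_lam0 -bEA.
  - by rewrite q2_lam0N -bAE.
  - by rewrite q2_nil -(bAA Aa Aa').
have AM x y : A x -> A y -> A (x * y) by exact: (@VgM _ _ _ _ gV 0 0).
have EA x y : E x -> A y -> E (x * y) by exact: (@VgM _ _ _ _ gV 1 0).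
have AE x y : A x -> E y -> E (x * y) by exact: (@VgM _ _ _ _ gV 0 1).
have Ed a : A a -> E (d a) by exact: (Vgd gV).
(* The Leibniz terms with {e, a} and {e, a'} are constant in lambda, hence invisible in the pairing,
   its coefficient of lambda. *)
have prM a e f a' : A a -> E e -> E f -> A a' ->
    qt (pr e (a * f * a')) = oml a (omr a' (qt (pr e f))).
  move=> Aa Ee Ef Aa'; rewrite !qpr !bMul !linearD !cf2_omr !cf2_oml.
  by rewrite (bEA Ee Aa) (bEA Ee Aa') !cf2_qt !linear0 add0r !addr0 oml_omr.
split; first split.
- exact: pr_hom.
- move=> c e e' f Ee Ee' Ef.
  by split; apply/qt_eq; rewrite qt_cat qt_sc2 !qpr ?(bl.2 f) ?bl.1 linearP.
- by move=> a e f a' Aa Ee Ef Aa'; apply/qt_eq; rewrite qt_outer prM.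
(* Symmetry transports the outer bimodule rule in the second argument to the inner rule in the
   first. *)
- move=> a e f a' Aa Ee Ef Aa'; apply/qt_eq; rewrite (qt_inner d) pr_sym ?prM //; last first.
    by apply: EA => //; apply: AE.
  by rewrite tau_oml // tau_omr // -pr_sym // iml_imr.
- by move=> e f Ee Ef; apply/qt_eq; rewrite (qt_tau d) -pr_sym.
- split; first exact: cb_hom.
  move=> c e e' f Ee Ee' Ef.
  by split; apply/qt_eq; rewrite qt_cat qt_sc2 !qcb ?(bl.2 f) ?bl.1 linearP.
(* [CD1] is the constant coefficient of skewsymmetry; the coefficient of lambda gave [pr_sym]. *)
- move=> e f Ee Ef; apply/qt_eq; rewrite qt_Dop // pr_sym // qt_cat qcb bskew tauEE //.
  rewrite (linearN (cf2 0)) (linearB (cf2 0)) (linearD (cf2 0)) cf20_lam !cf2_qt /= add0r opprB qt_Dop // (qt_tau d).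
  by rewrite addrNK.
- by move=> a e Aa Ee; apply/qt_eq; rewrite qcb bSin SinE linearN cf20_lam oppr0 qt_nil.
- split.
  + move=> a a' Aa Aa'; apply/qt_eq; rewrite qpr bSin SinE linearN cf2_lam bSout bAA //.
    by rewrite !linear0 qt_nil.
  + move=> a e f Aa Ee Ef; apply/qt_eq; rewrite qt_cat qt_omr qt_oml !qcb bMul linearD.
    by rewrite cf2_oml cf2_omr (bEA Ee Aa) cf2_qt addrC.
  + move=> a e f Aa Ee Ef; apply/qt_eq; rewrite qt_cat qt_omr qt_oml !qcb bMul linearD.
    by rewrite cf2_oml cf2_omr (bEA Ee Aa) cf2_qt.
  + move=> e f g tl1 tr1 tl2 tr2 tl3 tr3 Ee Ef Eg p1 hl1 hr1 p2 hl2 hr2 p3 hl3 hr3.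
    have [s1 [q1 h1]] := pr_hom Ef Eg; have [s2 [q2 h2]] := pr_hom Ee Eg.
    have [s3 [q3 h3]] := pr_hom Ee Ef.
    have [|c1] := jacobiator_EEE (B := B) (B' := B') _ bEE bEA bAE Ee Ef Eg q1 h1 q2 h2 q3 h3
      p1 hl1 hr1 p2 hl2 hr2 p3 hl3 hr3; first by [].
    by rewrite Jac => /esym/qt3_indepB[h _ _]; apply/qt3_eq.
  + move=> e f g s1 tl2 tr2 tl3 tr3 Ee Ef Eg q1 h1 p2 hl2 hr2 p3 hl3 hr3.
    have [s2 [q2 h2]] := pr_hom Ee Eg; have [s3 [q3 h3]] := pr_hom Ee Ef.
    have [tl1 [tr1 [p1 [hl1 hr1]]]] := cb_hom Ef Eg.
    have [|c1] := jacobiator_EEE (B := B) (B' := B') _ bEE bEA bAE Ee Ef Eg q1 h1 q2 h2 q3 h3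
      p1 hl1 hr1 p2 hl2 hr2 p3 hl3 hr3; first by [].
    by rewrite Jac => /esym/qt3_indepB[_ _ h]; apply/qt3_eq.
Qed.
End FromPVA.

(** * From double Courant-Dorfman algebras to double Poisson vertex algebras *)

Section HomogeneousSpan.
Variables (k : fieldType) (V : algType k) (d : {linear V -> V}) (G0 G1 : V -> Prop).
Hypothesis G_ind : forall P : V -> Prop,
  (forall c x y, P x -> P y -> P (c *: x + y)) -> (forall x y, P x -> P y -> P (x * y)) ->
  (forall x, P x -> P (d x)) -> (forall a, G0 a -> P a) -> (forall e, G1 e -> P e) ->
  forall x, P x.
Variable P : nat -> V -> Prop.
Hypotheses (PZ : forall n c x, P n x -> P n (c *: x))
  (PM : forall i j x y, P i x -> P j y -> P (i + j)%N (x * y))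
  (Pd : forall i x, P i x -> P i.+1 (d x))
  (P0 : forall a, G0 a -> P 0%N a) (P1 : forall e, G1 e -> P 1%N e).

(** The induction principle is a hypothesis because the lemma serves twice: for a freely generated
    V, and for the algebra of terms, whose grading is only established with its help. *)
Lemma homogeneous_span x : exists s : seq (nat * V),
  (forall t, t \in s -> P t.1 t.2) /\ x = \sum_(t <- s) t.2.
Proof.
move: x; apply: G_ind.
- move=> c _ _ [s [hs ->]] [t [ht ->]].
  exists ([seq (p.1, c *: p.2) | p <- s] ++ t); split; last first.
    by rewrite big_cat big_map scaler_sumr.
  by move=> p; rewrite mem_cat => /orP[/mapP[q /hs Pq ->]|/ht] //=; exact: PZ.
- move=> _ _ [s [hs ->]] [t [ht ->]].
  exists [seq ((p.1 + q.1)%N, p.2 * q.2) | p <- s, q <- t]; split; last first.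
    by rewrite big_allpairs_dep mulr_suml; apply: eq_bigr => p _; rewrite mulr_sumr.
  by move=> p /allpairsP[[u v] /= [/hs Pu /ht Pv ->]]; exact: PM.
- move=> _ [s [hs ->]].
  exists [seq (p.1.+1, d p.2) | p <- s]; split; last by rewrite big_map linear_sum.
  by move=> p /mapP[q /hs Pq ->]; exact: Pd.
- move=> a Aa; exists [:: (0%N, a)]; rewrite big_seq1; split=> // t.
  by rewrite inE => /eqP ->; exact: P0.
- move=> a Aa; exists [:: (1%N, a)]; rewrite big_seq1; split=> // t.
  by rewrite inE => /eqP ->; exact: P1.
Qed.
End HomogeneousSpan.

Section GradedInduction.
Variables (k : fieldType) (V : algType k) (Vg : nat -> V -> Prop) (d : {linear V -> V}).
Hypotheses (gV : graded_diff_alg Vg d) (fV : freely_generated Vg d).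

(** Induction on V only writes x as a sum of homogeneous elements with the property, of any degrees.
    Independence of the degrees shows that the summands of degree n already add up to x. *)
Lemma graded_ind (P : nat -> V -> Prop) :
  (forall n, P n 0) ->
  (forall n c x y, P n x -> P n y -> P n (c *: x + y)) ->
  (forall i j x y, Vg i x -> P i x -> Vg j y -> P j y -> P (i + j)%N (x * y)) ->
  (forall i x, Vg i x -> P i x -> P i.+1 (d x)) ->
  (forall a, Vg 0%N a -> P 0%N a) -> (forall e, Vg 1%N e -> P 1%N e) ->
  forall n x, Vg n x -> P n x.
Proof.
move=> P0 Plin Pmul Pd PA PE.
move=> n x Vx.
have [|||||s [hs xE]] := homogeneous_span (free_ind gV fV)
  (P := fun n x => Vg n x /\ P n x) _ _ _ _ _ x.
- move=> i c y [Vy Py]; split; first exact: (VgZ gV).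
  by rewrite -[_ *: _]addr0; apply: Plin.
- by move=> i j y z [Vy Py] [Vz Pz]; split; [exact: (VgM gV)|exact: Pmul].
- by move=> i y [Vy Py]; split; [exact: (Vgd gV)|exact: Pd].
- by move=> a Aa; split=> //; exact: PA.
- by move=> e Ee; split=> //; exact: PE.
pose N := (maxn n (\max_(t <- s) t.1)).+1.
have nN : (n < N)%N by rewrite ltnS leq_maxl.
have sN t : t \in s -> (t.1 < N)%N.
  by move=> ts; rewrite ltnS leq_max (leq_bigmax_seq _ ts) ?orbT.
pose e i := \sum_(t <- s | t.1 == i) t.2 - (if i == n then x else 0).
have Vsum i : Vg i (\sum_(t <- s | t.1 == i) t.2).
  rewrite big_seq_cond; apply: big_ind => [|u v|t /andP[/hs[Vt _] /eqP <-]] //.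
  - exact: (Vg0 gV).
  - exact: (VgD gV).
have Ve i : Vg i (e i).
  by apply: (VgD gV) => //; apply: (VgN gV); case: eqP => [->|_] //; exact: (Vg0 gV).
have e0 : \sum_(i < N) e i = 0.
  rewrite sumrB -big_mkcond (big_pred1 (Ordinal nN)) => [|i]; last by rewrite /= -val_eqE.
  apply/eqP; rewrite subr_eq0; apply/eqP; rewrite xE.
  under eq_bigr do rewrite big_mkcond.
  rewrite exchange_big; apply: eq_big_seq => t ts /=.
  by rewrite -big_mkcond (big_pred1 (Ordinal (sN t ts))).
have := Vg_indep gV Ve e0 nN; rewrite /e eqxx => /eqP; rewrite subr_eq0 => /eqP <-.
rewrite big_seq_cond; apply: big_ind => [|u v Pu Pv|t /andP[/hs[_ Pt] /eqP <-]] //.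
by rewrite -[u]scale1r; apply: Plin.
Qed.
End GradedInduction.

(** * Degrees in (V (x) V)[lambda] *)

Section TensorDegree.
Variables (k : fieldType) (V : algType k) (Vg : nat -> V -> Prop) (d : {linear V -> V}).
Hypothesis gV : graded_diff_alg Vg d.
Local Notation M := (M2 V).

(* lambda has degree 1 and the tensor product is shifted by 1. *)
Inductive degM : nat -> M -> Prop :=
| degM_0 n : degM n 0
| degM_D n m m' : degM n m -> degM n m' -> degM n (m + m')
| degM_lam n m : degM n m -> degM n.+1 (lam m)
| degM_tens r s x y : Vg r x -> Vg s y -> degM (r + s).+1 (tens2 x y).

Lemma degM_Z n c m : degM n m -> degM n (c *: m).
Proof.
elim=> [{}n|{}n m1 m2 _ h1 _ h2|{}n m1 _ h|r s x y Vx Vy].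
- by rewrite scaler0; exact: degM_0.
- by rewrite scalerDr; exact: degM_D.
- by rewrite -linearZZ; exact: degM_lam.
- by rewrite -[_ *: _]mon2Zl; apply: degM_tens => //; exact: (VgZ gV).
Qed.
Lemma degM_N n m : degM n m -> degM n (- m).
Proof. by rewrite -scaleN1r; exact: degM_Z. Qed.
Lemma degM_oml i a n m : Vg i a -> degM n m -> degM (i + n) (oml a m).
Proof.
move=> Va; elim=> [{}n|{}n m1 m2 _ h1 _ h2|{}n m1 _ h|r s x y Vx Vy].
- by rewrite linear0; exact: degM_0.
- by rewrite linearD; exact: degM_D.
- by rewrite oml_lam addnS; exact: degM_lam.
- by rewrite oml_tens addnS addnA; apply: degM_tens => //; exact: (VgM gV).
Qed.
Lemma degM_omr i a n m : Vg i a -> degM n m -> degM (n + i) (omr a m).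
Proof.
move=> Va; elim=> [{}n|{}n m1 m2 _ h1 _ h2|{}n m1 _ h|r s x y Vx Vy].
- by rewrite linear0; exact: degM_0.
- by rewrite linearD; exact: degM_D.
- by rewrite omr_lam addSn; exact: degM_lam.
- by rewrite omr_tens addSn -addnA; apply: degM_tens => //; exact: (VgM gV).
Qed.
Lemma degM_Dop n m : degM n m -> degM n.+1 (Dop d m).
Proof.
elim=> [{}n|{}n m1 m2 _ h1 _ h2|{}n m1 _ h|r s x y Vx Vy].
- by rewrite linear0; exact: degM_0.
- by rewrite linearD; exact: degM_D.
- by rewrite Dop_lam; exact: degM_lam.
- rewrite Dop_tens; apply: degM_D; first by rewrite -addSn; apply: degM_tens => //; exact: (Vgd gV).
  by rewrite -addnS; apply: degM_tens => //; exact: (Vgd gV).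
Qed.
Lemma degM_Sout n m : degM n m -> degM n.+1 (Sout d m).
Proof. by move=> h; rewrite SoutE; apply: degM_D; [exact: degM_lam|exact: degM_Dop]. Qed.
Lemma degM_Sin n m : degM n m -> degM n.+1 (Sin _ m).
Proof. by move=> h; rewrite SinE; apply: degM_N; exact: degM_lam. Qed.
Lemma degM_iml i a n m : Vg i a -> degM n m -> degM (i + n) (iml d a m).
Proof.
move=> + h; elim: h i a => [{}n|{}n m1 m2 _ h1 _ h2|{}n m1 _ h|r s x y Vx Vy] i a Va.
- by rewrite linear0; exact: degM_0.
- by rewrite linearD; apply: degM_D; [exact: h1|exact: h2].
- rewrite iml_lam addnS; apply: degM_D; first by apply: degM_lam; exact: h.
  by rewrite -addSn; apply: h; exact: (Vgd gV).
- by rewrite iml_tens addnS addnCA; apply: degM_tens => //; exact: (VgM gV).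
Qed.
Lemma degM_imr i a n m : Vg i a -> degM n m -> degM (n + i) (imr d a m).
Proof.
move=> + h; elim: h i a => [{}n|{}n m1 m2 _ h1 _ h2|{}n m1 _ h|r s x y Vx Vy] i a Va.
- by rewrite linear0; exact: degM_0.
- by rewrite linearD; apply: degM_D; [exact: h1|exact: h2].
- rewrite imr_lam addSn; apply: degM_D; first by apply: degM_lam; exact: h.
  by rewrite -addnS; apply: h; exact: (Vgd gV).
- by rewrite imr_tens addSn addnAC; apply: degM_tens => //; exact: (VgM gV).
Qed.
Lemma degM_qt r s (P Q : V -> Prop) (t : T2 V) :
  (forall x, P x -> Vg r x) -> (forall x, Q x -> Vg s x) -> hom2 P Q t ->
  degM (r + s).+1 (qt t).
Proof.
move=> hP hQ ht; rewrite /qt big_seq; apply: big_ind => [||p /ht [Pp Qp]].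
- exact: degM_0.
- by move=> *; apply: degM_D.
- by apply: degM_tens; auto.
Qed.

(** The degree n - q - 1 is taken in the integers: a negative value leaves no admissible entries, so
    t is then empty. *)
Lemma degM_coef n m : degM n m -> forall q, exists t, qt t = cf2 q m /\
  forall p, p \in t -> exists r s : nat,
    (r + s)%N%:Z = n%:Z - q%:Z - 1 /\ Vg r p.1 /\ Vg s p.2.
Proof.
elim=> [{}n|{}n m1 m2 _ h1 _ h2|{}n m1 _ h|r s x y Vx Vy] q.
- by exists [::]; rewrite qt_nil linear0.
- have [t1 [e1 d1]] := h1 q; have [t2 [e2 d2]] := h2 q.
  exists (t1 ++ t2); rewrite qt_cat e1 e2 linearD; split=> // p.
  by rewrite mem_cat => /orP[/d1|/d2].
- case: q => [|q]; first by exists [::]; rewrite qt_nil cf20_lam.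
  have [t [e dt]] := h q; exists t; rewrite e cf2_lam; split=> // p /dt [r [s [rs Vrs]]].
  by exists r, s; split=> //; rewrite rs -addn1 -[q.+1]addn1 !PoszD opprD addrACA subrr addr0.
- exists (if q is 0 then [:: (x, y)] else [::]); rewrite [RHS]cf2E.
  case: q => [|q]; last by rewrite qt_nil.
  split; first by rewrite /qt big_seq1.
  move=> p; rewrite inE => /eqP ->; exists r, s; split=> //.
  by rewrite subr0 -addn1 [in RHS]PoszD addrK.
Qed.

Lemma degM_inVV n P : degM n (q2 P) -> forall q, inVV Vg (n%:Z - q%:Z - 1) (coef2 P q).
Proof.
move=> h q; have [t [e dt]] := degM_coef h q; exists t; split=> //.
by apply/qt_eq; rewrite e qt_coef2.
Qed.
End TensorDegree.

(** * Outer and inner derivations into (V (x) V)[lambda] *)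

Section BracketBimodules.
Variables (k : fieldType) (V : algType k) (Vg : nat -> V -> Prop) (d : {linear V -> V}).
Hypotheses (gV : graded_diff_alg Vg d) (fV : freely_generated Vg d).
Let dMul : forall x y, d (x * y) = d x * y + x * d y. Proof. exact: dM gV. Qed.
Local Notation M := (M2 V).
Local Notation oml := (@oml k V).
Local Notation omr := (@omr k V).
Local Notation iml := (iml d).
Local Notation imr := (imr d).
Local Notation Sin := (@Sin k V).
Local Notation Sout := (Sout d).
Local Notation tau := (tau d).

Lemma bim_out : bimodule (fun a (m : M) => oml a m) (fun a m => omr a m).
Proof.
split=> [e|a|e|a|a b e|a b e|a b e|e|e].
- exact: oml_linear.
- exact: linearP.
- exact: omr_linear.
- exact: linearP.
- exact: omlM.
- exact: omrM.
- exact: oml_omr.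
- exact: oml1.
- exact: omr1.
Qed.
Lemma bim_in : bimodule (fun a (m : M) => iml a m) (fun a m => imr a m).
Proof.
split=> [e|a|e|a|a b e|a b e|a b e|e|e].
- exact: iml_linear.
- exact: linearP.
- exact: imr_linear.
- exact: linearP.
- exact: imlM.
- exact: imrM.
- exact: iml_imr.
- exact: iml1.
- exact: imr1.
Qed.

Definition oder (h : V -> M) := is_der d (fun a m => oml a m) (fun a m => omr a m) Sout h.
Definition ider (h : V -> M) := is_der d (fun a m => iml a m) (fun a m => imr a m) Sin h.

Lemma oder_linear h : oder h -> linear h. Proof. exact: der_lin. Qed.
Lemma oder_mul h : oder h -> forall x y, h (x * y) = oml x (h y) + omr y (h x).
Proof. exact: der_mul. Qed.

Lemma oder_eq h h' : oder h -> oder h' -> (forall a, Vg 0%N a -> h a = h' a) ->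
  (forall e, Vg 1%N e -> h e = h' e) -> forall x, h x = h' x.
Proof. exact: (der_eq gV fV bim_out). Qed.
Lemma ider_eq h h' : ider h -> ider h' -> (forall a, Vg 0%N a -> h a = h' a) ->
  (forall e, Vg 1%N e -> h e = h' e) -> forall x, h x = h' x.
Proof. exact: (der_eq gV fV bim_in). Qed.

Lemma oderP c h h' : oder h -> oder h' -> oder (fun x => c *: h x + h' x).
Proof.
move=> [hl hm hd] [hl' hm' hd']; split.
- move=> e x y; rewrite hl hl' !scalerDr !scalerA [c * e]mulrC -!scalerA addrACA.
  by rewrite -scalerDr.
- by move=> x y; rewrite hm hm' !linearP scalerDr addrACA.
- by move=> x; rewrite hd hd' linearP.
Qed.
Lemma iderP c h h' : ider h -> ider h' -> ider (fun x => c *: h x + h' x).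
Proof.
move=> [hl hm hd] [hl' hm' hd']; split.
- move=> e x y; rewrite hl hl' !scalerDr !scalerA [c * e]mulrC -!scalerA addrACA.
  by rewrite -scalerDr.
- by move=> x y; rewrite hm hm' !linearP scalerDr addrACA.
- by move=> x; rewrite hd hd' linearP.
Qed.
Lemma oderD h h' : oder h -> oder h' -> oder (fun x => h x + h' x).
Proof.
move=> dh dh'; have := oderP 1 dh dh'.
by congr is_der; apply/funext => x; rewrite scale1r.
Qed.
Lemma iderD h h' : ider h -> ider h' -> ider (fun x => h x + h' x).
Proof.
move=> dh dh'; have := iderP 1 dh dh'.
by congr is_der; apply/funext => x; rewrite scale1r.
Qed.

(* The inner structure maps are endomorphisms of the outer differential
   bimodule, and conversely. *)
Lemma oder_comp (F : {linear M -> M}) h : (forall a m, F (oml a m) = oml a (F m)) ->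
  (forall a m, F (omr a m) = omr a (F m)) -> (forall m, F (Sout m) = Sout (F m)) ->
  oder h -> oder (fun x => F (h x)).
Proof.
move=> Fl Fr FS [hl hm hd]; split.
- by move=> c x y; rewrite hl linearP.
- by move=> x y; rewrite hm linearD Fl Fr.
- by move=> x; rewrite hd FS.
Qed.
Lemma ider_comp (F : {linear M -> M}) h : (forall a m, F (iml a m) = iml a (F m)) ->
  (forall a m, F (imr a m) = imr a (F m)) -> (forall m, F (Sin m) = Sin (F m)) ->
  ider h -> ider (fun x => F (h x)).
Proof.
move=> Fl Fr FS [hl hm hd]; split.
- by move=> c x y; rewrite hl linearP.
- by move=> x y; rewrite hm linearD Fl Fr.
- by move=> x; rewrite hd FS.
Qed.

Lemma Sin_Sout m : Sin (Sout m) = Sout (Sin m).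
Proof. by rewrite !SinE linearN Sout_lam. Qed.
Lemma Sin_oml a m : Sin (oml a m) = oml a (Sin m).
Proof. by rewrite !SinE linearN oml_lam. Qed.
Lemma Sin_omr a m : Sin (omr a m) = omr a (Sin m).
Proof. by rewrite !SinE linearN omr_lam. Qed.

Lemma oder_iml a h : oder h -> oder (fun x => iml a (h x)).
Proof.
by apply: oder_comp => *; rewrite ?iml_oml ?iml_omr ?iml_Sout.
Qed.
Lemma oder_imr a h : oder h -> oder (fun x => imr a (h x)).
Proof.
by apply: oder_comp => *; rewrite ?imr_oml ?imr_omr ?imr_Sout.
Qed.
Lemma oder_Sin h : oder h -> oder (fun x => Sin (h x)).
Proof.
by apply: oder_comp => *; rewrite ?Sin_oml ?Sin_omr ?Sin_Sout.
Qed.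
Lemma ider_oml a h : ider h -> ider (fun x => oml a (h x)).
Proof.
by apply: ider_comp => *; rewrite ?iml_oml ?imr_oml ?Sin_oml.
Qed.
Lemma ider_omr a h : ider h -> ider (fun x => omr a (h x)).
Proof.
by apply: ider_comp => *; rewrite ?iml_omr ?imr_omr ?Sin_omr.
Qed.
Lemma ider_Sout h : ider h -> ider (fun x => Sout (h x)).
Proof.
by apply: ider_comp => *; rewrite ?iml_Sout ?imr_Sout ?Sin_Sout.
Qed.
(** Through this exchange skewsymmetry becomes an equality between derivations of the same kind. *)
Lemma oder_ider h : oder h -> ider (fun x => - tau (h x)).
Proof.
move=> [hl hm hd]; split.
- by move=> c x y; rewrite hl !linearP.
- by move=> x y; rewrite hm linearD tau_oml // tau_omr // opprD !linearN.
- by move=> x; rewrite hd tau_Sout // linearN.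
Qed.
Lemma ider_oder h : ider h -> oder (fun x => - tau (h x)).
Proof.
move=> [hl hm hd]; split.
- by move=> c x y; rewrite hl !linearP.
- by move=> x y; rewrite hm linearD tau_iml // tau_imr // opprD !linearN.
- by move=> x; rewrite hd tau_Sin // linearN.
Qed.
End BracketBimodules.

(** * The bracket determined by a pairing and a double Courant-Dorfman bracket *)

Section FromCD.
Variables (k : fieldType) (V : algType k) (Vg : nat -> V -> Prop) (d : {linear V -> V}).
Hypotheses (gV : graded_diff_alg Vg d) (fV : freely_generated Vg d).
Variables (pr cb : V -> V -> T2 V).
Hypothesis hCD : double_CD Vg d pr cb.
Let dMul : forall x y, d (x * y) = d x * y + x * d y. Proof. exact: dM gV. Qed.
Local Notation M := (M2 V).
Local Notation A := (Vg 0%N).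
Local Notation E := (Vg 1%N).
Local Notation oml := (@oml k V).
Local Notation omr := (@omr k V).
Local Notation Sin := (@Sin k V).
Local Notation tau := (tau d).
Let p x y : M := qt (pr x y).
Let c x y : M := qt (cb x y).

Let AM x y : A x -> A y -> A (x * y). Proof. exact: (@VgM _ _ _ _ gV 0 0). Qed.
Let EA x y : E x -> A y -> E (x * y). Proof. exact: (@VgM _ _ _ _ gV 1 0). Qed.
Let AE x y : A x -> E y -> E (x * y). Proof. exact: (@VgM _ _ _ _ gV 0 1). Qed.
Let Ed a : A a -> E (d a). Proof. exact: (Vgd gV). Qed.
Let AP e x y : A x -> A y -> A (e *: x + y). Proof. exact: (VgP gV). Qed.
Let EP e x y : E x -> E y -> E (e *: x + y). Proof. exact: (VgP gV). Qed.
Let A_1 : A 1. Proof. exact: (A1 gV). Qed.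

Let phom e f : E e -> E f -> exists t, t2eq (pr e f) t /\ hom2 A A t.
Proof. by case: hCD => [[h _ _ _ _] _ _ _ _]; apply: h. Qed.
Let plin a x y f : E x -> E y -> E f -> p (a *: x + y) f = a *: p x f + p y f.
Proof.
move=> Ex Ey Ef; case: hCD => [[_ h _ _ _] _ _ _ _].
by case: (h a x y f Ex Ey Ef) => /qt_eq + _; rewrite qt_cat qt_sc2.
Qed.
Let prin a x y f : E x -> E y -> E f -> p f (a *: x + y) = a *: p f x + p f y.
Proof.
move=> Ex Ey Ef; case: hCD => [[_ h _ _ _] _ _ _ _].
by case: (h a x y f Ex Ey Ef) => _ /qt_eq; rewrite qt_cat qt_sc2.
Qed.
Let pmul a e f b : A a -> E e -> E f -> A b -> p e (a * f * b) = oml a (omr b (p e f)).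
Proof.
move=> Aa Ee Ef Ab; case: hCD => [[_ _ h _ _] _ _ _ _].
by have /qt_eq := h a e f b Aa Ee Ef Ab; rewrite qt_outer.
Qed.
Let psym e f : E e -> E f -> p e f = tau (p f e).
Proof.
move=> Ee Ef; case: hCD => [[_ _ _ _ h] _ _ _ _].
by have /qt_eq := h e f Ee Ef; rewrite (qt_tau d).
Qed.
Let chom e f : E e -> E f -> in_EA_AE Vg (cb e f).
Proof. by case: hCD => [_ [h _] _ _ _]; apply: h. Qed.
Let clin a x y f : E x -> E y -> E f -> c (a *: x + y) f = a *: c x f + c y f.
Proof.
move=> Ex Ey Ef; case: hCD => [_ [_ h] _ _ _].
by case: (h a x y f Ex Ey Ef) => /qt_eq + _; rewrite qt_cat qt_sc2.
Qed.
Let crin a x y f : E x -> E y -> E f -> c f (a *: x + y) = a *: c f x + c f y.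
Proof.
move=> Ex Ey Ef; case: hCD => [_ [_ h] _ _ _].
by case: (h a x y f Ex Ey Ef) => _ /qt_eq; rewrite qt_cat qt_sc2.
Qed.
Let cd1 e f : E e -> E f -> Dop d (p e f) = c e f + tau (c f e).
Proof.
move=> Ee Ef; case: hCD => [_ _ h _ _].
by have /qt_eq := h e f Ee Ef; rewrite qt_Dop qt_cat (qt_tau d).
Qed.
Let cd2 a e : A a -> E e -> c (d a) e = 0.
Proof.
move=> Aa Ee; case: hCD => [_ _ _ h _].
by have /qt_eq := h a e Aa Ee; rewrite qt_nil.
Qed.
Let cd3 a b : A a -> A b -> p (d a) (d b) = 0.
Proof.
move=> Aa Ab; case: hCD => [_ _ _ _ [h _ _ _ _]].
by have /qt_eq := h a b Aa Ab; rewrite qt_nil.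
Qed.
Let cd4 a e f : A a -> E e -> E f -> c e (f * a) = omr a (c e f) + oml f (p e (d a)).
Proof.
move=> Aa Ee Ef; case: hCD => [_ _ _ _ [_ h _ _ _]].
by have /qt_eq := h a e f Aa Ee Ef; rewrite qt_cat qt_omr qt_oml.
Qed.
Let cd5 a e f : A a -> E e -> E f -> c e (a * f) = oml a (c e f) + omr f (p e (d a)).
Proof.
move=> Aa Ee Ef; case: hCD => [_ _ _ _ [_ _ h _ _]].
by have /qt_eq := h a e f Aa Ee Ef; rewrite qt_cat qt_omr qt_oml.
Qed.

Let pD e x y : E e -> E x -> E y -> p e (x + y) = p e x + p e y.
Proof. by move=> Ee Ex Ey; rewrite -[x in LHS]scale1r prin // scale1r. Qed.
Let pr_l e f a : A a -> E e -> E f -> p e (a * f) = oml a (p e f).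
Proof. by move=> Aa Ee Ef; rewrite -[a * f]mulr1 pmul // omr1. Qed.
Let pr_r e f a : A a -> E e -> E f -> p e (f * a) = omr a (p e f).
Proof. by move=> Aa Ee Ef; rewrite -[f in LHS]mul1r pmul // oml1. Qed.
Let pdM e a b : E e -> A a -> A b -> p e (d (a * b)) = oml a (p e (d b)) + omr b (p e (d a)).
Proof.
move=> Ee Aa Ab; rewrite dMul pD //; [|by apply: EA => //; exact: Ed|by apply: AE => //; exact: Ed].
by rewrite (pr_l Aa Ee (Ed Ab)) (pr_r Ab Ee (Ed Aa)) addrC.
Qed.

(** Compatibility with d is the only real condition on these values; it says <<d a, d b>> = 0, which
    is [CD3]. *)
Lemma dA_sig a : A a ->
  {h | [/\ oder d h, forall b, A b -> h b = 0 & forall e, E e -> h e = - p (d a) e]}.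
Proof.
move=> Aa; apply: (der_ext gV fV (bim_out V)).
- exact: Sout_oml.
- exact: Sout_omr.
- by move=> *; rewrite scaler0 addr0.
- by move=> *; rewrite !linear0 addr0.
- by move=> e x y Ex Ey; rewrite prin ?opprD ?scalerN //; apply: Ed.
- move=> b e b' Ab Ee Ab'; rewrite !linear0 addr0 add0r !linearN pmul ?oml_omr //.
  exact: Ed.
- by move=> b Ab; rewrite cd3 // !linear0.
Qed.
(** Compatibility with d requires [[e, d a]] + <<e, d a>> lambda = (lambda + d)<<e, d a>>, which is
    [CD1] once [[d a, e]] = 0 by [CD2]. The Leibniz rule on a f b comes from [CD4] and [CD5]. *)
Lemma dE_sig e : E e ->
  {h | [/\ oder d h, forall a, A a -> h a = p e (d a) &
           forall f, E f -> h f = c e f + lam (p e f)]}.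
Proof.
move=> Ee; apply: (der_ext gV fV (bim_out V)).
- exact: Sout_oml.
- exact: Sout_omr.
- by move=> a x y Ax Ay; rewrite linearP prin //; apply: Ed.
- by move=> a b Aa Ab; rewrite pdM.
- by move=> a x y Ax Ay; rewrite crin ?prin // linearP scalerDr addrACA.
- move=> a f b Aa Ef Ab; rewrite cd4 ?cd5 //; last exact: AE.
  rewrite pmul // !linearD oml_lam omr_lam oml_omr.
  by rewrite !addrA [RHS](ACl (2*4*1*3)).
- move=> a Aa; rewrite SoutE addrC cd1 ?cd2 ?linear0 ?addr0 //; exact: Ed.
Qed.

Definition dA a : V -> M := if pselect (A a) is left h then sval (dA_sig h) else fun=> 0.
Definition dE e : V -> M := if pselect (E e) is left h then sval (dE_sig h) else fun=> 0.

Lemma dAP a : A a ->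
  [/\ oder d (dA a), forall b, A b -> dA a b = 0 & forall e, E e -> dA a e = - p (d a) e].
Proof. by rewrite /dA; case: pselect => // h _; exact: (svalP (dA_sig h)). Qed.
Lemma dEP e : E e -> [/\ oder d (dE e), forall a, A a -> dE e a = p e (d a) &
  forall f, E f -> dE e f = c e f + lam (p e f)].
Proof. by rewrite /dE; case: pselect => // h _; exact: (svalP (dE_sig h)). Qed.

Lemma dE_skew e f : E e -> E f -> dE e f = - tau (dE f e).
Proof.
move=> Ee Ef; have [_ _ ->] := dEP Ee => //; have [_ _ ->] := dEP Ef => //.
rewrite (linearD tau) tau_lam -psym // SoutE cd1 // opprD opprK.
by rewrite [lam _ + (_ + _)]addrA [RHS]addrC addrK addrC.
Qed.
Lemma dA_skew a e : A a -> E e -> dA a e = - tau (dE e a).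
Proof.
move=> Aa Ee; have [_ _ aE] := dAP Aa; have [_ eA _] := dEP Ee.
by rewrite aE // eA // -psym //; apply: Ed.
Qed.
Lemma dE_skewA e a : E e -> A a -> dE e a = - tau (dA a e).
Proof.
by move=> Ee Aa; rewrite dA_skew // linearN opprK tauK.
Qed.

(** Each compatibility condition, with the first arguments fixed, is an equality of outer
    derivations in y, so y may be taken in A or E. For y in E, skewness on generators turns the
    product conditions into the Leibniz rule of [dE y] in its second argument. *)
Lemma br_sig y : {h | [/\ ider d h, forall a, A a -> h a = dA a y & forall e, E e -> h e = dE e y]}.
Proof.
apply: (@der_ext _ _ _ _ gV fV _ _ _ Sin (bim_in gV) _ _ (dA^~ y) (dE^~ y)).
- exact: Sin_iml.
- exact: Sin_imr.
- move=> e a b Aa Ab; move: y; have [oa aA aE] := dAP Aa; have [ob bA bE] := dAP Ab.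
  have [o oA oE] := dAP (AP e Aa Ab).
  apply: (oder_eq gV fV o (oderP e oa ob)) => [x Ax|x Ex].
    by rewrite oA // aA // bA // scaler0 addr0.
  by rewrite oE // aE // bE // linearP plin ?opprD ?scalerN //; apply: Ed.
- move=> a b Aa Ab; move: y; have [oa aA aE] := dAP Aa; have [ob bA bE] := dAP Ab.
  have [o oA oE] := dAP (AM Aa Ab).
  apply: (oder_eq gV fV o (oderD (oder_iml gV a ob) (oder_imr gV b oa))) => [x Ax|x Ex].
    by rewrite oA // aA // bA // !linear0 addr0.
  have [oe _ _] := dEP Ex.
  rewrite !dA_skew //; last exact: AM.
  by rewrite (oder_mul oe) linearD tau_oml // tau_omr // opprD !linearN.
- move=> a e f Ee Ef; move: y; have [oe eA eE] := dEP Ee; have [of_ fA fE] := dEP Ef.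
  have [o oA oE] := dEP (EP a Ee Ef).
  apply: (oder_eq gV fV o (oderP a oe of_)) => [x Ax|x Ex].
    by rewrite oA // eA // fA // plin //; apply: Ed.
  by rewrite oE // eE // fE // clin // plin // linearP scalerDr addrACA.
- move=> a e b Aa Ee Ab; move: y; have [oa aA aE] := dAP Aa; have [oe eA eE] := dEP Ee.
  have [ob bA bE] := dAP Ab; have Eaeb : E (a * e * b) by apply: EA => //; apply: AE.
  have [o oA oE] := dEP Eaeb.
  apply: (oder_eq gV fV o (oderD (oder_iml gV (a * e) ob)
    (oder_imr gV b (oderD (oder_iml gV a oe) (oder_imr gV e oa))))) => [x Ax|x Ex].
    rewrite oA // aA // bA // !linear0 add0r addr0 eA // psym //; last exact: Ed.
    by rewrite pmul ?tau_oml ?tau_omr // -?psym ?iml_imr //; apply: Ed.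
  have [ox _ _] := dEP Ex.
  rewrite dE_skew // (oder_mul ox (a * e)) (oder_mul ox a) (linearD tau) tau_oml // tau_omr //.
  rewrite (linearD tau) tau_oml // tau_omr // !dA_skew // (dE_skew Ee Ex).
  by rewrite !linearN -opprD linearN -opprD.
- move=> a Aa; move: y; have [oa aA aE] := dAP Aa; have [o oA oE] := dEP (Ed Aa).
  apply: (oder_eq gV fV o (oder_Sin oa)) => [x Ax|x Ex].
    by rewrite oA // aA // linear0 cd3.
  by rewrite oE // aE // cd2 // add0r SinE linearN opprK.
Qed.

Definition brM x y : M := sval (br_sig y) x.
Lemma brM_ider y : ider d (brM^~ y). Proof. by case: (svalP (br_sig y)). Qed.
Lemma brM_A a y : A a -> brM a y = dA a y. Proof. by case: (svalP (br_sig y)) => _ h _; apply: h. Qed.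
Lemma brM_E e y : E e -> brM e y = dE e y. Proof. by case: (svalP (br_sig y)) => _ _; apply. Qed.

(** The mirror image of the previous reduction: for fixed second arguments both sides of each rule
    are inner derivations in x, and for x in A or E they hold by construction of [dA] and [dE]. *)
Lemma brM_oder x : oder d (brM x).
Proof.
split.
- move=> a y z; move: x; apply: (ider_eq gV fV (brM_ider _) (iderP _ (brM_ider _) (brM_ider _))).
    by move=> b Ab; rewrite !brM_A //; have [/oder_linear ->] := dAP Ab.
  by move=> b Ab; rewrite !brM_E //; have [/oder_linear ->] := dEP Ab.
- move=> y z; move: x; apply: (ider_eq gV fV (brM_ider (y * z))
    (iderD (ider_oml y (brM_ider z)) (ider_omr z (brM_ider y)))).
    by move=> b Ab; rewrite !brM_A //; have [/oder_mul ->] := dAP Ab.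
  by move=> b Ab; rewrite !brM_E //; have [/oder_mul ->] := dEP Ab.
- move=> y; move: x; apply: (ider_eq gV fV (brM_ider (d y)) (ider_Sout gV (brM_ider y))).
    by move=> b Ab; rewrite !brM_A //; have [[_ _ ->]] := dAP Ab.
  by move=> b Ab; rewrite !brM_E //; have [[_ _ ->]] := dEP Ab.
Qed.

(** Reduced to generators twice: first in y as outer derivations, with x in A or E, then in x as
    inner derivations. *)
Lemma brM_skew x y : brM x y = - tau (brM y x).
Proof.
have gen g z : A g \/ E g -> brM g z = - tau (brM z g).
  move=> Gg; move: z.
  apply: (oder_eq gV fV (brM_oder g) (ider_oder gV (brM_ider g))) => z Gz; case: Gg => Gg.
  - have [_ gA _] := dAP Gg; have [_ zA _] := dAP Gz.
    by rewrite !brM_A // gA // zA // linear0 oppr0.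
  - by rewrite brM_E // brM_A // dE_skewA.
  - by rewrite brM_A // brM_E // dA_skew.
  - by rewrite !brM_E // dE_skew.
move: x; apply: (ider_eq gV fV (brM_ider y) (oder_ider gV (brM_oder y))) => x Gx.
  by apply: gen; left.
by apply: gen; right.
Qed.

Lemma brM_AA a b : A a -> A b -> brM a b = 0.
Proof. by move=> Aa Ab; have [_ h _] := dAP Aa; rewrite brM_A // h. Qed.
Lemma brM_AE a e : A a -> E e -> brM a e = - p (d a) e.
Proof. by move=> Aa Ee; have [_ _ h] := dAP Aa; rewrite brM_A // h. Qed.
Lemma brM_EA e a : E e -> A a -> brM e a = p e (d a).
Proof. by move=> Ee Aa; have [_ h _] := dEP Ee; rewrite brM_E // h. Qed.
Lemma brM_EE e f : E e -> E f -> brM e f = c e f + lam (p e f).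
Proof. by move=> Ee Ef; have [_ _ h] := dEP Ee; rewrite brM_E // h. Qed.

Definition brL x : {linear V -> M} := mklin (oder_linear (brM_oder x)).
Definition brR y : {linear V -> M} := mklin (der_lin (brM_ider y)).
Local Notation J := (jacobiator d brL brR).

Let Jcycle x y z : rho d (J y z x) = J x y z.
Proof.
apply: jacobiator_cycle => //.
- by move=> a x'; exact: (der_d (brM_oder a)).
- by move=> a b; exact: brM_skew.
Qed.
Let Jrot x y z : J x y z = 0 -> J z x y = 0.
Proof. by move=> h; rewrite -Jcycle h linear0. Qed.

Let J_EEE e f g : E e -> E f -> E g -> J e f g = 0.
Proof.
have half e1 e2 e3 : E e1 -> E e2 -> E e3 -> exists t, J e1 e2 e3 = lam3 (qt3 t).
  move=> E1 E2 E3; have [s1 [q1 h1]] := phom E2 E3; have [s2 [q2 h2]] := phom E1 E3.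
  have [s3 [q3 h3]] := phom E1 E2.
  have [tl1 [tr1 [p1 [hl1 hr1]]]] := chom E2 E3.
  have [tl2 [tr2 [p2 [hl2 hr2]]]] := chom E1 E3.
  have [tl3 [tr3 [p3 [hl3 hr3]]]] := chom E1 E2.
  have [|t] := jacobiator_EEE (B := brL) (B' := brR) _ brM_EE brM_EA brM_AE E1 E2 E3
    q1 h1 q2 h2 q3 h3 p1 hl1 hr1 p2 hl2 hr2 p3 hl3 hr3; first by [].
  case: hCD => [_ _ _ _ [_ _ _ /(_ _ _ _ _ _ _ _ _ _ E1 E2 E3 p1 hl1 hr1 p2 hl2 hr2 p3 hl3 hr3)
    cd6 /(_ _ _ _ _ _ _ _ _ E1 E2 E3 q1 h1 p2 hl2 hr2 p3 hl3 hr3) cd7]].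
  move=> ->; exists t; move/qt3_eq: cd6; move/qt3_eq: cd7.
  by rewrite /ins1 /ins2 /ins3 => -> ->; rewrite !subrr linear0 add0r addr0.
move=> Ee Ef Eg; have [t et] := half _ _ _ Ee Ef Eg; have [u eu] := half _ _ _ Ef Eg Ee.
(* J(f,g,e) is a multiple of lambda, so its rotation J(e,f,g) is a multiple of mu; being also a
   multiple of lambda, it vanishes. *)
move: (Jcycle e f g); rewrite eu et rho_lam rho_qt3 => /esym/eqP.
have q0 : qt3 [::] = 0 :> M3 V by exact: big_nil.
rewrite -subr_eq0 -linearN qt3N => /eqP; rewrite -[lam3 _]add0r -[X in X + lam3 _]q0 => /qt3_indep[_ t0 _].
by rewrite t0 linear0 q0 addr0.
Qed.

Let J_EEA e f a : E e -> E f -> A a -> J e f a = 0.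
Proof.
move=> Ee Ef Aa; have Eda := Ed Aa.
have [s [q h]] := phom Ef Eda; have [s' [q' h']] := phom Ee Eda.
have [s3 [q3 h3]] := phom Ee Ef; have [tl3 [tr3 [p3 [hl3 hr3]]]] := chom Ee Ef.
rewrite (jacobiator_EEA (B := brL) (B' := brR) _ brM_EE brM_EA brM_AA Ee Ef Aa
  q h q' h' q3 h3 p3 hl3 hr3) //.
(* [[e, d a]] = d<<e, d a>> by [CD1] and [CD2], so both parts are read off the representative of the
   pairing. *)
have p2 : t2eq (cb e (d a)) ([seq (d p.1, p.2) | p <- s'] ++ [seq (p.1, d p.2) | p <- s']).
  apply/qt_eq; rewrite -[LHS]/(c e (d a)); move: (cd1 Ee Eda); rewrite cd2 // linear0 addr0 => <-.
  rewrite qt_cat /p (proj1 (qt_eq _ _) q') /qt !big_map linear_sum -big_split.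
  by apply: eq_bigr => x _; rewrite Dop_tens.
have hl2 : hom2 E A [seq (d p.1, p.2) | p <- s'].
  by move=> x /mapP[y /h' [y1 y2] ->]; split=> //; exact: Ed.
have hr2 : hom2 A E [seq (p.1, d p.2) | p <- s'].
  by move=> x /mapP[y /h' [y1 y2] ->]; split=> //; exact: Ed.
case: hCD => [_ _ _ _ [_ _ _ _ cd7]].
have /qt3_eq := cd7 e f (d a) s _ _ tl3 tr3 Ee Ef Eda q h p2 hl2 hr2 p3 hl3 hr3.
by rewrite /ins1 /ins2 /ins3 => ->; rewrite subrr.
Qed.

Let J_AAx a b x : A a -> A b -> A x \/ E x -> J a b x = 0.
Proof.
move=> Aa Ab [Ax|Ex].
  by apply: (@jacobiator_AA _ _ Vg d brL brR brM_AA _ _ _ [::] [::] Aa Ab);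
    rewrite ?qt_nil //; apply: brM_AA.
have [s [q h]] := phom (Ed Ab) Ex; have [s' [q' h']] := phom (Ed Aa) Ex.
have hN t : hom2 A A t -> hom2 A A [seq (- y.1, y.2) | y <- t].
  by move=> ht y /mapP[z /ht[z1 z2] ->]; split=> //; exact: (VgN gV).
apply: (@jacobiator_AA _ _ Vg d brL brR brM_AA _ _ _ _ _ Aa Ab _ _ (hN _ h) (hN _ h')).
  by rewrite qt_opp [LHS](brM_AE Ab Ex) /p (proj1 (qt_eq _ _) q).
by rewrite qt_opp [LHS](brM_AE Aa Ex) /p (proj1 (qt_eq _ _) q').
Qed.

Lemma brM_jacobi x y z : J x y z = 0.
Proof.
apply: (@jacobiator0 _ _ d brL brR _ _ _ _ (fun x => A x \/ E x)) => //.
- by move=> a b; exact: (der_d (brM_oder a)).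
- by move=> a b b'; exact: (der_mul (brM_oder a)).
- by move=> a b; exact: brM_skew.
- move=> h hl hd hm hG; apply: (free_ind gV fV).
  + by move=> a u v hu hv; rewrite hl hu hv scaler0 addr0.
  + by move=> u v hu hv; rewrite hm hu hv !linear0 addr0.
  + by move=> u hu; rewrite hd hu linear0.
  + by move=> a Aa; apply: hG; left.
  + by move=> a Aa; apply: hG; right.
(* Rotations bring all eight cases to arguments of type A, A, anything, or E, E, A, or E, E, E. *)
- move=> a b e Ga Gb Ge; case: (Ga) (Gb) (Ge) => [Aa|Ea] [Ab|Eb] [Ae|Ee].
  + exact: J_AAx.
  + exact: J_AAx.
  + by do 2!apply: Jrot; apply: J_AAx.
  + by apply: Jrot; apply: J_EEA.
  + by apply: Jrot; apply: J_AAx.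
  + by do 2!apply: Jrot; apply: J_EEA.
  + exact: J_EEA.
  + exact: J_EEE.
Qed.

Lemma brM_degree i j v w : Vg i v -> Vg j w -> degM Vg (i + j) (brM v w).
Proof.
have dp e f : E e -> E f -> degM Vg 1 (p e f).
  move=> Ee Ef; have [t [/qt_eq q h]] := phom Ee Ef.
  by rewrite /p q; apply: (@degM_qt _ _ _ 0 0 A A).
have dc e f : E e -> E f -> degM Vg 2 (c e f).
  move=> Ee Ef; have [tl [tr [/qt_eq q [hl hr]]]] := chom Ee Ef.
  rewrite /c q qt_cat; apply: degM_D.
    by apply: (@degM_qt _ _ _ 1 0 E A).
  by apply: (@degM_qt _ _ _ 0 1 A E).
have dn n : degM Vg n 0 by exact: degM_0.
have dP n a m m' : degM Vg n m -> degM Vg n m' -> degM Vg n (a *: m + m').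
  by move=> *; apply: degM_D => //; exact: (degM_Z gV).
(* Settles the second argument for a generator e of degree n, with n = 0 or 1 in the two uses; the
   first argument follows by the same induction with the inner structure. *)
have outer e n : (forall a, A a -> degM Vg n (brM e a)) ->
    (forall f, E f -> degM Vg (n + 1) (brM e f)) ->
    forall j w, Vg j w -> degM Vg (n + j) (brM e w).
  move=> hA hE; have [bl bm bd] := brM_oder e.
  apply: (graded_ind gV fV (P := fun j w => degM Vg (n + j) (brM e w))).
  - by move=> n'; rewrite (lin_0 bl).
  - by move=> n' a x y hx hy; rewrite bl; apply: dP.
  - move=> i' j' x y Vx hx Vy hy; rewrite bm; apply: degM_D.
      by rewrite addnCA; apply: (degM_oml gV).
    by rewrite addnA; apply: (degM_omr gV).
  - by move=> i' x _ hx; rewrite bd addnS; apply: (degM_Sout gV).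
  - by move=> a Aa; rewrite addn0; apply: hA.
  - exact: hE.
move=> Vv; move: j w; move: i v Vv.
apply: (graded_ind gV fV (P := fun i v => forall j w, Vg j w -> degM Vg (i + j) (brM v w))).
- by move=> n j w _; have [bl _ _] := brM_ider w; rewrite (lin_0 bl).
- move=> n a x y hx hy j w Vw; have [bl _ _] := brM_ider w.
  by rewrite bl; apply: dP; [exact: hx|exact: hy].
- move=> i j x y Vx hx Vy hy n w Vw; have [_ bm _] := brM_ider w; rewrite bm.
  apply: degM_D; first by rewrite -addnA; apply: (degM_iml gV) => //; exact: hy.
  by rewrite addnAC; apply: (degM_imr gV) => //; exact: hx.
- move=> i x Vx hx j w Vw; have [_ _ ->] := brM_ider w.
  by rewrite addSn; apply: (degM_Sin gV); exact: hx.
- move=> a Aa j w; apply: outer => [b Ab|f Ef]; first by rewrite brM_AA.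
  by rewrite brM_AE //; apply: (degM_N gV); apply: dp => //; exact: Ed.
- move=> e Ee j w; apply: outer => [a Aa|f Ef].
    by rewrite brM_EA //; apply: dp => //; exact: Ed.
  by rewrite brM_EE //; apply: degM_D; [exact: dc|apply: degM_lam; exact: dp].
Qed.

Definition brCD x y : P2 V := projT1 (cid (q2_surj (brM x y))).
Lemma brCDE x y : q2 (brCD x y) = brM x y.
Proof. by rewrite /brCD; case: cid => P /= ->. Qed.

Lemma brCD_corresponds : corresponds Vg d pr cb brCD.
Proof.
move=> e f a b Ee Ef Aa Ab; split; apply/q2_eq; rewrite brCDE.
- by rewrite q2_cat q2_lam0 q2_lam1 brM_EE.
- by rewrite q2_lam0 brM_EA.
- by rewrite q2_lam0N brM_AE.
- by rewrite q2_nil brM_AA.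
Qed.

Lemma brCD_PVA : graded_double_PVA Vg d brCD.
Proof.
split; last first.
  move=> i j q v w Vv Vw; apply: (degM_inVV (n := i + j)).
  by rewrite brCDE; exact: brM_degree.
split.
- split.
  + apply/br_bilinP; split=> x a y z; rewrite !brCDE.
      exact: (oder_linear (brM_oder x)).
    exact: (der_lin (brM_ider x)).
  + by apply/sesq_lP => x y; rewrite !brCDE; exact: (der_d (brM_ider y)).
  + by apply/sesq_rP => x y; rewrite !brCDE; exact: (der_d (brM_oder x)).
  + by apply/leibniz_lP => x y z; rewrite !brCDE; exact: (der_mul (brM_oder x)).
  + by apply/leibniz_rP => x y z; rewrite !brCDE; exact: (der_mul (brM_ider z)).
- by apply/skewsymP => x y; rewrite !brCDE brM_skew.
- apply: ((@jacobiP _ _ d brCD brL brR _ _).2 brM_jacobi) => x y; exact: esym (brCDE _ _).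
Qed.

Lemma brCD_unique br' : double_lambda_bracket d br' -> corresponds Vg d pr cb br' ->
  forall x y, p2eq (br' x y) (brCD x y).
Proof.
move=> [/br_bilinP [bl1 bl2] /sesq_lP bl /sesq_rP br /leibniz_lP bml /leibniz_rP bmr] hco x y.
apply/q2_eq; rewrite brCDE.
have o' z : oder d (fun w => q2 (br' z w)) by split; [exact: bl1|exact: bml|exact: br].
have i' w : ider d (fun z => q2 (br' z w)).
  by split; [exact: bl2|move=> *; exact: bmr|move=> *; exact: bl].
have gen z : A z \/ E z -> forall w, q2 (br' z w) = brM z w.
  (* [corresponds] asks for two elements of E and two of A at once; zeros fill the places not at
     issue. *)
  have E0 : E 0 by exact: (Vg0 gV).
  have A0 : A 0 by exact: (Vg0 gV).
  move=> Gz; apply: (oder_eq gV fV (o' z) (brM_oder z)) => w Gw; case: Gz => Gz.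
  - by have [_ _ _ /q2_eq ->] := hco _ _ _ _ E0 E0 Gz Gw; rewrite brM_AA // q2_nil.
  - by have [_ /q2_eq -> _ _] := hco _ _ _ _ Gz E0 Gw A0; rewrite brM_EA // q2_lam0.
  - by have [_ _ /q2_eq -> _] := hco _ _ _ _ Gw E0 Gz A0; rewrite brM_AE // q2_lam0N.
  - have [/q2_eq -> _ _ _] := hco _ _ _ _ Gz Gw A0 A0.
    by rewrite brM_EE // q2_cat q2_lam0 q2_lam1.
move: x; apply: (ider_eq gV fV (i' y) (brM_ider y)) => x Gx.
  by apply: gen; left.
by apply: gen; right.
Qed.
End FromCD.

(** * The algebra V(A, E, d) *)

Section PolynomialAlgebra.
Variables (k : fieldType) (V : algType k).

(* {poly V} as an algebra over k (it is registered only over V). *)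
Definition kpoly := {poly V}.
HB.instance Definition _ := GRing.NzRing.on kpoly.
Definition kpscale (c : k) (p : kpoly) : kpoly := (c%:A : V) *: (p : {poly V}).
Lemma coef_kpscale c p i : (kpscale c p)`_i = c *: p`_i.
Proof. by rewrite coefZ mulr_algl. Qed.
Lemma kpscaleA a b v : kpscale a (kpscale b v) = kpscale (a * b) v.
Proof. by apply/polyP => i; rewrite !coef_kpscale scalerA. Qed.
Lemma kpscale1 : left_id 1 kpscale.
Proof. by move=> v; apply/polyP => i; rewrite coef_kpscale scale1r. Qed.
Lemma kpscaleDr : right_distributive kpscale +%R.
Proof. by move=> a u v; apply/polyP => i; rewrite !(coefD, coef_kpscale) scalerDr. Qed.
Lemma kpscaleDl v : {morph kpscale^~ v : a b / a + b}.
Proof. by move=> a b; apply/polyP => i; rewrite !(coefD, coef_kpscale) scalerDl. Qed.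
HB.instance Definition _ :=
  GRing.Zmodule_isLmodule.Build k kpoly kpscaleA kpscale1 kpscaleDr kpscaleDl.
Lemma kpscaleAl (c : k) (p q : kpoly) : c *: (p * q) = (c *: p) * q.
Proof.
apply/polyP => i; rewrite [LHS]coef_kpscale !coefM scaler_sumr; apply: eq_bigr => j _.
by rewrite -[RHS]/((kpscale c p)`_j * _) coef_kpscale scalerAl.
Qed.
HB.instance Definition _ := GRing.Lmodule_isLalgebra.Build k kpoly kpscaleAl.
Lemma kpscaleAr (c : k) (p q : kpoly) : c *: (p * q) = p * (c *: q).
Proof.
apply/polyP => i; rewrite [LHS]coef_kpscale !coefM scaler_sumr; apply: eq_bigr => j _.
by rewrite -[RHS]/(_ * (kpscale c q)`_(i - j)) coef_kpscale scalerAr.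
Qed.
HB.instance Definition _ := GRing.Lalgebra_isAlgebra.Build k kpoly kpscaleAr.

Lemma coefkZ (c : k) (p : kpoly) i : (c *: p)`_i = c *: p`_i.
Proof. exact: coef_kpscale. Qed.

Variable d : {linear V -> V}.
Hypothesis hd : forall x y, d (x * y) = d x * y + x * d y.
(** The factor 'X records that the differential has degree 1, so that the map marking degrees by
    powers of 'X respects differentials. *)
Definition kpder (p : kpoly) : kpoly := 'X * map_poly d p.
Lemma coef_kpder p i : (kpder p)`_i = if i is j.+1 then d p`_j else 0.
Proof.
by case: i => [|i]; rewrite coefXM //= coef_map_id0 // linear0.
Qed.
Lemma kpder_lin (c : k) x y : kpder (c *: x + y) = c *: kpder x + kpder y.
Proof.
apply/polyP => i; rewrite coefD coefkZ !coef_kpder.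
by case: i => [|i]; rewrite ?scaler0 ?addr0 // coefD coefkZ linearP.
Qed.
Lemma kpder_mul (x y : kpoly) : kpder (x * y) = kpder x * y + x * kpder y.
Proof.
have XC : x * 'X = 'X * x by exact: commr_polyX.
rewrite /kpder mulrA XC -!mulrA -mulrDr; congr (_ * _).
apply/polyP => i; rewrite coefD coef_map_id0 ?linear0 // !coefM linear_sum -big_split.
by apply: eq_bigr => j _; rewrite !coef_map_id0 ?linear0 // hd.
Qed.
Lemma kpder_mon (v : V) n : kpder (v%:P * 'X^n) = (d v)%:P * 'X^(n.+1).
Proof.
apply/polyP => i; rewrite coef_kpder coefCM coefXn; case: i => [|i]; first by rewrite mulr0.
by rewrite coefCM coefXn eqSS; case: eqP; rewrite ?mulr1 // !mulr0 linear0.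
Qed.
End PolynomialAlgebra.

(** * Differential terms and their models *)

Inductive dterm (k A E : Type) : Type :=
| TmA of A
| TmE of E
| TmLin of k & dterm k A E & dterm k A E
| TmMul of dterm k A E & dterm k A E
| TmD of dterm k A E.
Arguments TmA {k A E}.
Arguments TmE {k A E}.

Section UniversalAlgebra.
Variables (k : fieldType) (A : algType k) (E : lmodType k).
Variables (la : A -> E -> E) (ra : E -> A -> E) (dA : A -> E).
Hypothesis bimA : bimodule_with_derivation la ra dA.

Record model (W : algType k) (D : W -> W) (p0 : A -> W) (p1 : E -> W) : Prop := {
  mod_D : linear D;
  mod_DM : forall x y, D (x * y) = D x * y + x * D y;
  mod_0 : linear p0;
  mod_0M : forall a b, p0 (a * b) = p0 a * p0 b;
  mod_01 : p0 1 = 1;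
  mod_1 : linear p1;
  mod_1M : forall a e b, p1 (ra (la a e) b) = p0 a * p1 e * p0 b;
  mod_0d : forall a, D (p0 a) = p1 (dA a)
}.

Local Notation term := (dterm k A E).
Fixpoint teval (W : algType k) (D : W -> W) (p0 : A -> W) (p1 : E -> W) (t : term) : W :=
  match t with
  | TmA a => p0 a
  | TmE e => p1 e
  | TmLin c s t => c *: teval D p0 p1 s + teval D p0 p1 t
  | TmMul s t => teval D p0 p1 s * teval D p0 p1 t
  | TmD t => D (teval D p0 p1 t)
  end.

Definition teq (s t : term) : Prop :=
  forall (W : algType k) (D : W -> W) (p0 : A -> W) (p1 : E -> W),
    model D p0 p1 -> teval D p0 p1 s = teval D p0 p1 t.

(* V(A, E, d): differential terms modulo equality in all models. *)
Definition univ of bimodule_with_derivation la ra dA := quo teq.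
Local Notation U := (univ bimA).
HB.instance Definition _ := Choice.copy U (quo teq).
Definition tcl : term -> U := @cls _ teq.

Lemma teqP s t : tcl s = tcl t <-> teq s t.
Proof. by apply: clsP => [u|u v uv|u v w uv vw] W D p0 p1 h; rewrite ?uv ?vw. Qed.
Lemma trepK (x : U) : tcl (rep x) = x. Proof. exact: repK. Qed.

Section Evaluation.
Variables (W : algType k) (D : W -> W) (p0 : A -> W) (p1 : E -> W).
Definition uev (x : U) : W := teval D p0 p1 (rep x).
Hypothesis h : model D p0 p1.
Lemma uev_cl t : uev (tcl t) = teval D p0 p1 t.
Proof.
have : teq (rep (tcl t)) t by apply/teqP; rewrite trepK.
exact.
Qed.
End Evaluation.

Lemma univ_eq (x y : U) :
  (forall (W : algType k) (D : W -> W) p0 p1, model D p0 p1 ->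
     uev D p0 p1 x = uev D p0 p1 y) -> x = y.
Proof. by move=> h; rewrite -[x]trepK -[y]trepK; apply/teqP. Qed.

Definition uzero : U := tcl (TmA 0).
Definition uone : U := tcl (TmA 1).
Definition uadd (x y : U) : U := tcl (TmLin 1 (rep x) (rep y)).
Definition uscale c (x : U) : U := tcl (TmLin c (rep x) (TmA 0)).
Definition uopp (x : U) : U := uscale (-1) x.
Definition umul (x y : U) : U := tcl (TmMul (rep x) (rep y)).
Definition uder (x : U) : U := tcl (TmD (rep x)).
Definition uA (a : A) : U := tcl (TmA a).
Definition uE (e : E) : U := tcl (TmE e).

Section EvaluationRules.
Variables (W : algType k) (D : W -> W) (p0 : A -> W) (p1 : E -> W).
Hypothesis h : model D p0 p1.
Local Notation ev := (uev D p0 p1).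
Lemma uev_add x y : ev (uadd x y) = ev x + ev y.
Proof. by rewrite uev_cl //= scale1r. Qed.
Lemma uev_zero : ev uzero = 0.
Proof. by rewrite uev_cl //= (lin_0 (mod_0 h)). Qed.
Lemma uev_one : ev uone = 1.
Proof. by rewrite uev_cl //= (mod_01 h). Qed.
Lemma uev_scale c x : ev (uscale c x) = c *: ev x.
Proof. by rewrite uev_cl //= (lin_0 (mod_0 h)) addr0. Qed.
Lemma uev_opp x : ev (uopp x) = - ev x.
Proof. by rewrite uev_scale scaleN1r. Qed.
Lemma uev_mul x y : ev (umul x y) = ev x * ev y.
Proof. by rewrite uev_cl. Qed.
Lemma uev_der x : ev (uder x) = D (ev x).
Proof. by rewrite uev_cl. Qed.
Lemma uev_A a : ev (uA a) = p0 a. Proof. by rewrite uev_cl. Qed.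
Lemma uev_E e : ev (uE e) = p1 e. Proof. by rewrite uev_cl. Qed.
End EvaluationRules.

Let evE W D p0 p1 (h : @model W D p0 p1) := (uev_add h, uev_zero h, uev_one h,
  uev_scale h, uev_opp h, uev_mul h, uev_der h, uev_A h, uev_E h).

Lemma uaddA : associative uadd.
Proof. by move=> x y z; apply: univ_eq => W D p0 p1 h; rewrite !(evE h) addrA. Qed.
Lemma uaddC : commutative uadd.
Proof. by move=> x y; apply: univ_eq => W D p0 p1 h; rewrite !(evE h) addrC. Qed.
Lemma uadd0 : left_id uzero uadd.
Proof. by move=> x; apply: univ_eq => W D p0 p1 h; rewrite !(evE h) add0r. Qed.
Lemma uaddN : left_inverse uzero uopp uadd.
Proof. by move=> x; apply: univ_eq => W D p0 p1 h; rewrite !(evE h) addNr. Qed.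
HB.instance Definition _ := GRing.isZmodule.Build U uaddA uaddC uadd0 uaddN.

Lemma uscaleA a b v : uscale a (uscale b v) = uscale (a * b) v.
Proof. by apply: univ_eq => W D p0 p1 h; rewrite !(evE h) scalerA. Qed.
Lemma uscale1 : left_id 1 uscale.
Proof. by move=> v; apply: univ_eq => W D p0 p1 h; rewrite !(evE h) scale1r. Qed.
Lemma uscaleDr : right_distributive uscale +%R.
Proof. by move=> a u v; apply: univ_eq => W D p0 p1 h; rewrite !(evE h) scalerDr. Qed.
Lemma uscaleDl v : {morph uscale^~ v : a b / a + b}.
Proof. by move=> a b; apply: univ_eq => W D p0 p1 h; rewrite !(evE h) scalerDl. Qed.
HB.instance Definition _ :=
  GRing.Zmodule_isLmodule.Build k U uscaleA uscale1 uscaleDr uscaleDl.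

Lemma bimA_bimodule : bimodule la (fun a e => ra e a).
Proof.
case: bimA => h1 h2 h3 h4 _; split.
- by move=> e c a b; case: (h1 c a b e).
- by move=> a c e f; case: (h2 c a e f).
- by move=> e c a b; case: (h1 c a b e).
- by move=> a c e f; case: (h2 c a e f).
- by move=> a b e; case: (h3 a b e).
- by move=> a b e; case: (h3 a b e) => _ [].
- by move=> a b e; case: (h3 a b e) => _ [].
- by move=> e; case: (h4 e).
- by move=> e; case: (h4 e).
Qed.

(* The square-zero extension A (+) E, which shows that A and E embed. *)
Local Notation S := (sqzero bimA_bimodule).
Definition sqder (x : S) : S := (0, dA x.1).
Definition sqA (a : A) : S := (a, 0).
Definition sqE (e : E) : S := (0, e).
Lemma sqzero_model : model sqder sqA sqE.
Proof.
have B := bimA_bimodule; have [_ _ _ _ [dl dM]] := bimA.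
have l0 a : la a 0 = 0 by exact: (lin_0 (bim_lr B a)).
have r0 a : ra 0 a = 0 by exact: (lin_0 (bim_rr B a)).
have l0' e : la 0 e = 0 by exact: (lin_0 (bim_ll B e)).
have r0' e : ra e 0 = 0 by exact: (lin_0 (bim_rl B e)).
split.
- by move=> c x y; congr pair; rewrite /= ?scaler0 ?addr0 // dl.
- move=> x y; rewrite !sqmulE /=; congr pair; rewrite /= ?mul0r ?mulr0 ?addr0 //.
  by rewrite dM l0' r0' add0r addr0.
- by move=> c a b; congr pair; rewrite /= ?scaler0 ?addr0.
- by move=> a b; rewrite sqmulE; congr pair; rewrite /= l0 r0 addr0.
- by [].
- by move=> c e f; congr pair; rewrite /= ?scaler0 ?addr0.
- move=> a e b; rewrite !sqmulE /=; congr pair; rewrite ?mulr0 ?mul0r //.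
  by rewrite l0 r0 add0r addr0.
- by [].
Qed.

Lemma umulA : associative umul.
Proof. by move=> x y z; apply: univ_eq => W D p0 p1 h; rewrite !(evE h) mulrA. Qed.
Lemma umul1l : left_id uone umul.
Proof. by move=> x; apply: univ_eq => W D p0 p1 h; rewrite !(evE h) mul1r. Qed.
Lemma umul1r : right_id uone umul.
Proof. by move=> x; apply: univ_eq => W D p0 p1 h; rewrite !(evE h) mulr1. Qed.
Lemma umulDl : left_distributive umul +%R.
Proof. by move=> x y z; apply: univ_eq => W D p0 p1 h; rewrite !(evE h) mulrDl. Qed.
Lemma umulDr : right_distributive umul +%R.
Proof. by move=> x y z; apply: univ_eq => W D p0 p1 h; rewrite !(evE h) mulrDr. Qed.
(** All identities hold in U because they hold in every model, but an inequality needs one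
    nontrivial model: the square-zero extension. *)
Lemma uone_neq0 : uone != 0.
Proof.
apply/eqP => /(congr1 (uev sqder sqA sqE)).
by rewrite !(evE sqzero_model) => /eqP; rewrite oner_eq0.
Qed.
HB.instance Definition _ := GRing.Zmodule_isNzRing.Build U
  umulA umul1l umul1r umulDl umulDr uone_neq0.
Lemma uscaleAl (c : k) (x y : U) : c *: (x * y) = (c *: x) * y.
Proof. by apply: univ_eq => W D p0 p1 h; rewrite !(evE h) scalerAl. Qed.
HB.instance Definition _ := GRing.Lmodule_isLalgebra.Build k U uscaleAl.
Lemma uscaleAr (c : k) (x y : U) : c *: (x * y) = x * (c *: y).
Proof. by apply: univ_eq => W D p0 p1 h; rewrite !(evE h) scalerAr. Qed.
HB.instance Definition _ := GRing.Lalgebra_isAlgebra.Build k U uscaleAr.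

Lemma uder_linear : linear (uder : U -> U).
Proof.
by move=> c x y; apply: univ_eq => W D p0 p1 h; rewrite !(evE h) (mod_D h).
Qed.
Definition ud : {linear U -> U} := mklin uder_linear.

Lemma univ_model : model ud uA uE.
Proof.
split.
- exact: linearP.
- by move=> x y; apply: univ_eq => W D p0 p1 h; rewrite !(evE h) (mod_DM h).
- by move=> c a b; apply: univ_eq => W D p0 p1 h; rewrite !(evE h) (mod_0 h).
- by move=> a b; apply: univ_eq => W D p0 p1 h; rewrite !(evE h) (mod_0M h).
- by [].
- by move=> c a b; apply: univ_eq => W D p0 p1 h; rewrite !(evE h) (mod_1 h).
- by move=> a e b; apply: univ_eq => W D p0 p1 h; rewrite !(evE h) (mod_1M h).
- by move=> a; apply: univ_eq => W D p0 p1 h; rewrite !(evE h) (mod_0d h).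
Qed.

Section Hom.
Variables (W : algType k) (D : W -> W) (p0 : A -> W) (p1 : E -> W).
Hypothesis h : model D p0 p1.
Lemma uevP : linear (uev D p0 p1 : U -> W). Proof. by move=> c x y; rewrite !(evE h). Qed.
Lemma uevM (x y : U) : uev D p0 p1 (x * y) = uev D p0 p1 x * uev D p0 p1 y.
Proof. exact: uev_mul. Qed.
Lemma uev1 : uev D p0 p1 (1 : U) = 1. Proof. exact: uev_one. Qed.
Lemma uevd (x : U) : uev D p0 p1 (ud x) = D (uev D p0 p1 x). Proof. exact: uev_der. Qed.
End Hom.

Lemma univ_ind (P : U -> Prop) :
  (forall c x y, P x -> P y -> P (c *: x + y)) -> (forall x y, P x -> P y -> P (x * y)) ->
  (forall x, P x -> P (ud x)) -> (forall a, (exists b, a = uA b) -> P a) ->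
  (forall e, (exists f, e = uE f) -> P e) -> forall x, P x.
Proof.
move=> Plin PM Pd PA PE x; rewrite -[x]trepK.
elim: (rep x) => [a|e|c s hs t ht|s hs t ht|t ht].
- by apply: PA; exists a.
- by apply: PE; exists e.
- suff -> : tcl (TmLin c s t) = c *: tcl s + tcl t by exact: Plin.
  by apply: univ_eq => W D p0 p1 h; rewrite !(evE h) !uev_cl.
- suff -> : tcl (TmMul s t) = tcl s * tcl t by exact: PM.
  by apply: univ_eq => W D p0 p1 h; rewrite !(evE h) !uev_cl.
- suff -> : tcl (TmD t) = ud (tcl t) by exact: Pd.
  by apply: univ_eq => W D p0 p1 h; rewrite !(evE h) !uev_cl.
Qed.

Lemma uA_inj : injective uA.
Proof.
move=> a b /(congr1 (uev sqder sqA sqE)).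
by rewrite !(evE sqzero_model) => /(congr1 fst).
Qed.
Lemma uE_inj : injective uE.
Proof.
move=> a b /(congr1 (uev sqder sqA sqE)).
by rewrite !(evE sqzero_model) => /(congr1 snd).
Qed.

(* The grading is read off the map to U[t] that puts E in degree 1. *)
Definition grA (a : A) : kpoly U := (uA a)%:P : {poly U}.
Definition grE (e : E) : kpoly U := (uE e)%:P * 'X : {poly U}.
Lemma udM x y : ud (x * y) = ud x * y + x * ud y.
Proof. exact: (mod_DM univ_model). Qed.
Lemma grading_model : model (kpder ud) grA grE.
Proof.
have M := univ_model; split.
- exact: kpder_lin.
- exact: (kpder_mul udM).
- move=> c a b; apply/polyP => i; rewrite coefD coefkZ !coefC (mod_0 M).
  by case: eqP => // _; rewrite scaler0 addr0.
- by move=> a b; rewrite /grA (mod_0M M) polyCM.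
- by rewrite /grA (mod_01 M).
- move=> c a b; apply/polyP => i; rewrite coefD coefkZ !coefCM coefX (mod_1 M).
  by case: eqP => // _; rewrite ?mulr1 // !mulr0 scaler0 addr0.
- move=> a e b; rewrite /grA /grE (mod_1M M) !polyCM -!mulrA; congr (_ * (_ * _)).
  exact: commr_polyX.
- by move=> a; rewrite -[grA a]mulr1 -[1]/('X^0) kpder_mon (mod_0d M).
Qed.
Definition gr : U -> kpoly U := uev (kpder ud) grA grE.
(** In this form independence of the degrees is a comparison of coefficients; that homogeneous
    elements span is left to induction on terms. *)
Definition Ug n (x : U) : Prop := gr x = x%:P * 'X^n :> {poly U}.

Lemma gr_linear : linear gr. Proof. exact: (uevP grading_model). Qed.

Lemma UgP n (c : k) x y : Ug n x -> Ug n y -> Ug n (c *: x + y).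
Proof.
rewrite /Ug => hx hy; rewrite gr_linear hx hy; apply/polyP => i.
rewrite coefD coefkZ !coefCM coefXn.
by case: eqP => // _; rewrite ?mulr1 // !mulr0 scaler0 addr0.
Qed.
Lemma Ug0 n : Ug n 0.
Proof. by rewrite /Ug (lin_0 gr_linear) polyC0 mul0r. Qed.
Lemma UgM i j x y : Ug i x -> Ug j y -> Ug (i + j) (x * y).
Proof.
rewrite /Ug /gr (uevM grading_model) => -> ->.
rewrite polyCM exprD -!mulrA; congr (_ * _); rewrite !mulrA; congr (_ * _).
exact/esym/commr_polyXn.
Qed.
Lemma Ugd i x : Ug i x -> Ug i.+1 (ud x).
Proof. by rewrite /Ug /gr (uevd grading_model) => ->; rewrite kpder_mon. Qed.
Lemma UgA a : Ug 0 (uA a).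
Proof. by rewrite /Ug /gr (uev_A grading_model) mulr1. Qed.
Lemma UgE e : Ug 1 (uE e).
Proof. by rewrite /Ug /gr (uev_E grading_model). Qed.

(** Degrees 0 and 1 must consist of A and E alone. The strengthened condition survives products and
    d, since degree 1 arises only as 0 + 1, as 1 + 0, or by differentiating degree 0. *)
Definition Ug' n (x : U) : Prop := [/\ Ug n x, n = 0%N -> exists a, x = uA a &
  n = 1%N -> exists e, x = uE e].

Lemma Ug'P n (c : k) x y : Ug' n x -> Ug' n y -> Ug' n (c *: x + y).
Proof.
move=> [hx x0 x1] [hy y0 y1]; split; first exact: UgP.
  by move=> n0; have [a ->] := x0 n0; have [b ->] := y0 n0; exists (c *: a + b);
    rewrite (mod_0 univ_model).
by move=> n1; have [a ->] := x1 n1; have [b ->] := y1 n1; exists (c *: a + b);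
  rewrite (mod_1 univ_model).
Qed.
Lemma Ug'0 n : Ug' n 0.
Proof.
split; first exact: Ug0.
  by exists 0; rewrite (lin_0 (mod_0 univ_model)).
by exists 0; rewrite (lin_0 (mod_1 univ_model)).
Qed.

Lemma Ug'_span x : exists s : seq (nat * U),
  (forall t, t \in s -> Ug' t.1 t.2) /\ x = \sum_(t <- s) t.2.
Proof.
have M := univ_model.
move: x; apply: (homogeneous_span univ_ind).
- by move=> n c x hx; rewrite -[_ *: _]addr0; apply: Ug'P => //; exact: Ug'0.
- move=> i j x y [hx x0 x1] [hy y0 y1]; split; first exact: UgM.
    case: i j x0 y0 {x1 y1 hx hy} => [|i] [|j] //= x0 y0 _.
    by have [a ->] := x0 erefl; have [b ->] := y0 erefl; exists (a * b); rewrite (mod_0M M).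
  case: i j x0 x1 y0 y1 {hx hy} => [|[|i]] [|[|j]] //= x0 x1 y0 y1 _.
    have [a ->] := x0 erefl; have [e ->] := y1 erefl; exists (la a e).
    by rewrite -[la a e](bim_r1 bimA_bimodule) (mod_1M M) (mod_01 M) mulr1.
  have [e ->] := x1 erefl; have [a ->] := y0 erefl; exists (ra e a).
  by rewrite -[e in ra e a](bim_l1 bimA_bimodule) (mod_1M M) (mod_01 M) mul1r.
- move=> i x [hx x0 x1]; split=> //; first exact: Ugd.
  by case=> i0; have [a ->] := x0 i0; exists (dA a); rewrite (mod_0d M).
- by move=> _ [a ->]; split=> // [|_]; [exact: UgA|exists a].
- by move=> _ [e ->]; split=> // [|_]; [exact: UgE|exists e].
Qed.

Lemma coef_gr n x i : Ug n x -> (gr x : {poly U})`_i = if i == n then x else 0.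
Proof. by move=> ->; rewrite coefCM coefXn; case: eqP; rewrite ?mulr1 ?mulr0. Qed.

(** The coefficient of 'X^n in [gr x] is x; computed on a decomposition of x into strengthened
    homogeneous elements, it keeps those of degree n. *)
Lemma Ug_Ug' n x : Ug n x -> Ug' n x.
Proof.
move=> hx; have [s [hs xE]] := Ug'_span x.
have := congr1 (fun y => (gr y : {poly U})`_n) xE.
rewrite (coef_gr _ hx) eqxx (lin_sum gr_linear) coef_sum => ->.
rewrite big_seq_cond; apply: big_ind => [|y z hy hz|t /andP[/hs ht _]].
- exact: Ug'0.
- by rewrite -[y]scale1r; apply: Ug'P.
- by case: (ht) => h _ _; rewrite (coef_gr _ h); case: eqP => [->|_] //; exact: Ug'0.
Qed.

Lemma univ_graded : graded_diff_alg Ug ud.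
Proof.
split; first split.
- by move=> n; split; [exact: Ug0|exact: UgP].
- move=> v; have [s [hs vE]] := Ug'_span v.
  pose N := (\max_(t <- s) t.1).+1.
  exists N, (fun i => \sum_(t <- s | t.1 == i) t.2); split.
    move=> i; rewrite big_seq_cond; apply: big_ind => [|y z hy hz|t /andP[/hs [h _ _] /eqP <-]] //.
      exact: Ug0.
    by rewrite -[y]scale1r; apply: UgP.
  rewrite vE; under [RHS]eq_bigr do rewrite big_mkcond.
  rewrite exchange_big; apply: eq_big_seq => t ts /=.
  have tN : (t.1 < N)%N by rewrite ltnS (leq_bigmax_seq _ ts).
  by rewrite -big_mkcond (big_pred1 (Ordinal tN)).
- move=> N c hc c0 i iN.
  have := congr1 (fun y => (gr y : {poly U})`_i) c0.
  rewrite (lin_0 gr_linear) coef0 (lin_sum gr_linear) coef_sum (bigD1 (Ordinal iN)) //=.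
  rewrite (coef_gr _ (hc i)) eqxx big1 ?addr0 // => j /negP ji.
  rewrite (coef_gr _ (hc j)); case: eqP => // ij.
  by case: ji; apply/eqP/val_inj.
- exact: UgM.
- by split; [exact: linearP|exact: udM].
- exact: Ugd.
Qed.

(** Evaluation in the target gives existence, induction on terms uniqueness. [Ug_Ug'] ensures that
    the values are prescribed on nothing but the images of A and E. *)
Lemma univ_free : freely_generated Ug ud.
Proof.
move=> W D psi0 psi1 Dl DM h0 h0M h01 h1 h1M h0d.
have M := univ_model.
have m : model D (psi0 \o uA) (psi1 \o uE).
  split=> //=.
  - by move=> c a b; rewrite /= (mod_0 M) h0 //; exact: UgA.
  - by move=> a b; rewrite /= (mod_0M M) h0M //; exact: UgA.
  - by move=> c a b; rewrite /= (mod_1 M) h1 //; exact: UgE.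
  - by move=> a e b; rewrite /= (mod_1M M) h1M //; [exact: UgA|exact: UgE|exact: UgA].
  - by move=> a; rewrite /= h0d ?(mod_0d M) //; exact: UgA.
exists (uev D (psi0 \o uA) (psi1 \o uE)); split.
  split.
  - exact: (uevP m).
  - by split; [exact: (uevM m)|exact: (uev1 m)].
  - exact: (uevd m).
  - by move=> x /Ug_Ug' [_ /(_ erefl) [a ->] _]; rewrite (uev_A m).
  - by move=> x /Ug_Ug' [_ _ /(_ erefl) [e ->]]; rewrite (uev_E m).
move=> P [Pl [PM P1] Pd PA PE]; apply: univ_ind.
- by move=> c x y hx hy; rewrite Pl hx hy (uevP m).
- by move=> x y hx hy; rewrite PM hx hy (uevM m).
- by move=> x hx; rewrite Pd hx (uevd m).
- by move=> _ [a ->]; rewrite PA ?(uev_A m) //; exact: UgA.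
- by move=> _ [e ->]; rewrite PE ?(uev_E m) //; exact: UgE.
Qed.
End UniversalAlgebra.

(** The two passages are mutually inverse up to equality of tensors: [corresponds] displays the
    pairing and the bracket on E as the coefficients of lambda and 1, hence determined by the
    lambda-bracket, while the last clause determines the lambda-bracket from them. *)
Theorem theorem6p1 (k : fieldType) (char0 : [pchar k] =i pred0) :
  (* every (A, E, d) is (V_0, V_1, d|) for some freely generated V *)
  (forall (A : algType k) (E : lmodType k) (la : A -> E -> E) (ra : E -> A -> E)
          (dA : A -> E),
     bimodule_with_derivation la ra dA ->
     exists (V : algType k) (Vg : nat -> V -> Prop) (d : V -> V),
       [/\ graded_diff_alg Vg d, freely_generated Vg d &
        exists (i0 : A -> V) (i1 : E -> V),
          [/\ injective i0, injective i1,
              (forall v, Vg 0%N v <-> exists a, v = i0 a),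
              (forall v, Vg 1%N v <-> exists e, v = i1 e) &
              [/\ (forall (c : k) a b, i0 (c *: a + b) = c *: i0 a + i0 b),
                  (forall a b, i0 (a * b) = i0 a * i0 b) /\ i0 1 = 1,
                  (forall (c : k) e f, i1 (c *: e + f) = c *: i1 e + i1 f),
                  (forall a e b, i1 (ra (la a e) b) = i0 a * i1 e * i0 b) &
                  (forall a, d (i0 a) = i1 (dA a))]]]) /\
  (* on a freely generated V: graded double PVAs <-> double CD algebras *)
  (forall (V : algType k) (Vg : nat -> V -> Prop) (d : V -> V),
     graded_diff_alg Vg d -> freely_generated Vg d ->
     (forall br : V -> V -> P2 V, graded_double_PVA Vg d br ->
        exists pr cb : V -> V -> T2 V, double_CD Vg d pr cb /\ corresponds Vg d pr cb br) /\
     (forall pr cb : V -> V -> T2 V, double_CD Vg d pr cb ->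
        exists br : V -> V -> P2 V,
          [/\ graded_double_PVA Vg d br, corresponds Vg d pr cb br &
              forall br' : V -> V -> P2 V, double_lambda_bracket d br' ->
                corresponds Vg d pr cb br' -> forall x y, p2eq (br' x y) (br x y)])).
Proof.
split.
  move=> A E la ra dA h.
  exists (univ h), (@Ug k A E la ra dA h), (ud h).
  split; [exact: univ_graded|exact: univ_free|].
  have M := univ_model h.
  exists (@uA k A E la ra dA h), (@uE k A E la ra dA h); split.
  - exact: uA_inj.
  - exact: uE_inj.
  - move=> v; split=> [/Ug_Ug'[_ /(_ erefl) h0 _] //|[a ->]]; exact: UgA.
  - move=> v; split=> [/Ug_Ug'[_ _ /(_ erefl) h0] //|[e ->]]; exact: UgE.
  - split.
    + exact: (mod_0 M).
    + by split; [exact: (mod_0M M)|exact: (mod_01 M)].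
    + exact: (mod_1 M).
    + exact: (mod_1M M).
    + exact: (mod_0d M).
move=> V Vg d gV fV; have [_ [dl _] _] := gV.
pose D : {linear V -> V} := mklin (dl : linear d).
split=> [br hbr|pr cb hCD].
  exact: (@CD_of_PVA k V Vg D gV br hbr).
exists (@brCD k V Vg D gV fV pr cb hCD); split.
- exact: (@brCD_PVA k V Vg D gV fV pr cb hCD).
- exact: (@brCD_corresponds k V Vg D gV fV pr cb hCD).
- exact: (@brCD_unique k V Vg D gV fV pr cb hCD).
Qed.
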